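(* Let $(M,Q,h)$ be a sub-Riemannian structure with associated bundle map $g:T^*M\to TM$, and let $c:I=[a,b]\to M$ be a continuous piecewise curve tangent to $Q$. Then $c$ is an abnormal extremal if and only if there exists a nowhere vanishing continuous piecewise section $\psi$ of $Q^0$ along $c$ which is parallel with respect to a $Q$-adapted $g$-connection $\nabla$ (that is, parallel along a piecewise $g$-admissible curve with base curve $c$).
   Context: All manifolds are real, Hausdorff, second countable and $C^\infty$; $\mathcal X(M)$, $\mathcal X^*(M)$, $\mathcal F(M)$ denote smooth vector fields, one-forms and functions. A sub-Riemannian structure $(M,Q,h)$ consists of a smooth manifold $M$, a smooth constant-rank distribution $Q\subset TM$, assumed not integrable (not involutive), and a smooth Riemannian bundle metric $h$ on $Q$. With $i:Q\hookrightarrow TM$ the inclusion, $i^*:T^*M\to Q^*$ its adjoint, and $\sharp_h:Q^*\to Q$ the inverse of $X\mapsto h(X,\cdot)$, put $g=i\circ\sharp_h\circ i^*:T^*M\to TM$; its image is $Q$ and its kernel is the annihilator $Q^0$. Curves: a curve is a smooth map from a closed interval admitting a smooth extension to an open interval. A piecewise curve $c:[a,b]\to P$ is a map with a finite subdivision $a=a_1<\dots<a_{k+1}=b$ such that $c$ is left continuous at $a_2,\dots,a_{k+1}$, the right limits at $a_1,\dots,a_k$ exist (equal to $c(a)$ at $a_1=a$), and each $c^i:[a_i,a_{i+1}]\to P$ (equal to $c$ on $]a_i,a_{i+1}]$ and to the right limit at $a_i$) is a curve. A continuous piecewise curve is a piecewise curve that is continuous. It is tangent to $Q$ if $\dot c(t)\in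 Q_{c(t)}$ wherever $\dot c(t)$ exists. A piecewise curve $\alpha$ in $T^*M$ is $g$-admissible with base curve $c=\pi_M\circ\alpha$ ($\pi_M:T^*M\to M$ the projection) if $c$ is a continuous piecewise curve and $g(\alpha^i(t))=\dot c^i(t)$ on each $[a_i,a_{i+1}]$. A $g$-connection is a map $\nabla:\mathcal X^*(M)\times\mathcal X^*(M)\to\mathcal X^*(M)$ which is $\mathbb R$-bilinear, $\mathcal F(M)$-linear in the first argument, and satisfies $\nabla_\alpha(f\beta)=f\nabla_\alpha\beta+g(\alpha)(f)\beta$. It is $Q$-adapted if $\nabla_\alpha\eta=\delta^B_{g(\alpha)}\eta:=i_{g(\alpha)}d\eta$ for all $\alpha\in\mathcal X^*(M)$, $\eta\in\Gamma(Q^0)$. For a (smooth) $g$-admissible curve $\alpha$ with base curve $c$, $\nabla_\alpha$ is the operator on sections $\sigma$ of $T^*M$ along $c$ that is $\mathbb R$-linear, satisfies $\nabla_\alpha(f\sigma)=\dot f\sigma+f\nabla_\alpha\sigma$, and $\nabla_\alpha\sigma(t)=\nabla_{\alpha(t)}\overline\sigma$ whenever $\overline\sigma$ is a one-form with $\overline\sigma(c(t))=\sigma(t)$ for all $t$. A continuous piecewise section $\psi$ along the base curve $c$ of a piecewise $g$-admissible $\alpha$ is parallel along $\alpha$ if $\nabla_{\alpha^i}\psi^i(t)=0$ on each smooth piece. For $\eta_x\in Q^0_x$, $X_x\in Q_x$ and $Y\in\mathcal X(M)$, $\langle\eta_x,[X_x,Y]\rangle:=\langle\eta,[X,Y]\rangle(x)$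 for any sections $\eta\in\Gamma(Q^0)$, $X\in\Gamma(Q)$ extending $\eta_x,X_x$ (independent of choices). A continuous piecewise curve $c$ tangent to $Q$ is an abnormal extremal if there is a continuous piecewise curve $\psi$ in $T^*M$ along $c$, not meeting the zero section, with $\psi(t)\in Q^0$ for all $t$ and such that, for any piecewise $g$-admissible curve $\alpha$ with base curve $c$, $\frac{d}{dt}\langle\psi(t),X(c(t))\rangle=\langle\psi(t),[g(\alpha(t)),X]\rangle$ for all $X\in\mathcal X(M)$ and all $t$ where $\dot c(t)$ is defined. *)

(* Defs.v *)
From HB Require Import structures.
From mathcomp Require Import all_boot all_order all_algebra.
From mathcomp Require Import boolp classical_sets functions cardinality.
From mathcomp Require Import set_interval reals topology normedtype derive.
From mathcomp Require Import ring.

Set Implicit Arguments.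
Unset Strict Implicit.
Unset Printing Implicit Defensive.

Import Order.TTheory GRing.Theory Num.Theory.
Import numFieldNormedType.Exports.

Local Open Scope classical_set_scope.
Local Open Scope ring_scope.

Section SmoothOn.
Variables (R : realType) (E V : normedModType R).

(* Meant for open U and finite-dimensional E: f is C^k on U when all its
   iterated directional derivatives up to order k exist and are continuous. *)
Fixpoint Ck (k : nat) (U : set E) (f : E -> V) : Prop :=
  {in U, continuous f} /\
  if k is k'.+1 then
    forall v, (forall x, U x -> derivable f x v) /\ Ck k' U ('D_v f)
  else True.

Definition smooth_on (U : set E) (f : E -> V) : Prop := forall k, Ck k U f.

Lemma CkW k U f : Ck k.+1 U f -> Ck k U f.
Proof.
elim: k f => [|k IH] f [cf Hf]; first by split.
by split => // v; have [df /IH] := Hf v.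
Qed.

Lemma smooth_on_cst U (a : V) : smooth_on U (cst a).
Proof.
move=> k; elim: k a => [|k IH] a;
  (split; first by move=> x _; exact: cst_continuous) => //.
move=> v; split; first by move=> x _; exact: derivable_cst.
suff -> : 'D_v (cst a : E -> V) = cst 0 by exact: IH.
by apply/funext => x; rewrite derive_cst.
Qed.

Lemma Ck_ext k U f g : open U -> {in U, f =1 g} -> Ck k U f -> Ck k U g.
Proof.
move=> oU; elim: k f g => [|k IH] f g fg [cf Hf].
all: have near_fg x : U x -> {near x, f =1 g}.
1,3: move=> Ux; have := open_nbhs_nbhs (conj oU Ux).
1,2: by apply: filterS => y yU; exact/fg/mem_set.
all: have cg : {in U, continuous g}.
1,3: move=> x xU; have := cf _ xU; rewrite /prop_for /continuous_at -(fg _ xU).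
1,2: apply: cvg_trans; apply: near_eq_cvg.
1,2: by apply: filterS (near_fg _ (set_mem xU)) => y ->.
  by [].
split => // v; have [df Df] := Hf v.
have [-> | v0] := eqVneq v 0.
  split; first by move=> x _; exact: derivable0.
  by apply: (IH (cst 0)); [move=> x _; rewrite /= derive0|exact: smooth_on_cst].
split.
  by move=> x Ux; apply: near_eq_derivable (df _ Ux) => //; exact: near_fg.
apply: IH Df => x /set_mem Ux.
by apply: near_eq_derive => //; exact: near_fg.
Qed.

Lemma CkD k U f g : open U -> Ck k U f -> Ck k U g -> Ck k U (f + g).
Proof.
move=> oU; elim: k f g => [|k IH] f g [cf Hf] [cg Hg].
  by split => // x xU; apply: cvgD; [exact: cf|exact: cg].
split; first by move=> x xU; apply: cvgD; [exact: cf|exact: cg].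
move=> v; have [df Df] := Hf v; have [dg Dg] := Hg v; split.
  by move=> x Ux; apply: derivableD; [exact: df|exact: dg].
apply: Ck_ext (IH _ _ Df Dg) => // x /set_mem Ux.
by rewrite deriveD//; [exact: df|exact: dg].
Qed.

End SmoothOn.

Lemma CkM (R : realType) (E : normedModType R) k (U : set E) (f g : E -> R) :
  open U -> Ck k U f -> Ck k U g -> Ck k U (f * g).
Proof.
move=> oU; elim: k f g => [|k IH] f g Ckf Ckg.
  have [cf _] := Ckf; have [cg _] := Ckg.
  by split => // x xU; apply: cvgM; [exact: cf|exact: cg].
have [cf Hf] := Ckf; have [cg Hg] := Ckg.
split; first by move=> x xU; apply: cvgM; [exact: cf|exact: cg].
move=> v; have [df Df] := Hf v; have [dg Dg] := Hg v; split.
  by move=> x Ux; apply: derivableM; [exact: df|exact: dg].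
have /= := CkD oU (IH _ _ (CkW Ckf) Dg) (IH _ _ (CkW Ckg) Df).
apply: Ck_ext => // x /set_mem Ux.
by rewrite deriveM//; [exact: df|exact: dg].
Qed.

Section Manifold.
Variable R : realType.

Record chart (M : topologicalType) (n : nat) := Chart {
  chart_dom : set M;
  chart_map :> M -> 'rV[R]_n;
  chart_inv : 'rV[R]_n -> M;
  chart_dom_open : open chart_dom;
  chart_cod_open : open (chart_map @` chart_dom);
  chart_mapK : {in chart_dom, cancel chart_map chart_inv};
  chart_map_continuous : {in chart_dom, continuous chart_map};
  chart_inv_continuous : {in chart_map @` chart_dom, continuous chart_inv} }.

(* The atlas need not be maximal: it determines the smooth structure. *)
Record smoothManifold (n : nat) := SmoothManifold {
  carrier :> topologicalType;
  carrier_hausdorff : hausdorff_space carrier;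
  carrier_second_countable : @second_countable carrier;
  atlas : set (chart carrier n);
  atlas_cover : forall p, exists2 phi, atlas phi & chart_dom phi p;
  atlas_compatible : forall phi psi, atlas phi -> atlas psi ->
    smooth_on (phi @` (chart_dom phi `&` chart_dom psi))
              (psi \o chart_inv phi) }.

Variables (n : nat) (M : smoothManifold n).

Definition smooth_fun (f : M -> R) : Prop := forall phi : chart M n,
  atlas phi -> smooth_on (phi @` chart_dom phi) (f \o chart_inv phi).

Definition smooth_pred : {pred (M -> R)} := [pred f | `[< smooth_fun f >]].

Lemma smooth_funP f : reflect (smooth_fun f) (f \in smooth_pred).
Proof. exact: asboolP. Qed.

Lemma smooth_cst a : smooth_fun (cst a).
Proof. by move=> phi _; exact: (smooth_on_cst _ a). Qed.

Lemma smoothD f g : smooth_fun f -> smooth_fun g -> smooth_fun (f + g).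
Proof.
move=> sf sg phi aphi k.
exact: CkD (@chart_cod_open _ _ phi) (sf _ aphi k) (sg _ aphi k).
Qed.

Lemma smoothM f g : smooth_fun f -> smooth_fun g -> smooth_fun (f * g).
Proof.
move=> sf sg phi aphi k.
exact: CkM (@chart_cod_open _ _ phi) (sf _ aphi k) (sg _ aphi k).
Qed.

Lemma smoothZ a f : smooth_fun f -> smooth_fun (a *: f).
Proof. by move=> sf; apply: smoothM sf; exact: smooth_cst. Qed.

Fact smooth_subring : subring_closed smooth_pred.
Proof.
split; first by apply/smooth_funP; exact: smooth_cst.
- move=> f g /smooth_funP sf /smooth_funP sg; apply/smooth_funP.
  apply: smoothD => //; have -> : - g = (-1) *: g by rewrite scaleN1r.
  exact: smoothZ.
- move=> f g /smooth_funP sf /smooth_funP sg; apply/smooth_funP.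
  exact: smoothM.
Qed.
Fact smooth_submod : GRing.submod_closed smooth_pred.
Proof.
split; first by apply/smooth_funP; exact: smooth_cst.
move=> a f g /smooth_funP sf /smooth_funP sg; apply/smooth_funP.
by apply: smoothD => //; exact: smoothZ.
Qed.

Record smoothFun := SmoothFun {
  smoothFun_val :> M -> R; smoothFunP : smoothFun_val \in smooth_pred }.
HB.instance Definition _ := [isSub for smoothFun_val].
HB.instance Definition _ := [Choice of smoothFun by <:].
HB.instance Definition _ :=
  GRing.SubChoice_isSubComPzRing.Build _ _ smoothFun smooth_subring.
HB.instance Definition _ :=
  GRing.SubZmodule_isSubLmodule.Build R _ _ smoothFun smooth_submod.

Definition mkSmooth f (sf : smooth_fun f) : smoothFun :=
  SmoothFun (introT (smooth_funP f) sf).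

(* T_p M is the space of derivations at p of the algebra of smooth functions. *)
Definition derivation_at (p : M) (v : smoothFun -> R) : Prop :=
  (forall a f g, v (a *: f + g) = a * v f + v g) /\
  (forall f g, v (f * g) = v f * g p + f p * v g).

Definition derivation_pred p : {pred (smoothFun -> R)} :=
  [pred v | `[< derivation_at p v >]].

Fact derivation_submod p : GRing.submod_closed (derivation_pred p).
Proof.
split.
  have E f : (0 : smoothFun -> R) f = 0 by [].
  by apply/asboolP; split=> *; rewrite !E; ring.
move=> a v w /asboolP[vl vM] /asboolP[wl wM]; apply/asboolP.
have E f : (a *: v + w) f = a * v f + w f by [].
split=> [b f g|f g]; rewrite !E ?vl ?wl ?vM ?wM; ring.
Qed.

Record tangent (p : M) := Tangent {
  tangent_val :> smoothFun -> R;
  tangentP : tangent_val \in derivation_pred p }.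
HB.instance Definition _ p := [isSub for @tangent_val p].
HB.instance Definition _ p := [Choice of tangent p by <:].
HB.instance Definition _ p :=
  GRing.SubChoice_isSubLmodule.Build R _ _ (tangent p) (derivation_submod p).

Lemma tangent_linear p (v : tangent p) a f g : v (a *: f + g) = a * v f + v g.
Proof. by have /asboolP[vl _] := tangentP v; exact: vl. Qed.

Lemma tangentD p (v : tangent p) f g : v (f + g) = v f + v g.
Proof. by have := tangent_linear v 1 f g; rewrite scale1r mul1r. Qed.

Lemma tangent_leibniz p (v : tangent p) f g : v (f * g) = v f * g p + f p * v g.
Proof. by have /asboolP[_ vM] := tangentP v; exact: vM. Qed.

Definition mkTangent p v (dv : derivation_at p v) : tangent p :=
  Tangent (introT (asboolP _) dv).

Definition covector_pred p : {pred (tangent p -> R)} :=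
  [pred xi | `[< forall a v w, xi (a *: v + w) = a * xi v + xi w >]].

Fact covector_submod p : GRing.submod_closed (@covector_pred p).
Proof.
split.
  have E v : (0 : tangent p -> R) v = 0 by [].
  by apply/asboolP => a v w; rewrite !E; ring.
move=> a xi eta /asboolP xil /asboolP etal; apply/asboolP => b v w.
have E u : (a *: xi + eta) u = a * xi u + eta u by [].
rewrite !E xil etal; ring.
Qed.

Record cotangent (p : M) := Cotangent {
  cotangent_val :> tangent p -> R;
  cotangentP : cotangent_val \in @covector_pred p }.
HB.instance Definition _ p := [isSub for @cotangent_val p].
HB.instance Definition _ p := [Choice of cotangent p by <:].
HB.instance Definition _ p :=
  GRing.SubChoice_isSubLmodule.Build R _ _ (cotangent p) (@covector_submod p).

Record vfield := VField {
  vfield_val :> forall p : M, tangent p;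
  vfieldP : forall f : smoothFun, smooth_fun (fun p => vfield_val p f) }.

Definition vapply (X : vfield) (f : smoothFun) : smoothFun :=
  mkSmooth (vfieldP X f).

Fact lie_derivation (X Y : vfield) p :
  derivation_at p (fun f => X p (vapply Y f) - Y p (vapply X f)).
Proof.
split=> [a f g|f g].
  have E Z : vapply Z (a *: f + g) = a *: vapply Z f + vapply Z g.
    apply/val_inj/funext => q /=; exact: (tangent_linear (Z q)).
  rewrite !E !tangent_linear; ring.
have E Z : vapply Z (f * g) = vapply Z f * g + f * vapply Z g.
  apply/val_inj/funext => q /=; exact: (tangent_leibniz (Z q)).
rewrite !E !tangentD !tangent_leibniz /=; ring.
Qed.

Fact lie_smooth (X Y : vfield) (f : smoothFun) :
  smooth_fun (fun p => mkTangent (lie_derivation X Y p) f).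
Proof.
have /smooth_funP := smoothFunP (vapply X (vapply Y f) - vapply Y (vapply X f)).
exact.
Qed.

Definition lie (X Y : vfield) : vfield := VField (lie_smooth X Y).

Record oneform := OneForm {
  oneform_val :> forall p : M, cotangent p;
  oneformP : forall X : vfield, smooth_fun (fun p => oneform_val p (X p)) }.

Definition contract (eta : oneform) (X : vfield) : smoothFun :=
  mkSmooth (oneformP eta X).

Lemma oneform_ext (eta zeta : oneform) :
  (forall p v, eta p v = zeta p v) -> eta = zeta.
Proof.
case: eta zeta => [e ep] [z zp] /= ez.
have {}ez : e = z by apply: functional_extensionality_dep => p;
  apply/val_inj/funext => v; exact: ez.
by subst z; congr OneForm; exact: Prop_irrelevance.
Qed.

Fact oneform0_smooth (X : vfield) :
  smooth_fun (fun p => (0 : cotangent p) (X p)).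
Proof. exact: smooth_cst. Qed.

Fact oneformD_smooth (eta zeta : oneform) (X : vfield) :
  smooth_fun (fun p => (eta p + zeta p) (X p)).
Proof. exact: (smoothD (oneformP eta X) (oneformP zeta X)). Qed.

Fact oneformZ_smooth (f : smoothFun) (eta : oneform) (X : vfield) :
  smooth_fun (fun p => (f p *: eta p) (X p)).
Proof.
have /smooth_funP sf := smoothFunP f; exact: (smoothM sf (oneformP eta X)).
Qed.

Fact oneformN_smooth (eta : oneform) (X : vfield) :
  smooth_fun (fun p => (- eta p) (X p)).
Proof.
have /smooth_funP := smoothFunP (- contract eta X); exact.
Qed.

Definition oneform0 := OneForm oneform0_smooth.
Definition oneformN eta := OneForm (oneformN_smooth eta).
Definition oneformD eta zeta := OneForm (oneformD_smooth eta zeta).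
Definition oneformZ f eta := OneForm (oneformZ_smooth f eta).

Fact oneform0E p v : oneform0 p v = 0. Proof. by []. Qed.
Fact oneformNE eta p v : oneformN eta p v = - eta p v. Proof. by []. Qed.
Fact oneformDE eta zeta p v : oneformD eta zeta p v = eta p v + zeta p v.
Proof. by []. Qed.
Fact oneformZE f eta p v : oneformZ f eta p v = f p * eta p v.
Proof. by []. Qed.

Fact oneformDA : associative oneformD.
Proof.
by move=> x y z; apply: oneform_ext => p v; rewrite !oneformDE addrA.
Qed.
Fact oneformDC : commutative oneformD.
Proof. by move=> x y; apply: oneform_ext => p v; rewrite !oneformDE addrC. Qed.
Fact oneform0D : left_id oneform0 oneformD.
Proof.
by move=> x; apply: oneform_ext => p v; rewrite oneformDE oneform0E add0r.
Qed.
Fact oneformND : left_inverse oneform0 oneformN oneformD.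
Proof.
move=> x; apply: oneform_ext => p v.
by rewrite oneformDE oneformNE oneform0E addNr.
Qed.

HB.instance Definition _ := gen_eqMixin oneform.
HB.instance Definition _ := gen_choiceMixin oneform.
HB.instance Definition _ :=
  GRing.isZmodule.Build oneform oneformDA oneformDC oneform0D oneformND.

Fact oneformZA f g eta : oneformZ f (oneformZ g eta) = oneformZ (f * g) eta.
Proof. by apply: oneform_ext => p v; rewrite !oneformZE mulrA. Qed.
Fact oneform1Z : left_id 1 oneformZ.
Proof. by move=> x; apply: oneform_ext => p v; rewrite oneformZE mul1r. Qed.
Fact oneformZDr : right_distributive oneformZ +%R.
Proof.
move=> f x y; apply: oneform_ext => p v.
by rewrite (oneformDE (oneformZ f x)) !oneformZE (oneformDE x) mulrDr.
Qed.
Fact oneformZDl eta : {morph oneformZ^~ eta : f g / f + g}.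
Proof.
move=> f g; apply: oneform_ext => p v.
by rewrite oneformZE [RHS]oneformDE !oneformZE -mulrDl.
Qed.

HB.instance Definition _ := GRing.Zmodule_isLmodule.Build smoothFun oneform
  oneformZA oneform1Z oneformZDr oneformZDl.

(* The value at (v, w) of d eta, computed with any vector fields extending v
   and w; the convention is without the factor 1/2. *)
Definition ext_d (eta : oneform) (p : M) (v w : tangent p) : R :=
  xget 0 [set r | exists X Y : vfield, [/\ X p = v, Y p = w &
    r = X p (contract eta Y) - Y p (contract eta X) - eta p (lie X Y p)]].

Definition tanBundle := {p : M & tangent p}.
Definition cotBundle := {p : M & cotangent p}.

(* The derivative at t of f : [a, b] -> R, one-sided at the end points. *)
Definition deriv_in (a b : R) (f : R -> R) (t l : R) : Prop :=
  (fun u => (u - t)^-1 * (f u - f t)) @ within `[a, b]%classic t^' --> l.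

(* v is the velocity at t of the curve c restricted to [a, b]. *)
Definition velocity (a b : R) (c : R -> M) (t : R) (v : tangent (c t)) : Prop :=
  forall f : smoothFun, deriv_in a b (f \o c) t (v f).
Arguments velocity : clear implicits.

Definition smooth_path (J : set R) (c : R -> M) : Prop :=
  {in J, continuous c} /\ forall phi : chart M n, atlas phi ->
    smooth_on (J `&` c @^-1` chart_dom phi) (phi \o c).

Definition coord_vector (phi : chart M n) (i : 'I_n) (p : M) : tangent p :=
  xget (0 : tangent p) [set v : tangent p | forall f : smoothFun,
    v f = 'D_('e_i) (f \o chart_inv phi) (phi p)].

(* Smoothness in the charts (x_i, p_i) of T^*M induced by those of M. *)
Definition smooth_cot_path (J : set R) (xi : R -> cotBundle) : Prop :=
  smooth_path J (tag \o xi) /\ forall phi : chart M n, atlas phi -> forall i,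
    smooth_on (J `&` (tag \o xi) @^-1` chart_dom phi)
      (fun t => tagged (xi t) (coord_vector phi i (tag (xi t)))).

Section Curves.
Variables (P : Type) (smooth : set R -> (R -> P) -> Prop).

Definition curve (a b : R) (c : R -> P) : Prop :=
  exists a' b' (c' : R -> P), [/\ a' < a, b < b',
    smooth `]a', b'[%classic c' & {in `[a, b], c' =1 c}].

Definition subdivision (a b : R) (k : nat) (s : nat -> R) : Prop :=
  [/\ (0 < k)%N, s 0%N = a, s k = b & forall i, (i < k)%N -> s i < s i.+1].

(* Left continuity of c at the points of the subdivision and existence of its
   right limits there follow from the existence of the pieces. *)
Definition piecewise (a b : R) (k : nat) (s : nat -> R) (c : R -> P)
    (piece : nat -> R -> P) : Prop :=
  [/\ subdivision a b k s, piece 0%N a = c a &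
    forall i, (i < k)%N -> curve (s i) (s i.+1) (piece i) /\
      {in `]s i, s i.+1], piece i =1 c}].

(* piece i (s i) is the right limit of c at s i. *)
Definition continuous_piecewise (a b : R) (c : R -> P) : Prop :=
  exists k s piece, piecewise a b k s c piece /\
    forall i, (i < k)%N -> piece i (s i) = c (s i).

End Curves.

Record subRiemannian := SubRiemannian {
  sr_rank : nat;
  sr_Q : forall p : M, set (tangent p);
  (* local frames, given as restrictions of global vector fields *)
  sr_frame : forall p : M, exists X : 'I_sr_rank -> vfield, \forall q \near p,
    (forall v, sr_Q v <-> exists a : 'I_sr_rank -> R,
      v = \sum_i a i *: X i q) /\
    (forall a : 'I_sr_rank -> R, \sum_i a i *: X i q = 0 ->
      forall i, a i = 0);
  sr_not_involutive : ~ (forall X Y : vfield, (forall p, sr_Q (X p)) ->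
    (forall p, sr_Q (Y p)) -> forall p, sr_Q (lie X Y p));
  (* only the values of sr_h on Q matter *)
  sr_h : forall p : M, tangent p -> tangent p -> R;
  sr_hC : forall p (u v : tangent p), sr_Q u -> sr_Q v -> sr_h u v = sr_h v u;
  sr_h_linear : forall p a (u v w : tangent p),
    sr_Q u -> sr_Q v -> sr_Q w ->
    sr_h (a *: u + v) w = a * sr_h u w + sr_h v w;
  sr_h_gt0 : forall p (u : tangent p), sr_Q u -> u <> 0 -> 0 < sr_h u u;
  sr_h_smooth : forall X Y : vfield, (forall p, sr_Q (X p)) ->
    (forall p, sr_Q (Y p)) -> smooth_fun (fun p => sr_h (X p) (Y p)) }.

Variable S : subRiemannian.
Local Notation Q := (sr_Q S).

Definition section_Q (X : vfield) : Prop := forall p, Q (X p).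

Definition sr_Q0 (p : M) (xi : cotangent p) : Prop := forall v, Q v -> xi v = 0.

Definition section_Q0 (eta : oneform) : Prop := forall p, sr_Q0 (eta p).

(* sr_g xi is the h-dual in Q of the restriction of xi to Q. *)
Definition sr_g (p : M) (xi : cotangent p) : tangent p :=
  xget (0 : tangent p) [set v : tangent p |
    Q v /\ forall w, Q w -> sr_h S v w = xi w].

(* <xi, [v, Y]>, for xi in Q^0 and v in Q over the same point. *)
Definition pair_bracket (xi : cotBundle) (v : tanBundle) (Y : vfield) : R :=
  xget 0 [set r | exists (eta : oneform) (X : vfield),
    [/\ section_Q0 eta, section_Q X, eta (tag xi) = tagged xi,
        X (tag v) = tagged v & r = eta (tag xi) (lie X Y (tag xi))]].

Record g_connection (nabla : oneform -> oneform -> oneform) : Prop := {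
  nablaDl : forall al al' be : oneform,
    nabla (al + al') be = nabla al be + nabla al' be;
  nablaZl : forall (f : smoothFun) (al be : oneform),
    nabla (f *: al) be = f *: nabla al be;
  nablaDr : forall al be be' : oneform,
    nabla al (be + be') = nabla al be + nabla al be';
  (* real scalars act through constant functions *)
  nablaRr : forall (a : R) (al be : oneform),
    nabla al ((a *: (1 : smoothFun)) *: be) =
    (a *: (1 : smoothFun)) *: nabla al be;
  nabla_leibniz : forall (f : smoothFun) (al be : oneform) p,
    nabla al (f *: be) p = f p *: nabla al be p + sr_g (al p) f *: be p }.

Definition Q_adapted (nabla : oneform -> oneform -> oneform) : Prop :=
  forall al eta, section_Q0 eta ->
    forall p v, nabla al eta p v = ext_d eta (sr_g (al p)) v.

Definition tangent_to_Q (a b : R) (c : R -> M) : Prop :=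
  {in `[a, b], forall t v, velocity a b c t v -> Q v}.

(* al, with pieces alp i over [s i, s i.+1], is g-admissible with base c. *)
Definition admissible_pieces (a b : R) (c : R -> M) (k : nat) (s : nat -> R)
    (al : R -> cotBundle) (alp : nat -> R -> cotBundle) : Prop :=
  [/\ piecewise smooth_cot_path a b k s al alp,
      continuous_piecewise smooth_path a b c,
      {in `[a, b], forall t, tag (al t) = c t} &
      forall i, (i < k)%N -> {in `[s i, s i.+1], forall t,
        velocity (s i) (s i.+1) (tag \o alp i) t (sr_g (tagged (alp i t)))}].

Definition admissible a b c al : Prop :=
  exists k s alp, admissible_pieces a b c k s al alp.

Definition smooth_section (a b : R) (c : R -> M)
    (sigma : forall t, cotangent (c t)) : Prop :=
  curve smooth_cot_path a b (fun t => Tagged cotangent (sigma t)).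

(* D is the operator nabla_al on the sections of T^*M along the base curve of
   the smooth g-admissible curve al : [a, b] -> T^*M. *)
Record covariant_derivative (nabla : oneform -> oneform -> oneform)
    (a b : R) (al : R -> cotBundle)
    (D : (forall t, cotangent (tag (al t))) ->
         (forall t, cotangent (tag (al t)))) : Prop := {
  cov_section : forall sigma, smooth_section a b sigma ->
    smooth_section a b (D sigma);
  cov_linear : forall r sigma tau,
    smooth_section a b sigma -> smooth_section a b tau ->
    {in `[a, b], forall t, D (fun u => r *: sigma u + tau u) t =
                           r *: D sigma t + D tau t};
  cov_leibniz : forall f sigma,
    curve (@smooth_on R R R) a b f -> smooth_section a b sigma ->
    {in `[a, b], forall t l, deriv_in a b f t l ->
      D (fun u => f u *: sigma u) t = l *: sigma t + f t *: D sigma t};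
  cov_restrict : forall sigma (eta : oneform), smooth_section a b sigma ->
    {in `[a, b], forall t, eta (tag (al t)) = sigma t} ->
    {in `[a, b], forall t (be : oneform), be (tag (al t)) = tagged (al t) ->
      D sigma t = nabla be eta (tag (al t))} }.

(* The subdivision is common to al and psi. *)
Definition parallel (nabla : oneform -> oneform -> oneform) (a b : R)
    (c : R -> M) (al psi : R -> cotBundle) : Prop :=
  exists k s alp, admissible_pieces a b c k s al alp /\
    forall i, (i < k)%N ->
      exists D (sigma : forall t, cotangent (tag (alp i t))),
      [/\ covariant_derivative nabla (s i) (s i.+1) D,
          smooth_section (s i) (s i.+1) sigma,
          {in `[s i, s i.+1], forall t, Tagged cotangent (sigma t) = psi t} &
          {in `[s i, s i.+1], forall t, D sigma t = 0}].

(* psi is a nowhere vanishing continuous piecewise section of Q^0 along c. *)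
Definition nonvanishing_Q0_section (a b : R) (c : R -> M)
    (psi : R -> cotBundle) : Prop :=
  continuous_piecewise smooth_cot_path a b psi /\
  {in `[a, b], forall t,
    [/\ tag (psi t) = c t, tagged (psi t) <> 0 & sr_Q0 (tagged (psi t))]}.

Definition abnormal_extremal (a b : R) (c : R -> M) : Prop :=
  exists psi, nonvanishing_Q0_section a b c psi /\
    forall al, admissible a b c al -> forall X : vfield,
      {in `[a, b], forall t, (exists v, velocity a b c t v) ->
        deriv_in a b (fun u => tagged (psi u) (X (tag (psi u)))) t
          (pair_bracket (psi t) (Tagged tangent (sr_g (tagged (al t)))) X)}.

End Manifold.

Arguments velocity {R n M}.

(* Main.v *)
(* In a local frame E_i of Q with dual forms th_i, the operator
   nabla_al eta = sum_i th_i(g al) L_{E_i} eta is a Q-adapted g-connection: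
   L_X eta and i_X d eta agree for eta in Q^0 and X in Q. Countably many local
   frames, weighted so as to be locally finite, give such a connection on all
   of M. For a section psi of Q^0 along c, nabla_al psi = 0 paired with a vector
   field X reads d/dt <psi, X> = <psi, [c', X]>, which is the abnormal equation.
   Conversely, write a parallel section psi of Q^0 as sum_l f_l ze_l with local
   sections ze_l of Q^0; the Leibniz rule and adaptedness alone turn
   nabla_al psi = 0 into the same equation. *)
From HB Require Import structures.
From mathcomp Require Import all_boot all_order all_algebra.
From mathcomp Require Import boolp classical_sets functions cardinality.
From mathcomp Require Import reals topology normedtype landau derive.
From mathcomp Require Import constructive_ereal sequences realfun exp ftc.
From mathcomp Require Import measure lebesgue_measure lebesgue_integral.
From mathcomp Require Import ring lra.
Require Import Defs.

Set Implicit Arguments.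
Unset Strict Implicit.
Unset Printing Implicit Defensive.

Import Order.TTheory GRing.Theory Num.Theory.
Import numFieldNormedType.Exports.

Local Open Scope classical_set_scope.
Local Open Scope ring_scope.

(** * Smooth functions on normed spaces *)

(** The two directions are asymmetric. From an abnormal extremal the connection may be chosen, but
    the equation is given only where [c] has a velocity; at the ends of the smooth pieces it is
    recovered by continuity. From a parallel section the connection is an arbitrary adapted one, the
    operator along the curve is known only through its axioms, and the section need not be the
    restriction of a one-form; splitting it along fixed forms of Q^0 brings it back to forms on
    which adaptedness prescribes the derivative.

    Sections along a curve live on a closed interval, while smoothness is tested on an open one. A
    smooth extension may have velocities outside Q, so the operator along a curve is defined with a
    frame of the whole tangent bundle and compared with the connection only over Q.

    Tangent vectors are derivations of global functions: locality rests on bump functions, finite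
    dimension on Hadamard's lemma. Local frames are therefore cut off to global objects from the
    start, and identities between them carry the cut-off as a factor. The metric enters through
    [sr_g] alone: its smoothness, and the lifting of velocities in Q to covectors. *)

Section CkClosure.
Variables (R : realType) (E : normedModType R).

Lemma Ck_subset (V : normedModType R) k (U W : set E) (f : E -> V) :
  W `<=` U -> Ck k U f -> Ck k W f.
Proof.
move=> WU; elim: k f => [|k IH] f [cf Hf]; split => //.
- by move=> x /set_mem/WU/mem_set; exact: cf.
- by move=> x /set_mem/WU/mem_set; exact: cf.
- move=> v; have [df Df] := Hf v; split; last exact: IH.
  by move=> x /WU; exact: df.
Qed.

Lemma Ck_continuous (V : normedModType R) k (U : set E) (f : E -> V) :
  Ck k U f -> {in U, continuous f}.
Proof. by case: k => [|k] []. Qed.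

Lemma smooth_on_subset (V : normedModType R) (U W : set E) (f : E -> V) :
  W `<=` U -> smooth_on U f -> smooth_on W f.
Proof. by move=> WU sf k; exact: Ck_subset WU (sf k). Qed.

(** [Ck k W f] speaks of limits in the whole space at the points of [W], so a neighbourhood [W]
    serves as well as an open one. *)
Lemma smooth_on_local (V : normedModType R) (U : set E) (f : E -> V) :
  (forall x, U x -> exists2 W : set E, nbhs x W & smooth_on W f) ->
  smooth_on U f.
Proof.
move=> loc k; elim: k f U loc => [|k IH] f U loc; split => //.
- by move=> x /set_mem/loc[W /nbhs_singleton Wx /(_ 0%N)[+ _]]; apply; exact: mem_set.
- by move=> x /set_mem/loc[W /nbhs_singleton Wx /(_ 0%N)[+ _]]; apply; exact: mem_set.
move=> v; split.
  by move=> x /loc[W /nbhs_singleton Wx /(_ 1%N)[_ /(_ v)[+ _]]]; exact.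
by apply: IH => x /loc[W xW sW]; exists W => // j; have [_ /(_ v)[]] := sW j.+1.
Qed.

Lemma smooth_on_ext (V : normedModType R) (U : set E) (f g : E -> V) :
  open U -> {in U, f =1 g} -> smooth_on U f -> smooth_on U g.
Proof. by move=> oU fg sf k; exact: Ck_ext oU fg (sf k). Qed.

(** The form in which smoothness is proved on manifolds and along curves: near each point [f] is
    replaced by an expression in local coordinates or in a local frame. *)
Lemma smooth_on_near (V : normedModType R) (U : set E) (f : E -> V) :
  (forall x, U x -> exists g W, [/\ open W, W x, smooth_on W g & {in W, g =1 f}]) ->
  smooth_on U f.
Proof.
move=> H; apply: smooth_on_local => x /H[g [W [oW Wx sg gf]]]; exists W.
  exact: open_nbhs_nbhs.
exact: smooth_on_ext sg.
Qed.

Lemma smooth_onD (V : normedModType R) (U : set E) (f g : E -> V) :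
  open U -> smooth_on U f -> smooth_on U g -> smooth_on U (f + g).
Proof. by move=> oU sf sg k; exact: CkD. Qed.

Lemma smooth_onM (U : set E) (f g : E -> R) :
  open U -> smooth_on U f -> smooth_on U g -> smooth_on U (f * g).
Proof. by move=> oU sf sg k; exact: CkM. Qed.

Lemma Ck_sum (U : set E) I (r : seq I) (P : pred I) (f : I -> E -> R) k :
  open U -> (forall i, P i -> Ck k U (f i)) ->
  Ck k U (fun x => \sum_(i <- r | P i) f i x).
Proof.
move=> oU sf.
have -> : (fun x => \sum_(i <- r | P i) f i x) = \sum_(i <- r | P i) f i.
  by apply/funext => x; rewrite fct_sumE.
elim/big_ind : _ => //; first exact: (smooth_on_cst U 0).
by move=> g h; exact: CkD.
Qed.

Lemma smooth_on_sum (U : set E) I (r : seq I) (P : pred I) (f : I -> E -> R) :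
  open U -> (forall i, P i -> smooth_on U (f i)) ->
  smooth_on U (fun x => \sum_(i <- r | P i) f i x).
Proof. by move=> oU sf k; apply: Ck_sum => // i /sf. Qed.

Lemma smooth_onN (U : set E) (f : E -> R) :
  open U -> smooth_on U f -> smooth_on U (- f).
Proof.
move=> oU sf; have -> : - f = cst (-1) * f.
  by apply/funext => x; rewrite /cst !fctE mulN1r.
by apply: smooth_onM => //; exact: smooth_on_cst.
Qed.

Lemma smooth_onB (U : set E) (f g : E -> R) :
  open U -> smooth_on U f -> smooth_on U g -> smooth_on U (f - g).
Proof. by move=> oU sf sg; apply: smooth_onD => //; exact: smooth_onN. Qed.

Lemma smooth_on_derive (V : normedModType R) (U : set E) (f : E -> V) v :
  smooth_on U f -> smooth_on U ('D_v f).
Proof. by move=> sf k; have [_ /(_ v)[]] := sf k.+1. Qed.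

Lemma smooth_on_continuous (V : normedModType R) (U : set E) (f : E -> V) x :
  smooth_on U f -> U x -> {for x, continuous f}.
Proof. by move=> /(_ 0%N)[cf _] Ux; apply: cf; exact: mem_set. Qed.

Lemma smooth_on_derivable (V : normedModType R) (U : set E) (f : E -> V) x v :
  smooth_on U f -> U x -> derivable f x v.
Proof. by move=> /(_ 1%N)[_ /(_ v)[+ _]]; exact. Qed.

(** The derivative of the inverse is the square of the inverse times [- 'D_v f], so one order of the
    inverse yields the next. *)
Lemma smooth_onV (U : set E) (f : E -> R) :
  open U -> (forall x, U x -> f x != 0) -> smooth_on U f ->
  smooth_on U (fun x => (f x)^-1).
Proof.
move=> oU f0 sf k; elim: k => [|k IH]; split => //.
- move=> x xU; apply: cvgV; first exact/f0/set_mem.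
  exact: (smooth_on_continuous sf (set_mem xU)).
- move=> x xU; apply: cvgV; first exact/f0/set_mem.
  exact: (smooth_on_continuous sf (set_mem xU)).
move=> v; split.
  by move=> x Ux; apply: derivableV; [exact: f0|exact: smooth_on_derivable sf Ux].
have sg : Ck k U (((fun x => (f x)^-1) * (fun x => (f x)^-1)) * (- 'D_v f)).
  apply: CkM => //; first exact: CkM.
  exact: (smooth_onN oU (smooth_on_derive v sf) k).
apply: Ck_ext sg => // x /set_mem Ux.
rewrite [RHS]deriveV//; [|exact: f0|exact: smooth_on_derivable sf Ux].
by rewrite !fctE scaleNr mulrN expr2 invfM.
Qed.

Lemma Ck_coord k n (U : set E) (y : E -> 'rV[R]_n) i :
  open U -> Ck k U y -> Ck k U (fun e => y e 0 i).
Proof.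
move=> oU; elim: k y => [|k IH] y [cy Hy].
all: have cyi : {in U, continuous (fun e => y e 0 i)}.
1,3: move=> x xU; apply: (@cvg_comp _ _ _ y (fun z : 'rV_n => z 0 i)); first exact: cy.
1,2: exact: coord_continuous.
  by [].
split => // v; have [dy Dy] := Hy v; split.
  by move=> x Ux; exact: (derivable_mxP _ _ _).1 (dy x Ux) 0 i.
apply: Ck_ext (IH _ Dy) => // x /set_mem Ux.
by rewrite derive_mx ?mxE//; exact: dy.
Qed.

End CkClosure.

(** * Chain rule and mean value theorem for directional derivatives *)

Section Chain.
Variables (R : realType).

(** Brings directional derivatives to the real line, where derivability and differentiability
    coincide. *)
Lemma derive_line (E V : normedModType R) (f : E -> V) x v :
  'D_v f x = 'D_1 (fun h : R => f (h *: v + x)) 0.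
Proof.
rewrite /derive; set g1 := fun h => h^-1 *: _; set g2 := fun h => h^-1 *: _.
suff -> : g1 = g2 by [].
by apply/funext => h; rewrite /g1 /g2 /= addr0 scale0r add0r [_%:A]mulr1.
Qed.

(** Only the outer map has to be differentiable: [y] is restricted to the line through [e] in
    direction [v], on which it is differentiable, and the chain rule for differentials applies
    there. *)
Lemma derivable_comp (E V W : normedModType R) (y : E -> V) (f : V -> W) e v :
  derivable y e v -> differentiable f (y e) ->
  derivable (f \o y) e v /\ 'D_v (f \o y) e = 'd f (y e) ('D_v y e).
Proof.
move=> dy df.
pose z := fun h : R => y (h *: v + e).
have dz : derivable z 0 1 by exact: (derivable1P _ _ _).1 dy.
have Dz : 'D_1 z 0 = 'D_v y e.
  by rewrite [RHS]derive_line.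
have z0 : z 0 = y e by rewrite /z scale0r add0r.
have dz' : differentiable z 0 by apply/derivable1_diffP.
have dfz : differentiable (f \o z) 0.
  by apply: differentiable_comp => //; rewrite z0.
split.
  by apply: (derivable1P _ _ _).2; apply/derivable1_diffP.
have -> : 'D_v (f \o y) e = 'D_1 (f \o z) 0.
  by rewrite [LHS]derive_line.
rewrite deriveE// diff_comp//; last by rewrite z0.
by rewrite /= z0 -Dz [in RHS]deriveE.
Qed.

Lemma derivable_scale_dir (E V : normedModType R) (f : E -> V) y v (c : R) :
  derivable f y v ->
  derivable f y (c *: v) /\ 'D_(c *: v) f y = c *: 'D_v f y.
Proof.
move=> dv; pose z := fun s : R => f (s *: v + y).
have dz : derivable z 0 1 by exact: (derivable1P _ _ _).1 dv.
have zE : (fun s : R => f (s *: (c *: v) + y)) = z \o (cst c * id).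
  by apply/funext => s; rewrite /z /= scalerA mulrC.
have dm : derivable (cst c * id : R -> R) 0 1.
  by apply: derivableM.
have [|dzc Dzc] := @derivable_comp _ _ _ (cst c * id : R -> R) z 0 1 dm.
  by rewrite fctE mulr0; apply/derivable1_diffP.
split; first by apply: (derivable1P _ _ _).2; rewrite zE.
rewrite derive_line zE Dzc fctE mulr0.
rewrite (derive_line f) -/z [in RHS]deriveE; last by apply/derivable1_diffP.
have -> : 'D_1 (cst c * id : R -> R) 0 = c *: 1.
  rewrite deriveM; [|exact: derivable_cst|exact: derivable_id].
  by rewrite derive_id derive_cst scaler0 addr0.
by rewrite linearZ.
Qed.

Lemma derive_along (E V : normedModType R) (f : E -> V) y v (s : R) :
  derivable f (s *: v + y) v ->
  is_derive s 1 (fun u : R => f (u *: v + y)) ('D_v f (s *: v + y)).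
Proof.
have gE : (fun h : R => f ((h *: 1 + s) *: v + y)) = fun h => f (h *: v + (s *: v + y)).
  by apply/funext => h; rewrite [h *: 1]mulr1 scalerDl addrA.
move=> dv; split.
  by apply: (derivable1P _ _ _).2; rewrite gE; exact: (derivable1P _ _ _).1 dv.
by rewrite derive_line gE -derive_line.
Qed.

Lemma MVT_dir (E : normedModType R) (f : E -> R) y v :
  (forall s : R, 0 <= s <= 1 -> derivable f (s *: v + y) v) ->
  exists2 s : R, 0 <= s <= 1 & f (v + y) - f y = 'D_v f (s *: v + y).
Proof.
move=> dv.
pose z := fun u : R => f (u *: v + y).
have dz (s : R) : 0 <= s <= 1 -> is_derive s 1 z ('D_v f (s *: v + y)).
  by move=> /dv; exact: derive_along.
have [||s sI] := @MVT_segment R z (fun s => 'D_v f (s *: v + y)) 0 1 ler01.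
- by move=> s; rewrite in_itv /= => /andP[s0 s1]; apply: dz; rewrite !ltW.
- apply: derivable_within_continuous => s; rewrite in_itv /= => sI.
  by have [] := dz s sI.
rewrite /z scale1r scale0r add0r subr0 mulr1 => zE.
by exists s => //; move: sI; rewrite in_itv.
Qed.

Lemma differentiable_linear_approx (E V : normedModType R) (f : E -> V)
    (L : {linear E -> V}) x :
  continuous L ->
  (forall e : R, 0 < e ->
    \forall h \near 0, `|f (h + x) - f x - L h| <= e * `|h|) ->
  differentiable f x /\ forall v, 'd f x v = L v.
Proof.
move=> cL fL.
have fLo : f \o shift x = cst (f x) + L +o_ (0 : E) id.
  apply/eqaddoP => e e0; apply: filterS (fL e e0) => h.
  by rewrite /= opprD addrA.
have dL := diff_unique cL fLo.
by split; [apply/diff_locallyP; rewrite dL|rewrite dL].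
Qed.

(* The increment is telescoped along the coordinate axes; each term is
   controlled by the mean value theorem. *)
Lemma C1_differentiable n (U : set 'rV[R]_n) (f : 'rV[R]_n -> R) x :
  open U -> Ck 1 U f -> U x ->
  differentiable f x /\ forall v, 'd f x v = \sum_i v 0 i * 'D_('e_i) f x.
Proof.
move=> oU [cf Hf] Ux.
pose L (v : 'rV[R]_n) : R := \sum_i v 0 i * 'D_('e_i) f x.
have Llin : linear L.
  move=> a u v; rewrite /L scaler_sumr -big_split; apply: eq_bigr => i _ /=.
  by rewrite !mxE mulrDl scalerAl.
pose LM := GRing.isLinear.Build _ _ _ _ _ Llin.
pose LL : {linear 'rV[R]_n -> R} := HB.pack L LM.
have cL : continuous LL.
  have cLi (i : 'I_n) : continuous (fun v : 'rV[R]_n => v 0 i * 'D_('e_i) f x).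
    move=> w; apply: (@continuousM R 'rV[R]_n (fun v => v 0 i) (cst ('D_('e_i) f x)) w).
      exact: coord_continuous.
    exact: cst_continuous.
  exact: (continuous_big add_continuous (fun i _ => cLi i)).
suff H (e : R) : 0 < e ->
    \forall h \near (0 : 'rV[R]_n), `|f (h + x) - f x - LL h| <= e * `|h|.
  exact: differentiable_linear_approx cL H.
move=> e0.
  (* Each of the [n] coordinate increments costs at most [e'] times the norm of [h]; the successor
     keeps the quotient meaningful when [n] is 0. *)
  pose e' := e / n.+1%:R.
  have e'0 : 0 < e' by rewrite divr_gt0.
  have : \forall y \near x, U y /\ forall i, `|'D_('e_i) f x - 'D_('e_i) f y| <= e'.
    have nD (i : 'I_n) : \forall y \near x, `|'D_('e_i) f x - 'D_('e_i) f y| <= e'.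
      have [_ [cD _]] := Hf 'e_i.
      by move/cvgrPdist_le : (cD x (mem_set Ux)); apply.
    near=> y; split; first by near: y; exact: open_nbhs_nbhs.
    by move=> i; move: i; near: y; exact: filter_forall nD.
  move=> /nbhs_ballP[d /= d0 dU]; near=> h.
  have hd : `|h| < d.
    near: h; apply/nbhs_ballP; exists d => // z.
    by rewrite -ball_normE /ball_ /= sub0r normrN.
  (* [P j] keeps the first [j] coordinates of [h]: the vertices of a path from 0 to [h] along the
     axes. *)
  pose P j : 'rV[R]_n := \row_i (if (i < j)%N then h 0 i else 0).
  have hi i : `|h 0 i| <= `|h|.
    by rewrite [leRHS]/Num.norm/= mx_normrE; exact: (le_bigmax _ _ (0, i)).
  have Ps (j : 'I_n) (s : R) : 0 <= s <= 1 ->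
      `|s *: (h 0 j *: 'e_j) + P j| <= `|h|.
    move=> /andP[s0 s1].
    rewrite [leLHS]/Num.norm/= mx_normrE bigmax_le// => -[k i] _ /=.
    rewrite [k]ord1 !mxE eqxx /= ; have [->|ij] := eqVneq i j.
      by rewrite ltnn addr0 mulr1 normrM ger0_norm// (le_trans _ (hi j))// ler_piMl.
    rewrite mulr0 mulr0 add0r; case: ifP => // _; rewrite normr0 //.
  have tele : f (h + x) - f x = \sum_(j < n) (f (P j.+1 + x) - f (P j + x)).
    rewrite -(big_mkord xpredT (fun j => f (P j.+1 + x) - f (P j + x))).
    rewrite telescope_sumr//; congr (f (_ + x) - f _).
      by apply/rowP => i; rewrite mxE ltn_ord.
    by apply/rowP => i; rewrite !mxE ltn0 add0r.
  have step (j : 'I_n) : `|f (P j.+1 + x) - f (P j + x) - h 0 j * 'D_('e_j) f x| <=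
      `|h| * e'.
    have PS : P j.+1 = h 0 j *: 'e_j + P j.
      apply/rowP => i; rewrite !mxE eqxx /= ltnS leq_eqVlt eq_sym.
      have [/val_inj ->|ij] /= := eqVneq (val i) (val j).
        by rewrite eqxx mulr1 ltnn addr0.
      by rewrite (_ : (i == j) = false) ?mulr0 ?add0r //; exact: negbTE.
    have dU' (s : R) : 0 <= s <= 1 -> ball x d (s *: (h 0 j *: 'e_j) + (P j + x)).
      move=> s01; rewrite -ball_normE /ball_ /= addrA opprD addrCA subrr addr0 normrN.
      exact: le_lt_trans (Ps _ _ s01) hd.
    have -> : P j.+1 + x = h 0 j *: 'e_j + (P j + x) by rewrite PS addrA.
    have [|s s01 ->] := @MVT_dir _ f (P j + x) (h 0 j *: 'e_j).
      move=> s /dU'/dU[Uy _]; have [df _] := Hf 'e_j.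
      exact: (derivable_scale_dir (h 0 j) (df _ Uy)).1.
    have [Uy Dy] := dU _ (dU' _ s01).
    have [df _] := Hf 'e_j.
    rewrite (derivable_scale_dir (h 0 j) (df _ Uy)).2.
    rewrite -[h 0 j *: _]/(h 0 j * _) -mulrBr normrM ler_pM// distrC; exact: Dy.
rewrite tele -[L h]/(\sum_i _) -sumrB (le_trans (ler_norm_sum _ _ _))//.
rewrite (le_trans (ler_sum _ (fun j _ => step j)))// sumr_const card_ord -mulr_natr.
rewrite [e * _]mulrC -mulrA ler_wpM2l// /e' mulrAC ler_pdivrMr ?ltr0n//.
by rewrite ler_pM2l// ler_nat.
Unshelve. all: by end_near. Qed.

(** A derivative of [f \o y] is a sum of products of a derivative of a component of [y] with a
    partial derivative of [f] composed with [y], both of order [k]. This chain rule requires [f] to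
    be differentiable, which [C1_differentiable] supplies. *)
Lemma Ck_comp k (E : normedModType R) n (U : set E) (V : set 'rV[R]_n)
    (y : E -> 'rV[R]_n) (f : 'rV[R]_n -> R) :
  open U -> open V -> (forall e, U e -> V (y e)) ->
  Ck k U y -> Ck k V f -> Ck k U (f \o y).
Proof.
move=> oU oV UV; elim: k f => [|k IH] f sy sf.
  split => // e /set_mem Ue; have [cy _] := sy; have [cf _] := sf.
  by apply: continuous_comp; [exact/cy/mem_set|exact/cf/mem_set/UV].
have [cy Hy] := sy; have [cf Hf] := sf; split.
  move=> e /set_mem Ue.
  by apply: continuous_comp; [exact/cy/mem_set|exact/cf/mem_set/UV].
have sf1 : Ck 1 V f.
  by split => // v; have [df /Ck_continuous] := Hf v.
have chain e v : U e -> derivable (f \o y) e v /\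
    'D_v (f \o y) e = \sum_i 'D_v (fun e => y e 0 i) e * ('D_('e_i) f \o y) e.
  move=> Ue; have [dfe Df] := C1_differentiable oV sf1 (UV _ Ue).
  have [dy _] := Hy v; have [dc Dc] := derivable_comp (dy _ Ue) dfe.
  split => //; rewrite Dc Df; apply: eq_bigr => i _.
  by rewrite derive_mx ?mxE//; exact: dy.
move=> v; split; first by move=> e /(chain e v)[].
have : Ck k U (fun e => \sum_i 'D_v (fun e => y e 0 i) e * ('D_('e_i) f \o y) e).
  apply: Ck_sum => // i _; apply: (@CkM R E k U ('D_v (fun e => y e 0 i))) => //.
    by have [_ /(_ v)[]] := Ck_coord i oU sy.
  by apply: IH; [exact: CkW sy|have [] := Hf 'e_i].
by apply: Ck_ext => // e /set_mem /(chain e v)[].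
Qed.

Lemma smooth_on_comp (E : normedModType R) n (U : set E) (V : set 'rV[R]_n)
    (y : E -> 'rV[R]_n) (f : 'rV[R]_n -> R) :
  open U -> open V -> (forall e, U e -> V (y e)) ->
  smooth_on U y -> smooth_on V f -> smooth_on U (f \o y).
Proof. by move=> oU oV UV sy sf k; exact: Ck_comp oU oV UV (sy k) (sf k). Qed.

(** For an outer function on the line derivability already is differentiability, so the chain rule
    applies without passing through partial derivatives. *)
Lemma smooth_on_comp1 (E : normedModType R) (U : set E) (V : set R)
    (y : E -> R) (f : R -> R) :
  open U -> (forall e, U e -> V (y e)) ->
  smooth_on U y -> smooth_on V f -> smooth_on U (f \o y).
Proof.
move=> oU UV sy sf k; elim: k f sf => [|k IH] f sf; split => //.
1,2: move=> e /set_mem Ue; apply: continuous_comp.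
1,3: exact: smooth_on_continuous sy Ue.
1,2: exact: smooth_on_continuous sf (UV _ Ue).
have chain e v : U e -> derivable (f \o y) e v /\
    'D_v (f \o y) e = ('D_v y * ('D_1 f \o y)) e.
  move=> Ue; have dfe : differentiable f (y e).
    by apply/derivable1_diffP; exact: smooth_on_derivable sf (UV _ Ue).
  have [dc Dc] := derivable_comp (smooth_on_derivable (v := v) sy Ue) dfe.
  by split => //; rewrite Dc diff1E// derive1E.
move=> v; split; first by move=> e /(chain e v)[].
have : Ck k U ('D_v y * ('D_1 f \o y)).
  by apply: CkM => //; [exact: smooth_on_derive|exact/IH/smooth_on_derive].
by apply: Ck_ext => // e /set_mem /(chain e v)[].
Qed.

Lemma smooth_on_linear (E : normedModType R) (U : set E) (f : {linear E -> R}) :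
  continuous f -> smooth_on U f.
Proof.
move=> cf; case=> [|k]; split => //.
have df x v : is_derive x v f (f v).
  have dif := linear_differentiable x cf.
  by split; [exact: diff_derivable|rewrite deriveE// diff_lin].
move=> v; split; first by move=> x _; have [] := df x v.
have -> : 'D_v f = cst (f v).
  by apply/funext => x; have [] := df x v.
exact: smooth_on_cst.
Qed.

Lemma smooth_on_id1 (U : set R) : smooth_on U (id : R -> R).
Proof.
case=> [|k]; split => //.
- by move=> x _; exact: cvg_id.
- by move=> x _; exact: cvg_id.
move=> v; split; first by move=> x _; exact: derivable_id.
have -> : 'D_v id = cst v by apply/funext => x; exact: derive_id.
exact: smooth_on_cst.
Qed.

Lemma smooth_on_proj n (U : set 'rV[R]_n) i : smooth_on U (fun x : 'rV[R]_n => x 0 i).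
Proof.
pose p (x : 'rV[R]_n) := x 0 i.
have lp : linear p by move=> a u v; rewrite /p !mxE.
pose pM := GRing.isLinear.Build _ _ _ _ _ lp.
pose pL : {linear 'rV[R]_n -> R} := HB.pack p pM.
apply: (@smooth_on_linear _ _ pL); exact: coord_continuous.
Qed.

End Chain.

(** * Bump functions and Hadamard's lemma *)

Section Step.
Variable R : realType.
Implicit Types (t : R) (m : nat).

(* The family flat m is closed under differentiation up to linear
   combinations, and flat 0 is the usual exp (- 1 / t). *)
Definition flat m t : R := if t <= 0 then 0 else t^-1 ^+ m * expR (- t^-1).

Lemma flat_npos m t : t <= 0 -> flat m t = 0.
Proof. by rewrite /flat => ->. Qed.

Lemma flat_pos m t : 0 < t -> flat m t = t^-1 ^+ m * expR (- t^-1).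
Proof. by rewrite /flat leNgt => ->. Qed.

Lemma flat_ge0 m t : 0 <= flat m t.
Proof.
have [t0|t0] := leP t 0; first by rewrite flat_npos.
by rewrite flat_pos// mulr_ge0 ?expR_ge0// exprn_ge0// invr_ge0 ltW.
Qed.

(** The exponential of the inverse of [t] dominates the term of degree [m.+1] of its series. A bound
    linear in [t] makes difference quotients at 0 tend to 0. *)
Lemma flat_le m t : 0 < t -> flat m t <= m.+1`!%:R * t.
Proof.
move=> t0; rewrite flat_pos// expRN.
have t1 : 0 < t^-1 by rewrite invr_gt0.
have f0 : 0 < m.+1`!%:R :> R by rewrite ltr0n fact_gt0.
rewrite ler_pdivrMr ?expR_gt0//.
apply: (@le_trans _ _ (m.+1`!%:R * t * (t^-1 ^+ m.+1 / m.+1`!%:R))); last first.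
  apply: ler_wpM2l; first by rewrite mulr_ge0 ?ltW.
  by apply: le_trans (expR_ge1Dxn m (ltW t1)); rewrite lerDr.
by rewrite exprS le_eqVlt; apply/orP; left; apply/eqP; field; rewrite !gt_eqF.
Qed.

Lemma cvg_is_derive (V W : normedModType R) (f : V -> W) x v l :
  h^-1 *: (f (h *: v + x) - f x) @[h --> 0^'] --> l -> is_derive x v f l.
Proof. by move=> fl; split; [apply/cvg_ex; exists l|exact/cvg_lim]. Qed.

Lemma is_derive_flat m t :
  is_derive t 1 (flat m) (- m%:R * flat m.+1 t + flat m.+2 t).
Proof.
have [t0|t0|->] := ltgtP t 0.
- rewrite !flat_npos ?ltW// mulr0 addr0.
  apply: (@near_eq_is_derive _ _ _ (cst 0)).
  by near=> s; rewrite flat_npos// ltW//; near: s; exact: lt_nbhsl.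
- apply: (@near_eq_is_derive _ _ _ ((fun s : R => s^-1) ^+ m * (fun s : R => expR (-
  s^-1)))).
    by near=> s; rewrite flat_pos ?fctE ?exprfctE//; near: s; exact: lt_nbhsr.
  have tn0 : t != 0 by rewrite gt_eqF.
  have dV : is_derive t 1 (fun s : R => s^-1) (- t ^- 2).
    split; first by apply: derivableV => //; exact: derivable_id.
    by rewrite (deriveV (f := id))// derive_id [_ *: 1]mulr1.
  have dN : is_derive t 1 (fun s : R => - s^-1) (t ^- 2).
    by rewrite -[t ^- 2]opprK; exact: is_deriveN.
  have dE : is_derive t 1 (fun s : R => expR (- s^-1)) (t ^- 2 * expR (- t^-1)).
    have [dN1 dN2] := dN.
    have de : differentiable (@expR R) (- t^-1).
      by apply/derivable1_diffP; exact: derivable_expR.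
    have [d1 d2] := derivable_comp dN1 de.
    split; first exact: d1.
    rewrite [LHS]d2 dN2 diff1E// derive1E.
    by have [_ ->] := is_derive_expR (- t^-1).
  case: m => [|m].
    rewrite expr0 mul1r mulr0n oppr0 mul0r add0r flat_pos//.
    by apply: is_derive_eq dE _; rewrite exprVn.
  have dP : is_derive t 1 ((fun s : R => s^-1) ^+ m.+1) ((m.+1%:R * t^-1 ^+ m) *: (-
    t ^- 2)).
    by apply: is_derive_eq.
  apply: (@is_derive_eq _ _ _ _ _ _ _ _ (is_deriveM dP dE)).
  rewrite !flat_pos// !exprfctE -!exprVn.
  rewrite -[_ *: (_ * _)]/(_ * _) -![_ *: (_ *: _)]/(_ * (_ * _)) !exprS; ring.
- rewrite !flat_npos// mulr0 addr0; apply: cvg_is_derive.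
  apply/cvgrPdist_le => e e0.
  have f0 : 0 < m.+2`!%:R :> R by rewrite ltr0n fact_gt0.
  near=> h.
  rewrite sub0r normrN addr0 [h *: 1]mulr1 (flat_npos m (lexx 0)) subr0.
  have h0 : h != 0 by near: h; exact: nbhs_dnbhs_neq.
  have he : `|h| < e / m.+2`!%:R by near: h; apply: dnbhs0_lt; rewrite divr_gt0.
  have [hn|hp] := leP h 0; first by rewrite flat_npos// scaler0 normr0 ltW.
  (* The difference quotient at 0 is again a member of the family, and [flat_le] bounds it
     linearly. *)
  have -> : h^-1 *: flat m h = flat m.+1 h.
    by rewrite !flat_pos// -[_ *: _]/(_ * _) exprS mulrA.
  rewrite ger0_norm ?flat_ge0// (le_trans (flat_le _ hp))//.
  by rewrite mulrC -ler_pdivlMr// ltW// -[h]gtr0_norm.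
Unshelve. all: by end_near. Qed.

Lemma smooth_flat m : smooth_on setT (flat m).
Proof.
move=> k; elim: k m => [|k IH] m; split => //.
1,2: move=> x _; apply/differentiable_continuous/derivable1_diffP.
1,2: by have [] := is_derive_flat m x.
move=> v.
have D x : derivable (flat m) x v /\
    'D_v (flat m) x = (cst (- v * m%:R) * flat m.+1 + cst v * flat m.+2) x.
  have [d D1] := is_derive_flat m x.
  have [d' Dv] := derivable_scale_dir v d; rewrite [v *: 1]mulr1 in d' Dv.
  split => //; rewrite Dv D1 !fctE -[v *: _]/(v * _) /cst; ring.
split; first by move=> x _; have [] := D x.
rewrite (_ : 'D_v (flat m) = cst (- v * m%:R) * flat m.+1 + cst v * flat m.+2).
  apply: CkD; [exact: openT| |].
    apply: (@CkM R R k setT (cst (- v * m%:R)) (flat m.+1)) => //; first exact: openT.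
    exact: smooth_on_cst.
  apply: (@CkM R R k setT (cst v) (flat m.+2)) => //; first exact: openT.
  exact: smooth_on_cst.
by apply/funext => x; have [] := D x.
Qed.

(** The usual smooth transition from 0 to 1; since [t] and [1 - t] cannot both be nonpositive, the
    denominator is positive. *)
Definition step t : R := flat 0 t / (flat 0 t + flat 0 (1 - t)).

Lemma step_den_gt0 t : 0 < flat 0 t + flat 0 (1 - t).
Proof.
have f0 s : 0 < s -> 0 < flat 0 s by move=> s0; rewrite flat_pos// expr0 mul1r expR_gt0.
have [t0|t0] := ltP 0 t; first by rewrite ltr_wpDr ?flat_ge0// f0.
by rewrite ltr_wpDl ?flat_ge0// f0//; lra.
Qed.

Lemma step0 t : t <= 0 -> step t = 0.
Proof. by move=> t0; rewrite /step flat_npos// mul0r. Qed.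

Lemma step1 t : 1 <= t -> step t = 1.
Proof.
move=> t1; have := step_den_gt0 t; rewrite /step (flat_npos _ (t := 1 - t)) ?addr0;
  last lra.
by move=> h; rewrite divff// gt_eqF.
Qed.

Lemma smooth_step : smooth_on setT step.
Proof.
have oT : open [set: R] by exact: openT.
apply: (@smooth_onM _ _ setT (flat 0) (fun t => (flat 0 t + flat 0 (1 - t))^-1)) => //.
  exact: smooth_flat.
apply: smooth_onV => //; first by move=> t _; rewrite gt_eqF ?step_den_gt0.
apply: (@smooth_onD _ _ _ setT (flat 0) (flat 0 \o (cst 1 - id))) => //.
  exact: smooth_flat.
apply: (@smooth_on_comp1 _ _ setT setT) => //; last exact: smooth_flat.
by apply: smooth_onB => //; [exact: smooth_on_cst|exact: smooth_on_id1].
Qed.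

Lemma rV_bump n (p : 'rV[R]_n) (r : R) : 0 < r ->
  exists b : 'rV[R]_n -> R, [/\ smooth_on setT b, \forall x \near p, b x = 1 &
    forall x, r <= `|x - p| -> b x = 0].
Proof.
move=> r0; have oT : open [set: 'rV[R]_n] by exact: openT.
(* The norm of row vectors is the maximum norm, which is not smooth; the sum of squares is smooth
   and dominates its square. *)
pose q (x : 'rV[R]_n) : R := \sum_i (x 0 i - p 0 i) * (x 0 i - p 0 i).
have sq : smooth_on setT q.
  apply: smooth_on_sum => // i _.
  by apply: (@smooth_onM _ _ setT (fun x : 'rV[R]_n => x 0 i - p 0 i)
    (fun x : 'rV[R]_n => x 0 i - p 0 i)) => //;
   apply: (@smooth_onB _ _ setT (fun x : 'rV[R]_n => x 0 i) (cst (p 0 i))) => //;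
   [exact: smooth_on_proj|exact: smooth_on_cst|exact: smooth_on_proj|exact: smooth_on_cst].
(* With this factor [2 - c * q] is at least 1 near [p] and at most 0 once [q] reaches the square of
   [r]. *)
pose c := 2 / (r * r).
have c0 : 0 < c by rewrite divr_gt0// mulr_gt0.
exists (step \o (cst 2 - cst c * q)); split.
- apply: (@smooth_on_comp1 _ _ setT setT) => //; last exact: smooth_step.
  apply: smooth_onB => //; first exact: smooth_on_cst.
  by apply: smooth_onM => //; exact: smooth_on_cst.
- have : (cst c * q) x @[x --> p] --> (cst c * q) p.
    have s : smooth_on setT (cst c * q) by apply: smooth_onM => //; exact: smooth_on_cst.
    exact: smooth_on_continuous s I.
  have q0 : q p = 0 by rewrite /q big1// => i _; rewrite subrr mul0r.
  have -> : (cst c * q) p = 0 by rewrite -[LHS]/(c * q p) q0 mulr0.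
  move=> /cvgrPdist_le /(_ 1 ltr01); apply: filterS => x; rewrite sub0r normrN => h.
  by rewrite /= step1// !fctE; have := ler_norm (c * q x); lra.
- move=> x rx; rewrite /= step0// !fctE.
  suff : r * r <= q x.
    have cr : c * (r * r) = 2 by rewrite /c divfK// gt_eqF// mulr_gt0.
    move=> h; have := ler_wpM2l (ltW c0) h; rewrite cr; lra.
  have [[j i] /= xi] : exists i, `|x - p| = `|(x - p) i.1 i.2|.
    by apply: mx_norm_neq0; rewrite gt_eqF//; exact: lt_le_trans rx.
  move: rx; rewrite {}xi [j]ord1 !mxE => rx.
  rewrite (@le_trans _ _ (`|x 0 i - p 0 i| * `|x 0 i - p 0 i|))//.
    by rewrite ler_pM// ltW.
  rewrite -normrM ger0_norm -?expr2 ?sqr_ge0// /q (bigD1 i)//= -expr2 lerDl.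
  by rewrite sumr_ge0// => k _; rewrite -expr2 sqr_ge0.
Qed.

End Step.

(** * Integrals along segments and Hadamard's lemma *)

Section Hadamard.
Variable R : realType.
Implicit Types (w W : R -> R).

Definition primitive W w : Prop :=
  forall t : R, 0 <= t <= 1 -> is_derive t 1 W (w t).

Lemma primitive_MVT w W :
  primitive W w -> exists2 t, 0 <= t <= 1 & W 1 - W 0 = w t.
Proof.
move=> pW; have [t tI|t tI|t] := @MVT_segment R W w 0 1 ler01.
- by apply: pW; move: tI; rewrite in_itv => /andP[t0 t1]; rewrite !ltW.
- by apply: derivable_within_continuous t tI => t; rewrite in_itv => /pW[].
- by rewrite in_itv => tI ->; exists t => //; rewrite subr0 mulr1.
Qed.

Lemma primitive_bound w W e :
  primitive W w -> (forall t, 0 <= t <= 1 -> `|w t| <= e) -> `|W 1 - W 0| <= e.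
Proof. by move=> /primitive_MVT[t tI ->]; exact. Qed.

Lemma primitiveB w1 w2 W1 W2 :
  primitive W1 w1 -> primitive W2 w2 -> primitive (W1 - W2) (w1 - w2).
Proof.
by move=> pW1 pW2 t tI; have d1 := pW1 t tI; have d2 := pW2 t tI; exact: is_deriveB.
Qed.

Lemma primitiveZ (c : R) w W : primitive W w -> primitive (c *: W) (c *: w).
Proof. by move=> pW t tI; have d := pW t tI; exact: is_deriveZ. Qed.

Lemma primitive_sum n (w W : 'I_n -> R -> R) :
  (forall i, primitive (W i) (w i)) -> primitive (\sum_i W i) (\sum_i w i).
Proof.
move=> H t tI; have -> : (\sum_i w i) t = \sum_i w i t by rewrite fct_sumE.
by apply: is_derive_sum => i; exact: H.
Qed.

Lemma primitive_unique w W W' :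
  primitive W w -> primitive W' w -> W 1 - W 0 = W' 1 - W' 0.
Proof.
move=> pW pW'; have [t _] := primitive_MVT (primitiveB pW pW').
by rewrite !fctE subrr => h; lra.
Qed.

Lemma primitive_exists w :
  (forall t, 0 <= t <= 1 -> {for t, continuous w}) -> exists W, primitive W w.
Proof.
move=> cw.
(* [cl] clamps to the unit interval, so [w \o cl] is continuous on the line and equals [w] where it
   matters. *)
pose cl : R -> R := cst 0 \max (id \min cst 1).
have ccl : continuous cl.
  apply: max_fun_continuous; first exact: cst_continuous.
  by apply: min_fun_continuous; [move=> x; exact: cvg_id|exact: cst_continuous].
have cl01 t : 0 <= cl t <= 1.
  by rewrite /cl /= le_max lexx/= ge_max ler01 ge_min lexx orbT.
have cwcl : continuous (w \o cl).
  by move=> t; apply: continuous_comp; [exact: ccl|exact: cw].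
pose mu := @lebesgue_measure R.
(* The interval from -1 to 2 has 0 and 1 in its interior, so that the primitive has two-sided
   derivatives there too. *)
have int : mu.-integrable `[(-1), 2] (EFin \o (w \o cl)).
  apply: continuous_compact_integrable; first exact: segment_compact.
  exact: continuous_subspaceT.
pose W x := (\int[mu]_(t in `[(-1)%R, x]) (w \o cl) t)%R.
have dW (t : R) : 0 <= t <= 1 -> is_derive t 1 W (w t).
  move=> /andP[t0 t1].
  have t2 : t < 2 by lra.
  have tm : -1 < t by lra.
  have [dW DW] := continuous_FTC1_closed t2 int tm (cwcl t).
  split; first exact: dW.
  rewrite -derive1E [LHS]DW /= /cl.
  by rewrite -[X in w X]/(Num.max 0 (Num.min t 1)) min_l// max_r.
by exists W.
Qed.

(** The integral is the increment of a primitive: bounds come from the mean value theorem, and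
    Lebesgue integration enters only in the existence of primitives. *)
Definition integral01 w : R :=
  xget 0 [set l | exists2 W, primitive W w & l = W 1 - W 0].

Lemma integral01E w W : primitive W w -> integral01 w = W 1 - W 0.
Proof.
move=> pW; rewrite /integral01; case: xgetP => [l _ [W' pW' ->]|].
  exact: primitive_unique pW' pW.
by move=> /(_ (W 1 - W 0)) []; exists W.
Qed.

Lemma integral01_bound w1 w2 (e : R) :
  (exists W, primitive W w1) -> (exists W, primitive W w2) ->
  (forall t, 0 <= t <= 1 -> `|w1 t - w2 t| <= e) ->
  `|integral01 w1 - integral01 w2| <= e.
Proof.
move=> [W1 pW1] [W2 pW2] we.
rewrite (integral01E pW1) (integral01E pW2).
have := primitive_bound (primitiveB pW1 pW2) we.
by rewrite !fctE; congr (`|_| <= _); ring.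
Qed.

Variables (n : nat) (p : 'rV[R]_n) (r : R).
Let B : set 'rV[R]_n := ball p r.
Implicit Types (x v : 'rV[R]_n) (u : 'rV[R]_n -> R) (m : nat).

Let sg x (t : R) : 'rV[R]_n := t *: (x - p) + p.

Let sgB x t : B x -> 0 <= t <= 1 -> B (sg x t).
Proof.
rewrite /B -!ball_normE /ball_ /= => xr /andP[t0 t1].
rewrite /sg opprD addrCA subrr addr0 normrN normrZ ger0_norm//.
by apply: le_lt_trans xr; rewrite [leRHS]distrC ler_piMl.
Qed.

Let oB : open B.
Proof. exact: ball_open. Qed.

Let sg_cts (z : R * 'rV[R]_n) : {for z, continuous (fun z => sg z.2 z.1)}.
Proof.
apply: cvgD; last exact: cvg_cst.
apply: cvgZ; first exact: cvg_fst.
by apply: cvgB; [exact: cvg_snd|exact: cvg_cst].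
Qed.

Let sgx_cts x (t : R) : {for t, continuous (sg x)}.
Proof.
apply: cvgD; last exact: cvg_cst.
by apply: cvgZ; [exact: cvg_id|exact: cvg_cst].
Qed.

(* The weight t ^+ m accounts for m differentiations in x under the integral. *)
Definition segment_integral m u x : R :=
  integral01 (fun t => t ^+ m * u (sg x t)).

Let has_prim m u x : {in B, continuous u} -> B x ->
  exists W, primitive W (fun t => t ^+ m * u (sg x t)).
Proof.
move=> cu Bx; apply: primitive_exists => t t01.
apply: continuousM; first exact: exprn_continuous.
apply: (@continuous_comp _ _ _ (sg x) u); first exact: sgx_cts.
exact/cu/mem_set/sgB.
Qed.

(** Compactness of the unit interval makes the continuity of [u] along the segments uniform in
    [t]. *)
Let uniform u x (e : R) : {in B, continuous u} -> B x -> 0 < e ->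
  \forall y \near x, B y /\ forall t, 0 <= t <= 1 -> `|u (sg y t) - u (sg x t)| <= e.
Proof.
move=> cu Bx e0.
have e20 : 0 < e / 2 by rewrite divr_gt0.
have cx z : 0 <= z.1 <= 1 -> B z.2 ->
    {for z, continuous (fun z : R * 'rV[R]_n => u (sg z.2 z.1))}.
  move=> z01 Bz; apply: (@continuous_comp _ _ _ (fun z => sg z.2 z.1) u).
    exact: sg_cts.
  exact/cu/mem_set/sgB.
have cov := (compact_near_coveringP _).1 (@segment_compact R 0 1).
have H : \forall y \near x,
    `[0, 1]%classic `<=` (fun t => `|u (sg y t) - u (sg x t)| <= e).
  apply: (cov _ (nbhs x) (fun y (t : R) => `|u (sg y t) - u (sg x t)| <= e)
    (nbhs_filter x)) => t.
  rewrite /= in_itv /= => t01.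
  have c1 := cx (t, x) t01 Bx.
  have c2 : (fun z : R * 'rV[R]_n => u (sg x z.1)) z @[z --> (t, x)] --> u (sg x t).
    apply: (@cvg_comp _ _ _ (fun z : R * 'rV[R]_n => z.1) (u \o sg x) _ (nbhs t)).
      exact: cvg_fst.
    have : {for t, continuous (u \o sg x)}.
      apply: continuous_comp; first exact: sgx_cts.
      exact/cu/mem_set/sgB.
    by [].
  near=> z.
  rewrite (splitr e) -(subrKA (u (sg x t))) (le_trans (ler_normD _ _))//.
  apply: lerD.
    rewrite distrC; near: z; move/cvgrPdist_le : c1; exact.
  near: z; move/cvgrPdist_le : c2; exact.
near=> y; split; first by near: y; exact: open_nbhs_nbhs.
move=> t t01; have : `[0, 1]%classic `<=` (fun t => `|u (sg y t) - u (sg x t)| <= e).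
  near: y; exact: H.
by apply; rewrite /= in_itv.
Unshelve. all: by end_near. Qed.

(** Differentiation under the integral: for each [t] the mean value theorem turns the difference
    quotient of the integrand into [t ^+ m.+1] times ['D_v u] at a point of a nearby segment, and
    [uniform] compares it with the value on the segment to [x]. *)
Lemma segment_integral_derive m u x v : smooth_on B u -> B x ->
  is_derive x v (segment_integral m u) (segment_integral m.+1 ('D_v u) x).
Proof.
move=> su Bx; apply: cvg_is_derive; apply/cvgrPdist_le => e e0.
have cu : {in B, continuous u} by move=> z /set_mem; exact: smooth_on_continuous.
have cDu : {in B, continuous ('D_v u)}.
  by move=> z /set_mem; apply: smooth_on_continuous; exact: smooth_on_derive.
have [d /= d0 dB] := (nbhs_ballP _ _).1 (uniform cDu Bx e0).
(* Adding 1 keeps the divisor positive when [v] is 0. *)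
have v1 : 0 < `|v| + 1 by rewrite ltr_pwDr.
near=> h.
have h0 : h != 0 by near: h; exact: nbhs_dnbhs_neq.
have hd : `|h| < d / (`|v| + 1) by near: h; apply: dnbhs0_lt; rewrite divr_gt0.
have shB s : `|s| <= `|h| -> ball x d (s *: v + x).
  move=> sh; rewrite -ball_normE /ball_ /= opprD addrCA subrr addr0 normrN normrZ.
  rewrite (le_lt_trans (ler_pM _ _ sh (lexx `|v|)))//.
  rewrite (@le_lt_trans _ _ (`|h| * (`|v| + 1)))//; first by rewrite ler_wpM2l// lerDl.
  by rewrite -ltr_pdivlMr.
have [Bhx _] := dB _ (shB h (lexx _)).
rewrite /segment_integral.
have [W1 pW1] := has_prim m cu Bhx; have [W2 pW2] := has_prim m cu Bx.
rewrite (integral01E pW1) (integral01E pW2).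
have pW := primitiveZ h^-1 (primitiveB pW1 pW2).
have -> : h^-1 *: (W1 1 - W1 0 - (W2 1 - W2 0)) =
    integral01 (h^-1 *: ((fun t : R => t ^+ m * u (sg (h *: v + x) t)) -
                 (fun t : R => t ^+ m * u (sg x t)))).
  rewrite (integral01E pW) !fctE -![_ *: _]/(_ * _); ring.
have eW : exists W, primitive W (h^-1 *: ((fun t : R => t ^+ m * u (sg (h *: v + x) t)) -
                 (fun t : R => t ^+ m * u (sg x t)))) by exists (h^-1 *: (W1 - W2)).
apply: (@integral01_bound _ _ e (has_prim m.+1 cDu Bx) eW).
move=> t t01; rewrite !fctE -mulrBr.
have sgD s : sg (s *: v + x) t = (t * s) *: v + sg x t.
  by rewrite /sg -addrA scalerDr scalerA addrA.
rewrite sgD.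
have [t0 t1] := andP t01.
have [|s s01 ->] := @MVT_dir R _ u (sg x t) ((t * h) *: v).
  move=> s s01; rewrite scalerA; apply: (derivable_scale_dir (t * h) _).1.
  rewrite mulrCA -sgD; apply: smooth_on_derivable su _; apply: sgB => //.
  have [] // := dB _ (shB (s * h) _).
  by case/andP: s01 => s0 s1; rewrite normrM ger0_norm// ler_piMl.
have [Bs Ds] := dB _ (shB (s * h) ltac:(by case/andP: s01 => s0 s1;
  rewrite normrM ger0_norm// ler_piMl)).
have -> : s *: (t * h *: v) + sg x t = sg ((s * h) *: v + x) t.
  by rewrite sgD scalerA; congr (_ *: _ + _); ring.
rewrite (derivable_scale_dir (t * h) _).2; last by apply: smooth_on_derivable su _;
  exact: sgB.
set D := 'D_v u _; set D' := 'D_v u _.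
have -> : t ^+ m.+1 * D - h^-1 *: (t ^+ m * (t * h *: D')) = t ^+ m.+1 * (D - D').
  by rewrite -![_ *: _]/(_ * _) exprS; field.
have De : `|D - D'| <= e by rewrite distrC; exact: Ds.
rewrite normrM (le_trans _ De)// ler_piMl//.
by rewrite normrX exprn_ile1// ger0_norm.
Unshelve. all: by end_near. Qed.

Lemma segment_integral_continuous m u :
  {in B, continuous u} -> {in B, continuous (segment_integral m u)}.
Proof.
move=> cu x /set_mem Bx.
suff : segment_integral m u y @[y --> nbhs x] --> segment_integral m u x by [].
apply/(cvgrPdist_le (F := nbhs x)) => e e0.
near=> y.
have [By uy] : B y /\ forall t, 0 <= t <= 1 -> `|u (sg y t) - u (sg x t)| <= e.
  by near: y; exact: uniform.
rewrite distrC.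
refine (@integral01_bound _ _ e (has_prim m cu By) (has_prim m cu Bx) _).
move=> t t01; rewrite -mulrBr normrM (le_trans _ (uy t t01))// ler_piMl//.
by case/andP: t01 => t0 t1; rewrite normrX exprn_ile1// ger0_norm.
Unshelve. all: by end_near. Qed.

Lemma smooth_segment_integral m u : smooth_on B u -> smooth_on B (segment_integral m u).
Proof.
move=> su k; elim: k m u su => [|k IH] m u su.
  by split => //; apply: segment_integral_continuous; have [] := su 0%N.
split; first by apply: segment_integral_continuous; have [] := su 0%N.
move=> v; split.
  by move=> x Bx; have [] := segment_integral_derive m v su Bx.
apply: Ck_ext (IH m.+1 _ (smooth_on_derive v su)) => //.
by move=> x /set_mem Bx; have [_ ->] := segment_integral_derive m v su Bx.
Qed.

(** Integrate the derivative of [f] along the segment from [p] to [x]: [g i] is the mean of the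
    [i]-th partial derivative over that segment, which degenerates to a point when [x] is [p]. *)
Lemma Hadamard_lemma (f : 'rV[R]_n -> R) : 0 < r -> smooth_on B f ->
  exists g : 'I_n -> 'rV[R]_n -> R, [/\ forall i, smooth_on B (g i),
    forall x, B x -> f x = f p + \sum_i (x 0 i - p 0 i) * g i x &
    forall i, g i p = 'D_('e_i) f p].
Proof.
move=> r0 sf; exists (fun i => segment_integral 0 ('D_('e_i) f)); split.
- by move=> i; exact/smooth_segment_integral/smooth_on_derive.
- move=> x Bx.
  have cD (i : 'I_n) : {in B, continuous ('D_('e_i) f)}.
    by move=> z /set_mem; apply: smooth_on_continuous; exact: smooth_on_derive.
  have [W pW] := choice (fun i => has_prim 0 (cD i) Bx).
  have pS := primitive_sum (fun i => primitiveZ (x 0 i - p 0 i) (pW i)).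
  have pf : primitive (fun t => f (sg x t))
      (\sum_i (x 0 i - p 0 i) *: (fun t => t ^+ 0 * 'D_('e_i) f (sg x t))).
    move=> t t01; have Bt := sgB Bx t01.
    have -> : (\sum_i (x 0 i - p 0 i) *: (fun t => t ^+ 0 * 'D_('e_i) f (sg x t))) t =
        'D_(x - p) f (sg x t).
      have [df Df] := C1_differentiable oB (sf 1%N) Bt.
      rewrite deriveE// Df fct_sumE; apply: eq_bigr => i _.
      by rewrite !fctE expr0 mul1r !mxE.
    by apply: derive_along; exact: smooth_on_derivable sf Bt.
  have := primitive_unique pf pS.
  rewrite /sg scale1r scale0r subrK add0r => /eqP; rewrite subr_eq => /eqP ->.
  rewrite addrC; congr (_ + _); rewrite !fct_sumE -sumrB; apply: eq_bigr => i _.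
  rewrite /segment_integral (integral01E (pW i)) !fctE.
  by rewrite -![_ *: _]/(_ * _) -mulrBr.
- move=> i; pose c := 'D_('e_i) f p.
  have pc : primitive (c *: id) (fun t => t ^+ 0 * 'D_('e_i) f (sg p t)).
    move=> t _; rewrite /sg subrr scaler0 add0r expr0 mul1r.
    by apply: is_derive_eq; rewrite [_ *: 1]mulr1.
  rewrite /segment_integral (integral01E pc) !fctE.
  by rewrite -![_ *: _]/(_ * _) mulr1 mulr0 subr0.
Qed.

End Hadamard.

Lemma near_open (T : topologicalType) (p : T) (P : T -> Prop) :
  (\forall q \near p, P q) -> exists N, [/\ open N, N p & forall q, N q -> P q].
Proof.
move=> H; have : nbhs p P by [].
by rewrite nbhsE => -[N [oN Np] NP]; exists N.
Qed.

(** * Smooth functions on a manifold: bump functions and local inverses *)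

Section ManifoldFunctions.
Variables (R : realType) (n : nat) (M : smoothManifold R n).
Implicit Types (phi psi : chart R M n) (p q : M) (f g : smoothFun M).

Lemma chart_image_open phi (A : set M) :
  open A -> A `<=` chart_dom phi -> open (phi @` A).
Proof.
move=> oA Adom; have -> : phi @` A =
    (phi @` chart_dom phi) `&` chart_inv phi @^-1` A.
  rewrite eqEsubset; split=> [y [q Aq <-]|y [[q dq <-]]] /=.
    by split; [exists q => //; exact: Adom|rewrite chart_mapK//; exact/mem_set/Adom].
  by rewrite chart_mapK//; [exists q|exact: mem_set].
rewrite openE => y [ycod Ay]; apply: filterI.
  by apply: open_nbhs_nbhs; split => //; exact: chart_cod_open.
have /= := chart_inv_continuous (mem_set ycod); apply.
exact: open_nbhs_nbhs.
Qed.

Lemma smoothFun_chart f phi : atlas phi ->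
  smooth_on (phi @` chart_dom phi) (f \o chart_inv phi).
Proof. by have /smooth_funP := smoothFunP f; exact. Qed.

Lemma smooth_fun_local (f : M -> R) :
  (forall p, exists g, \forall q \near p, f q = g q) -> smooth_fun f.
Proof.
move=> loc psi apsi; apply: smooth_on_near => _ [q dq <-].
have [g /near_open[N [oN Nq fg]]] := loc q.
pose A := N `&` chart_dom psi.
have oA : open A by apply: openI => //; exact: chart_dom_open.
exists (g \o chart_inv psi), (psi @` A); split.
- by apply: chart_image_open => // x [].
- by exists q.
- apply: smooth_on_subset (smoothFun_chart g apsi).
  by apply: image_subset => x [].
- move=> y /set_mem [x [Nx dx] <-] /=.
  by rewrite chart_mapK ?fg//; exact: mem_set.
Qed.

Lemma chart_map_near phi p (W : set 'rV[R]_n) :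
  chart_dom phi p -> open W -> W (phi p) -> \forall q \near p, chart_dom phi q /\ W (phi q).
Proof.
move=> dp oW Wp; apply: filterI.
  by apply: open_nbhs_nbhs; split => //; exact: chart_dom_open.
have /= := chart_map_continuous (mem_set dp); apply.
exact: open_nbhs_nbhs.
Qed.

(* The bump function vanishes outside a compact subset of the chart domain, so
   the product extended by 0 is smooth because M is Hausdorff. *)
Lemma chart_bump phi p (W : set 'rV[R]_n) :
  atlas phi -> chart_dom phi p -> open W -> W (phi p) ->
  exists chi : smoothFun M, [/\ \forall q \near p, chi q = 1,
    forall q, chi q != 0 -> chart_dom phi q /\ W (phi q) &
    forall u : 'rV[R]_n -> R, smooth_on W u ->
      smooth_fun (fun q => chi q * u (phi q))].
Proof.
move=> aphi dp oW Wp.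
pose V := W `&` (phi @` chart_dom phi).
have oV : open V by apply: openI => //; exact: chart_cod_open.
have : nbhs (phi p) V by apply: open_nbhs_nbhs; split => //; split => //; exists p.
move=> /nbhs_ballP[r /= r0 rV].
(* Halving the radius leaves the closed ball [C], off which the bump vanishes, compact and inside
   [V]. *)
have r20 : 0 < r / 2 by rewrite divr_gt0.
have [b [sb b1 b0]] := rV_bump (phi p) r20.
pose C := [set y : 'rV[R]_n | `|y - phi p| <= r / 2].
have CV : C `<=` V.
  move=> y /= yC; apply: rV; rewrite -ball_normE /ball_ /= distrC.
  by apply: le_lt_trans yC _; rewrite ltr_pdivrMr// ltr_pMr// ltr1n.
have cC : compact C.
  apply: bounded_closed_compact.
    exists (r / 2 + `|phi p|); split; first by rewrite num_real.
    move=> z zr y /= yC; apply: le_trans (ltW zr).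
    by rewrite -[y](subrK (phi p)) (le_trans (ler_normD _ _))// lerD2r.
  rewrite /C -[X in closed X]/((fun y : 'rV[R]_n => `|y - phi p|) @^-1` [set x | x <=
    r / 2]).
  apply: closed_comp; last exact: closed_le.
  move=> y _; apply: (@continuous_comp _ _ _ (fun y : 'rV[R]_n => y - phi p)
    (@Num.norm R _)).
    exact: (@cvgB R 'rV[R]_n 'rV[R]_n (nbhs y) _ id (cst (phi p)) y (phi p) cvg_id
      (cvg_cst _)).
  exact: norm_continuous.
pose K := chart_inv phi @` C.
have cK : closed K.
  apply: compact_closed; first exact: carrier_hausdorff.
  apply: continuous_compact => //; apply: continuous_in_subspaceT => y /set_mem /CV [_ yc].
  exact/chart_inv_continuous/mem_set.
pose F (u : 'rV[R]_n -> R) q :=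
  if `[< chart_dom phi q >] then b (phi q) * u (phi q) else 0.
have F0 u q : ~ K q -> F u q = 0.
  move=> Kq; rewrite /F; case: asboolP => // dq.
  rewrite b0 ?mul0r// leNgt; apply/negP => qr; apply: Kq.
  by exists (phi q); [exact: ltW|rewrite chart_mapK//; exact: mem_set].
have KW q : K q -> chart_dom phi q /\ W (phi q).
  move=> [y /CV[Wy [x dx xy]] yq].
  have xq : x = q by rewrite -yq -xy chart_mapK//; exact: mem_set.
  by rewrite -xq xy.
have sF u : smooth_on W u -> smooth_fun (F u).
  move=> su psi apsi; apply: smooth_on_near => _ [q dq <-].
  have [Kq|Kq] := pselect (K q); last first.
    exists (cst 0), (psi @` (chart_dom psi `&` ~` K)); split.
    - apply: chart_image_open; last by move=> x [].
      by apply: openI; [exact: chart_dom_open|exact: closed_openC].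
    - by exists q.
    - exact: smooth_on_cst.
    - move=> _ /set_mem [x [dx Kx] <-] /=.
      by rewrite chart_mapK ?F0//; exact: mem_set.
  have [dphiq Wq] := KW _ Kq.
  have [N [oN Nq NW]] := near_open (chart_map_near dphiq oW Wq).
  pose A := chart_dom psi `&` N.
  have oA : open A by apply: openI => //; exact: chart_dom_open.
  have oPA : open (psi @` A) by apply: chart_image_open => // x [].
  exists ((b * u) \o (phi \o chart_inv psi)), (psi @` A); split => //.
  - by exists q.
  - apply: (smooth_on_comp oPA oW).
    + by move=> _ [x [dx /NW[_ Wx]] <-] /=; rewrite chart_mapK//; exact: mem_set.
    + apply: smooth_on_subset (atlas_compatible apsi aphi).
      by apply: image_subset => x [dx /NW[]].
    + by apply: smooth_onM => //; exact: smooth_on_subset sb.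
  - move=> _ /set_mem [x [dx /NW [dx' Wx]] <-] /=.
    by rewrite chart_mapK ?inE// /F; case: asboolP.
have sF1 : smooth_fun (F (cst 1)) by apply: sF; exact: smooth_on_cst.
exists (mkSmooth sF1); split.
- have := chart_map_near dp openT I => H.
  have Hb : \forall q \near p, b (phi q) = 1.
    exact: (chart_map_continuous (mem_set dp) b1).
  near=> q; rewrite /= /F; case: asboolP;
    last by have [] : chart_dom phi q /\ True by near: q.
  by move=> dq; rewrite mulr1; near: q.
- move=> q; have [Kq _|Kq] := pselect (K q); last by rewrite /= F0// eqxx.
  exact: KW.
- move=> u su; have -> : (fun q => mkSmooth sF1 q * u (phi q)) = F u; last exact: sF.
  by apply/funext => q; rewrite /= /F; case: ifP => _; rewrite ?mulr1 ?mul0r.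
Unshelve. all: by end_near. Qed.

Lemma bump p (U : set M) : nbhs p U ->
  exists chi : smoothFun M, (\forall q \near p, chi q = 1) /\ forall q, chi q != 0 -> U q.
Proof.
rewrite nbhsE => -[N [oN Np] NU].
have [phi aphi dp] := atlas_cover p.
pose A := N `&` chart_dom phi.
have oA : open A by apply: openI => //; exact: chart_dom_open.
have oP : open (phi @` A) by apply: chart_image_open => // x [].
have [|chi [chi1 chi0 _]] := chart_bump aphi dp oP; first by exists p.
exists chi; split => // q /chi0[dq [x [Nx dx] xq]].
apply: NU; suff -> : q = x by [].
by rewrite -(chart_mapK (mem_set dx)) xq chart_mapK//; exact: mem_set.
Qed.

Lemma smoothFun_ext f g : (forall q, f q = g q) -> f = g.
Proof. by move=> fg; apply/val_inj/funext. Qed.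

Lemma smoothFun_sumE I (r : seq I) (P : pred I) (F : I -> smoothFun M) q :
  (\sum_(i <- r | P i) F i) q = \sum_(i <- r | P i) F i q.
Proof. by elim/big_rec2 : _ => // i y1 y2 _ <-. Qed.

Lemma smooth_fun_continuous f : continuous (f : M -> R).
Proof.
move=> p; have [phi aphi dp] := atlas_cover p.
have cf : {for p, continuous ((f \o chart_inv phi) \o phi)}.
  apply: continuous_comp; first exact/chart_map_continuous/mem_set.
  by apply: smooth_on_continuous (smoothFun_chart f aphi) _; exists p.
have : {near p, (f \o chart_inv phi) \o phi =1 f}.
  have := chart_map_near dp openT I; apply: filterS => q [dq _] /=.
  by rewrite chart_mapK//; exact: mem_set.
move=> h; rewrite /continuous_at -(nbhs_singleton h).
by apply: cvg_trans cf; apply: near_eq_cvg; apply: filterS h => q ->.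
Qed.

Lemma smooth_funV f : (forall q, f q != 0) -> smooth_fun (fun q => (f q)^-1).
Proof.
move=> f0 phi aphi; apply: (@smooth_onV _ _ _ (f \o chart_inv phi)).
- exact: chart_cod_open.
- by move=> x _; exact: f0.
- exact: smoothFun_chart.
Qed.

Lemma smoothFun_inv_near f p : f p != 0 ->
  exists g, \forall q \near p, g q * f q = 1.
Proof.
move=> fp0.
have nf0 : \forall q \near p, f q != 0.
  have := @smooth_fun_continuous f p; move/(@cvgr_neq0 _ _ _ _ _ _) => /(_ fp0).
  exact.
have [chi [chi1 chi0]] := bump nf0.
(* Where [f] vanishes [chi] does too, so [d] has no zero; near [p], where [chi] is 1, it is the
   square of [f], and [f / d] inverts [f]. *)
pose d : smoothFun M := f * f + (1 - chi) * (1 - chi).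
have d0 q : d q != 0.
  rewrite gt_eqF// -[d q]/(f q * f q + (1 - chi q) * (1 - chi q)).
  have [fq|fq] := eqVneq (f q) 0; last first.
    by rewrite ltr_pwDl// -expr2 ?sqr_ge0// exprn_even_gt0.
  have -> : chi q = 0 by apply/eqP/negP => /negP/chi0; rewrite fq eqxx.
  by rewrite fq mul0r add0r subr0 mulr1.
exists (f * mkSmooth (smooth_funV d0)); near=> q.
have chiq : chi q = 1 by near: q.
have fq : f q != 0 by near: q; exact: nf0.
rewrite -[LHS]/(f q * (f q * f q + (1 - chi q) * (1 - chi q))^-1 * f q) chiq.
by field.
Unshelve. all: by end_near. Qed.

End ManifoldFunctions.

(** * Tangent vectors, covectors and coordinate vectors *)

Section TangentSpace.
Variables (R : realType) (n : nat) (M : smoothManifold R n).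
Implicit Types (phi psi : chart R M n) (p q : M) (f g : smoothFun M).

Lemma tangentZ p (v : tangent p) (a : R) f : v (a *: f) = a * v f.
Proof.
have v0 : v 0 = 0 by have := tangentD v 0 0; rewrite addr0 => h; lra.
by have := tangent_linear v a f 0; rewrite addr0 v0 addr0.
Qed.

Lemma tangent0 p (v : tangent p) : v 0 = 0.
Proof. by rewrite -(scale0r (0 : smoothFun M)) tangentZ mul0r. Qed.

Lemma tangentB p (v : tangent p) f g : v (f - g) = v f - v g.
Proof. by rewrite tangentD -scaleN1r tangentZ mulN1r. Qed.

Lemma tangent_sum p (v : tangent p) I (r : seq I) (P : pred I) (F : I -> smoothFun M) :
  v (\sum_(i <- r | P i) F i) = \sum_(i <- r | P i) v (F i).
Proof.
by elim/big_rec2 : _ => [|i y1 y2 _ <-]; [exact: tangent0|exact: tangentD].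
Qed.

Lemma tangent1 p (v : tangent p) : v 1 = 0.
Proof.
have := tangent_leibniz v 1 1; rewrite mulr1.
by rewrite -[(1 : smoothFun M) p]/(1 : R) mulr1 mul1r => h; lra.
Qed.

Definition cstF (a : R) : smoothFun M := a *: (1 : smoothFun M).

Lemma cstFE a q : cstF a q = a.
Proof. by rewrite -[LHS]/(a * 1) mulr1. Qed.

Lemma tangent_cst p (v : tangent p) (a : R) : v (cstF a) = 0.
Proof. by rewrite tangentZ tangent1 mulr0. Qed.

Lemma tangent_ext p (v w : tangent p) : (forall f, v f = w f) -> v = w.
Proof. by move=> vw; apply/val_inj/funext. Qed.

Lemma tangentZE p (a : R) (v : tangent p) f : (a *: v) f = a * v f.
Proof. by []. Qed.

Lemma tangent_sumE p I (r : seq I) (P : pred I) (F : I -> tangent p) f :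
  (\sum_(i <- r | P i) F i) f = \sum_(i <- r | P i) F i f.
Proof. by elim/big_rec2 : _ => // i y1 y2 _ <-. Qed.

(** A cut-off [chi] equal to 1 near [p] and supported where [f] and [g] agree gives
    [chi * (f - g) = 0] everywhere; the Leibniz rule at [p] then leaves [v (f - g) = 0]. *)
Lemma tangent_local p (v : tangent p) f g : (\forall q \near p, f q = g q) -> v f = v g.
Proof.
move=> fg; have [chi [chi1 chi0]] := bump fg.
have : chi * (f - g) = 0.
  apply: smoothFun_ext => q; rewrite -[LHS]/(chi q * (f q - g q)) -[RHS]/(0 : R).
  have [->|/chi0 ->] := eqVneq (chi q) 0; first by rewrite mul0r.
  by rewrite subrr mulr0.
move=> /(congr1 v); rewrite tangent0 tangent_leibniz tangentB.
rewrite (nbhs_singleton chi1) mul1r -[(f - g) p]/(f p - g p) (nbhs_singleton fg)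
  subrr mulr0 add0r.
by move=> /subr0_eq.
Qed.

Lemma covectorD p (xi : cotangent p) v w : xi (v + w) = xi v + xi w.
Proof.
by have /asboolP := cotangentP xi => /(_ 1 v w); rewrite scale1r mul1r.
Qed.

Lemma covector0 p (xi : cotangent p) : xi 0 = 0.
Proof. by have := covectorD xi 0 0; rewrite addr0 => h; lra. Qed.

Lemma covectorZ p (xi : cotangent p) (a : R) v : xi (a *: v) = a * xi v.
Proof.
by have /asboolP := cotangentP xi => /(_ a v 0); rewrite addr0 covector0 addr0.
Qed.

Lemma covectorB p (xi : cotangent p) v w : xi (v - w) = xi v - xi w.
Proof. by rewrite covectorD -scaleN1r covectorZ mulN1r. Qed.

Lemma covector_sum p (xi : cotangent p) I (r : seq I) (P : pred I) (F : I -> tangent p) :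
  xi (\sum_(i <- r | P i) F i) = \sum_(i <- r | P i) xi (F i).
Proof.
by elim/big_rec2 : _ => [|i y1 y2 _ <-]; [exact: covector0|exact: covectorD].
Qed.

Lemma cotangent_ext p (v w : cotangent p) : (forall u, v u = w u) -> v = w.
Proof. by move=> vw; apply/val_inj/funext. Qed.

Lemma cotangentZE p (a : R) (xi : cotangent p) v : (a *: xi) v = a * xi v.
Proof. by []. Qed.

Lemma cotangentDE p (xi eta : cotangent p) v : (xi + eta) v = xi v + eta v.
Proof. by []. Qed.

Lemma cotangent0E p v : (0 : cotangent p) v = 0.
Proof. by []. Qed.

Lemma cotangent_sumE p I (r : seq I) (P : pred I) (F : I -> cotangent p) v :
  (\sum_(i <- r | P i) F i) v = \sum_(i <- r | P i) F i v.
Proof. by elim/big_rec2 : _ => // i y1 y2 _ <-. Qed.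

Lemma chart_derivation phi p i : atlas phi -> chart_dom phi p ->
  derivation_at p (fun f => 'D_('e_i) (f \o chart_inv phi) (phi p)).
Proof.
move=> aphi dp; have cp : (phi @` chart_dom phi) (phi p) by exists p.
have df f : derivable (f \o chart_inv phi) (phi p) 'e_i.
  exact: smooth_on_derivable (smoothFun_chart f aphi) cp.
split=> [a f g|f g].
  have -> : (a *: f + g) \o chart_inv phi =
    a *: (f \o chart_inv phi : _ -> R) + (g \o chart_inv phi : _ -> R) by [].
  rewrite deriveD; [|apply: derivableZ; exact: df|exact: df].
  by rewrite deriveZ; [|exact: df].
have -> : (f * g) \o chart_inv phi =
    (f \o chart_inv phi : _ -> R) * (g \o chart_inv phi : _ -> R) by [].
rewrite deriveM; [|exact: df|exact: df].
rewrite /= chart_mapK; last exact: mem_set.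
by rewrite -![_ *: _]/(_ * _); ring.
Qed.

Lemma coord_vectorE phi i p f : atlas phi -> chart_dom phi p ->
  coord_vector phi i p f = 'D_('e_i) (f \o chart_inv phi) (phi p).
Proof.
move=> aphi dp; rewrite /coord_vector; case: xgetP => [v _ ->//|].
by move=> /(_ (mkTangent (chart_derivation i aphi dp))) [].
Qed.

(* Hadamard's lemma expresses f near p through the coordinate functions. *)
Lemma tangent_coord phi p (v : tangent p) (x : 'I_n -> smoothFun M) :
  atlas phi -> chart_dom phi p ->
  (forall i, \forall q \near p, x i q = phi q 0 i) ->
  v = \sum_i v (x i) *: coord_vector phi i p.
Proof.
move=> aphi dp xphi; apply: tangent_ext => f.
have : nbhs (phi p) (phi @` chart_dom phi).
  by apply: open_nbhs_nbhs; split; [exact: chart_cod_open|exists p].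
move=> /nbhs_ballP[r /= r0 rV].
have sf : smooth_on (ball (phi p) r) (f \o chart_inv phi).
  exact: smooth_on_subset rV (smoothFun_chart f aphi).
have [g [sg fg gp]] := Hadamard_lemma r0 sf.
have [chi [chi1 chi0 chiu]] := chart_bump aphi dp (ball_open (phi p) r) (ballxx _ r0).
pose G i := mkSmooth (chiu _ (sg i)).
(* The Hadamard expansion holds only near [p], which suffices for a derivation; it kills the
   constant, and by the Leibniz rule only [v (x i)] times the value of [g i] at the base point
   remains. *)
have -> : v f = v (cstF (f p) + \sum_i (x i - cstF (phi p 0 i)) * G i).
  apply: tangent_local; near=> q.
  rewrite -[RHS]/(cstF (f p) q + (\sum_i (x i - cstF (phi p 0 i)) * G i) q) cstFE
    smoothFun_sumE.
  have chiq : chi q = 1 by near: q.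
  have [dq Bq] : chart_dom phi q /\ ball (phi p) r (phi q).
    by apply: chi0; rewrite chiq oner_neq0.
  have := fg _ Bq; rewrite /= !chart_mapK ?inE// => ->; congr (_ + _);
    apply: eq_bigr => i _.
  rewrite -[RHS]/((x i q - cstF (phi p 0 i) q) * (chi q * g i (phi q))) chiq mul1r cstFE.
  congr ((_ - _) * _); apply/esym; move: i; near: q; exact: filter_forall.
rewrite tangentD tangent_cst add0r tangent_sum tangent_sumE; apply: eq_bigr => i _.
rewrite tangent_leibniz tangentB tangent_cst subr0.
rewrite -[(x i - _) p]/(x i p - cstF (phi p 0 i) p) cstFE (nbhs_singleton (xphi i))
  subrr mul0r addr0.
rewrite -[RHS]/(v (x i) * coord_vector phi i p f) coord_vectorE// -gp.
by rewrite -[G i p]/(chi p * g i (phi p)) (nbhs_singleton chi1) mul1r.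
Unshelve. all: by end_near. Qed.

End TangentSpace.

(** * Vector fields, one-forms and Lie brackets in local coordinates *)

Section Fields.
Variables (R : realType) (n : nat) (M : smoothManifold R n).
Implicit Types (phi : chart R M n) (p q : M) (f g : smoothFun M).
Implicit Types (X Y Z : vfield M) (eta zeta : oneform M).

Lemma vfield_local (w : forall p, tangent p) :
  (forall p, exists X, \forall q \near p, w q = X q) ->
  forall f, smooth_fun (fun p => w p f).
Proof.
move=> loc f; apply: smooth_fun_local => p; have [X wX] := loc p.
by exists (vapply X f); apply: filterS wX => q ->.
Qed.

Lemma oneform_local (w : forall p, cotangent p) :
  (forall p, exists eta, \forall q \near p, w q = eta q) ->
  forall X, smooth_fun (fun p => w p (X p)).
Proof.
move=> loc X; apply: smooth_fun_local => p; have [eta wX] := loc p.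
by exists (contract eta X); apply: filterS wX => q ->.
Qed.

Fact vf_comb_smooth I (r : seq I) (P : pred I) (a : I -> smoothFun M) (X : I ->
  vfield M) f :
  smooth_fun (fun p => (\sum_(i <- r | P i) a i p *: X i p : tangent p) f).
Proof.
have /smooth_funP := smoothFunP (\sum_(i <- r | P i) a i * vapply (X i) f).
by congr smooth_fun; apply/funext => p; rewrite tangent_sumE smoothFun_sumE.
Qed.

(** Vector fields are given no module structure; finite combinations with function coefficients are
    built in one go, as brackets and frames use them. *)
Definition vf_comb I (r : seq I) (P : pred I) (a : I -> smoothFun M) (X : I -> vfield
  M) : vfield M :=
  VField (@vf_comb_smooth I r P a X).

Definition vf_scale f X : vfield M := vf_comb [:: tt] xpredT (fun=> f) (fun=> X).

Lemma vf_scaleE f X p : vf_scale f X p = f p *: X p.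
Proof. by rewrite /= big_seq1. Qed.

Lemma oneform_sumE I (r : seq I) (P : pred I) (F : I -> oneform M) p :
  (\sum_(i <- r | P i) F i) p = \sum_(i <- r | P i) F i p.
Proof.
elim/big_rec2 : _ => [|i y1 y2 _ <-]; first by apply: cotangent_ext.
by apply: cotangent_ext.
Qed.

Lemma oneform_zE f eta p : (f *: eta) p = f p *: eta p.
Proof. by apply: cotangent_ext. Qed.

Lemma oneform_dE eta zeta p : (eta + zeta) p = eta p + zeta p.
Proof. by apply: cotangent_ext. Qed.

Fact coord_field_smooth phi (aphi : atlas phi) chi i
    (chiu : forall u : 'rV[R]_n -> R, smooth_on (phi @` chart_dom phi) u ->
      smooth_fun (fun q => chi q * u (phi q)))
    (chi0 : forall q, chi q != 0 -> chart_dom phi q) f :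
  smooth_fun (fun p => (chi p *: coord_vector phi i p : tangent p) f).
Proof.
have := chiu _ (smooth_on_derive 'e_i (smoothFun_chart f aphi)).
congr smooth_fun; apply/funext => q.
rewrite -[RHS]/(chi q * coord_vector phi i q f).
have [->|/chi0 dq] := eqVneq (chi q) 0; first by rewrite !mul0r.
by rewrite coord_vectorE.
Qed.

(** Global functions and fields that behave as coordinates near [p] only; the functions [x i] are
    retained through their differentials, as components with respect to [d]. *)
Definition coordinates phi p (x : 'I_n -> smoothFun M) (d : 'I_n -> vfield M) : Prop :=
  \forall q \near p, [/\ chart_dom phi q, forall i, d i q = coord_vector phi i q &
    forall v : tangent q, v = \sum_i v (x i) *: d i q].

Lemma coordinates_exist phi p : atlas phi -> chart_dom phi p ->
  exists x d, coordinates phi p x d.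
Proof.
move=> aphi dp.
have oC : open (phi @` chart_dom phi) by exact: chart_cod_open.
have [|chi [chi1 chi0 chiu]] := chart_bump aphi dp oC; first by exists p.
have chid q : chi q != 0 -> chart_dom phi q by move=> /chi0[].
pose x i := mkSmooth (chiu _ (smooth_on_proj (phi @` chart_dom phi) i)).
exists x, (fun i => VField (coord_field_smooth aphi i chiu chid)).
(* [tangent_coord] at [q] asks for the coordinate functions on a neighbourhood of [q], hence the
   nested nearness. *)
have nchi : \forall q \near p, \forall z \near q, chi z = 1.
  exact: (nbhs_interior chi1).
apply: filterS nchi => q chiq; have chiq1 := nbhs_singleton chiq.
have dq : chart_dom phi q by apply: chid; rewrite chiq1 oner_neq0.
have dE i : chi q *: coord_vector phi i q = coord_vector phi i q by rewrite chiq1 scale1r.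
split => // v; rewrite [LHS](tangent_coord (x := x) v aphi dq).
  by apply: eq_bigr => i _; rewrite -dE.
by move=> i; apply: filterS chiq => z; rewrite /= => ->; rewrite mul1r.
Qed.

Lemma coordinates_exist' p : exists phi x d, atlas phi /\ coordinates phi p x d.
Proof.
have [phi aphi dp] := atlas_cover p.
by have [x [d H]] := coordinates_exist aphi dp; exists phi, x, d.
Qed.

Fact differential_covector f p : (fun v : tangent p => v f) \in @covector_pred R n M p.
Proof. exact/asboolP. Qed.

Fact differential_smooth f X : smooth_fun (fun p => Cotangent (differential_covector
  f p) (X p)).
Proof. exact: (vfieldP X f). Qed.

Definition differential f : oneform M := OneForm (differential_smooth f).

Lemma tangent_extend p (v : tangent p) : exists X : vfield M, X p = v.
Proof.
have [phi [x [d [_ /nbhs_singleton [_ _ H]]]]] := coordinates_exist' p.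
exists (vf_comb (index_enum 'I_n) xpredT (fun i => cstF M (v (x i))) d).
by rewrite [RHS]H; apply: eq_bigr => i _; congr (_ *: _); exact: cstFE.
Qed.

Lemma cotangent_extend p (xi : cotangent p) : exists eta : oneform M, eta p = xi.
Proof.
have [phi [x [d [_ /nbhs_singleton [_ _ H]]]]] := coordinates_exist' p.
exists (\sum_i cstF M (xi (d i p)) *: differential (x i)).
rewrite oneform_sumE; apply: cotangent_ext => v;
  rewrite cotangent_sumE [in RHS](H v) covector_sum.
by apply: eq_bigr => i _;
  rewrite oneform_zE covectorZ -[LHS]/(cstF M _ p * v (x i)) cstFE mulrC.
Qed.

Lemma lieE X Y p f : lie X Y p f = X p (vapply Y f) - Y p (vapply X f).
Proof. by []. Qed.

Lemma lie_local X X' Y p : (\forall q \near p, X q = X' q) -> lie X Y p = lie X' Y p.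
Proof.
move=> XX'; apply: tangent_ext => f; rewrite !lieE (nbhs_singleton XX'); congr (_ - _).
by apply: tangent_local; apply: filterS XX' => q /= ->.
Qed.

Lemma lieC X Y p : lie X Y p = - lie Y X p.
Proof. by apply: tangent_ext => f; rewrite -[RHS]/(- (lie Y X p f)) !lieE opprB. Qed.

Lemma lie_comb I (r : seq I) (P : pred I) (a : I -> smoothFun M) (X : I -> vfield M) Y p :
  lie (vf_comb r P a X) Y p =
  \sum_(i <- r | P i) (a i p *: lie (X i) Y p - Y p (a i) *: X i p).
Proof.
apply: tangent_ext => f; rewrite lieE tangent_sumE tangent_sumE.
have -> : vapply (vf_comb r P a X) f = \sum_(i <- r | P i) a i * vapply (X i) f.
  by apply: smoothFun_ext => q;
    rewrite smoothFun_sumE -[LHS]/((\sum_(i <- r | P i) a i q *: X i q : tangent q)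
      f) tangent_sumE.
rewrite tangent_sum -sumrB; apply: eq_bigr => i _.
rewrite tangent_leibniz -[RHS]/(a i p * lie (X i) Y p f - Y p (a i) * X i p f) lieE.
rewrite -[(a i p *: X i p) _]/(a i p * X i p (vapply Y f)) -[vapply (X i) f p]/(X i p
  f); ring.
Qed.

End Fields.

(** * Frames adapted to Q *)

Section SmoothMatrix.
Variables (R : realType) (n : nat) (M : smoothManifold R n).
Implicit Types (p q : M).

(** Evaluation is a ring morphism, so [map_mx (ev q)] commutes with products, determinants and
    adjugates of matrices of functions. *)
Definition ev q (f : smoothFun M) : R := f q.

Fact ev_is_zmod_morphism q : zmod_morphism (ev q).
Proof. by []. Qed.
Fact ev_is_monoid_morphism q : monoid_morphism (ev q).
Proof. by []. Qed.
HB.instance Definition _ q :=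
  GRing.isZmodMorphism.Build (smoothFun M) R (ev q) (ev_is_zmod_morphism q).
HB.instance Definition _ q :=
  GRing.isMonoidMorphism.Build (smoothFun M) R (ev q) (ev_is_monoid_morphism q).

(* Cramer's rule, with the determinant inverted near p. *)
Lemma smooth_matrix_inverse k (C : 'M[smoothFun M]_k) p :
  \det (map_mx (ev p) C) != 0 ->
  exists D : 'M[smoothFun M]_k, \forall q \near p,
    map_mx (ev q) C *m map_mx (ev q) D = 1%:M /\
    map_mx (ev q) D *m map_mx (ev q) C = 1%:M.
Proof.
rewrite det_map_mx => /smoothFun_inv_near[u u1].
exists (u *: \adj C); apply: filterS u1 => q uq.
rewrite -!map_mxM -scalemxAr -scalemxAl mul_mx_adj mul_adj_mx scale_scalar_mx.
by rewrite map_scalar_mx; split; congr (_%:M); exact: uq.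
Qed.

End SmoothMatrix.

Section Frames.
Variables (R : realType) (n : nat) (M : smoothManifold R n) (S : subRiemannian M).
Local Notation Q := (sr_Q S).
Local Notation k := (sr_rank S).
Implicit Types (p q : M) (X Y : vfield M) (eta : oneform M).

Lemma sr_Q_linear p a (v w : tangent p) : Q v -> Q w -> Q (a *: v + w).
Proof.
have [X /nbhs_singleton [QX _]] := sr_frame S p.
move=> /QX[b ->] /QX[c ->]; apply/QX; exists (fun i => a * b i + c i).
rewrite scaler_sumr -big_split; apply: eq_bigr => i _ /=.
by rewrite scalerDl scalerA.
Qed.

Lemma sr_Q_0 p : Q (0 : tangent p).
Proof.
have [X /nbhs_singleton [QX _]] := sr_frame S p.
by apply/QX; exists (fun=> 0); rewrite big1// => i _; rewrite scale0r.
Qed.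

Lemma sr_QZ p a (v : tangent p) : Q v -> Q (a *: v).
Proof. by move=> Qv; rewrite -[_ *: _]addr0; apply: sr_Q_linear => //; exact: sr_Q_0. Qed.

Lemma sr_QD p (v w : tangent p) : Q v -> Q w -> Q (v + w).
Proof. by rewrite -{2}[v]scale1r; exact: sr_Q_linear. Qed.

Lemma sr_Q_sum p I (r : seq I) (P : pred I) (F : I -> tangent p) :
  (forall i, P i -> Q (F i)) -> Q (\sum_(i <- r | P i) F i).
Proof. by move=> QF; elim/big_ind : _ => //; [exact: sr_Q_0|exact: sr_QD]. Qed.

(** The fields of a local frame lie in Q only near [p]; multiplied by a bump function supported
    there they become global sections of Q. *)
Lemma section_Q_frame p : exists E : 'I_k -> vfield M,
  (forall j, section_Q S (E j)) /\ \forall q \near p,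
    (forall v, Q v <-> exists a : 'I_k -> R, v = \sum_j a j *: E j q) /\
    (forall a : 'I_k -> R, \sum_j a j *: E j q = 0 -> forall j, a j = 0).
Proof.
have [X nX] := sr_frame S p; have [chi [chi1 chi0]] := bump nX.
exists (fun j => vf_scale chi (X j)); split.
  move=> j q; rewrite vf_scaleE.
  have [->|/chi0 [QX _]] := eqVneq (chi q) 0; first by rewrite scale0r; exact: sr_Q_0.
  apply/sr_QZ/QX; exists (fun i => (i == j)%:R).
  by rewrite (bigD1 j)//= eqxx scale1r big1 ?addr0// => i /negbTE ->; rewrite scale0r.
near=> q.
have chiq : chi q = 1 by near: q.
have EX (a : 'I_k -> R) : \sum_j a j *: vf_scale chi (X j) q = \sum_j a j *: X j q.
  by apply: eq_bigr => j _; rewrite vf_scaleE chiq scale1r.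
have [QX iX] : (forall v, Q v <-> exists a : 'I_k -> R, v = \sum_j a j *: X j q) /\
  (forall a : 'I_k -> R, \sum_j a j *: X j q = 0 -> forall j, a j = 0) by near: q.
split=> [v|a]; last by rewrite EX; exact: iX.
by split=> [/QX[a ->]|[a]]; [exists a; rewrite EX|rewrite EX => va; apply/QX; exists a].
Unshelve. all: by end_near. Qed.

Lemma sr_h_suml p I (r : seq I) (a : I -> R) (F : I -> tangent p) (w : tangent p) :
  (forall i, Q (F i)) -> Q w ->
  sr_h S (\sum_(i <- r) a i *: F i) w = \sum_(i <- r) a i * sr_h S (F i) w.
Proof.
move=> QF Qw.
have h0 : sr_h S (0 : tangent p) w = 0.
  have := sr_h_linear 1 (sr_Q_0 p) (sr_Q_0 p) Qw; rewrite scale1r addr0 mul1r => h; lra.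
elim: r => [|i r IH]; first by rewrite !big_nil.
rewrite !big_cons sr_h_linear ?IH//; apply: sr_Q_sum => j _; exact: sr_QZ.
Qed.

Lemma sr_h_sumr p I (r : seq I) (a : I -> R) (F : I -> tangent p) (w : tangent p) :
  (forall i, Q (F i)) -> Q w ->
  sr_h S w (\sum_(i <- r) a i *: F i) = \sum_(i <- r) a i * sr_h S w (F i).
Proof.
move=> QF Qw; rewrite sr_hC//; last by apply: sr_Q_sum => i _; exact: sr_QZ.
by rewrite sr_h_suml//; apply: eq_bigr => i _; rewrite sr_hC.
Qed.

Lemma sr_h0l p (w : tangent p) : Q w -> sr_h S 0 w = 0.
Proof.
move=> Qw; have := sr_h_suml [::] (fun=> 0) (fun i : unit => sr_Q_0 p) Qw.
by rewrite !big_nil.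
Qed.

Lemma sr_h_inj p (v v' : tangent p) : Q v -> Q v' ->
  (forall w, Q w -> sr_h S v w = sr_h S v' w) -> v = v'.
Proof.
move=> Qv Qv' vv'; apply/eqP; rewrite -subr_eq0; apply/negP => /negP/eqP d0.
have Qd : Q (v - v') by rewrite addrC -scaleN1r; exact: sr_Q_linear.
have := sr_h_gt0 Qd d0.
rewrite addrC -scaleN1r sr_h_linear//; last by rewrite scaleN1r addrC.
by rewrite vv' ?mulN1r ?addNr ?ltxx// scaleN1r addrC.
Qed.

(** In a frame of Q the dual of [al] has components [al (E l)] multiplied by the inverse of the Gram
    matrix [G] of h. Positivity of h makes [G] nonsingular at [p], hence smoothly invertible near
    [p]. *)
Lemma sr_g_local (al : oneform M) p : exists X, \forall q \near p,
  Q (X q) /\ forall w, Q w -> sr_h S (X q) w = al q w.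
Proof.
have [E [QE nE]] := section_Q_frame p.
pose G : 'M[smoothFun M]_k := \matrix_(i, j) mkSmooth (sr_h_smooth (QE i) (QE j)).
have [spE inE'] := nbhs_singleton nE.
have dG : \det (map_mx (ev p) G) != 0.
  apply/det0P => -[v /eqP v0 vG]; apply: v0; apply/rowP => i; rewrite mxE.
  apply: (inE' (v 0)); apply: sr_h_inj; [|exact: sr_Q_0|].
    by apply: sr_Q_sum => j _; apply: sr_QZ; exact: QE.
  move=> w /spE[b ->]; rewrite !sr_h_sumr//; try by move=> j; exact: QE.
    apply: eq_bigr => l _; rewrite sr_h_suml; [|by move=> j; exact: QE|exact: QE].
    rewrite sr_h0l; last exact: QE.
    by have /rowP/(_ l) := vG; rewrite !mxE => vGl; rewrite -[in RHS]vGl;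
      congr (_ * _); apply: eq_bigr => j _; rewrite !mxE.
  by apply: sr_Q_0.
  by apply: sr_Q_sum => j _; apply: sr_QZ; exact: QE.
have [D nD] := smooth_matrix_inverse dG.
exists (vf_comb (index_enum 'I_k) xpredT
  (fun j => \sum_l contract al (E l) * D l j) E).
near=> q.
have [spq _] : (forall v, Q v <-> exists a : 'I_k -> R, v = \sum_j a j *: E j q) /\
    (forall a : 'I_k -> R, \sum_j a j *: E j q = 0 -> forall j, a j = 0) by near: q.
have [_ DG] : map_mx (ev q) G *m map_mx (ev q) D = 1%:M /\
    map_mx (ev q) D *m map_mx (ev q) G = 1%:M by near: q.
set V := vf_comb _ _ _ _.
have VE : V q = \sum_j (\sum_l al q (E l q) * D l j q) *: E j q.
  by apply: eq_bigr => j _; rewrite smoothFun_sumE.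
have QV : Q (V q) by rewrite VE; apply: sr_Q_sum => j _; apply: sr_QZ; exact: QE.
split => // w /spq[b ->]; rewrite sr_h_sumr//; last by move=> j; exact: QE.
rewrite covector_sum; apply: eq_bigr => m _; rewrite covectorZ; congr (_ * _).
rewrite VE sr_h_suml; [|by move=> j; exact: QE|exact: QE].
under eq_bigr do rewrite mulr_suml.
rewrite exchange_big /= (bigD1 m)//= [X in X + _](_ : _ = al q (E m q)); last first.
  under eq_bigr do rewrite -mulrA.
  rewrite -mulr_sumr; have /matrixP/(_ m m) := DG; rewrite !mxE eqxx => H.
  by rewrite -[RHS]mulr1 -[X in _ = _ * X]H; congr (_ * _); apply: eq_bigr => j _;
    rewrite !mxE.
rewrite big1 ?addr0// => l lm; under eq_bigr do rewrite -mulrA.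
rewrite -mulr_sumr; have /matrixP/(_ l m) := DG; rewrite !mxE (negbTE lm) => H.
by rewrite -[RHS](mulr0 (al q (E l q))) -[X in _ = _ * X]H; congr (_ * _);
  apply: eq_bigr => j _; rewrite !mxE.
Unshelve. all: by end_near. Qed.

(** Extending [xi] to a one-form and applying [sr_g_local] shows that the choice in [sr_g] is not
    the default value 0 by accident: a dual vector exists. *)
Lemma sr_gP p (xi : cotangent p) :
  Q (sr_g S xi) /\ forall w, Q w -> sr_h S (sr_g S xi) w = xi w.
Proof.
have [al alp] := cotangent_extend xi.
have [X /nbhs_singleton [QX hX]] := sr_g_local al p.
rewrite /sr_g; case: xgetP => [v _ //|/(_ (X p))[]]; split => // w Qw.
by rewrite hX// alp.
Qed.

Lemma sr_g_Q p (xi : cotangent p) : Q (sr_g S xi).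
Proof. by have [] := sr_gP xi. Qed.

Lemma sr_g_unique p (xi : cotangent p) v :
  Q v -> (forall w, Q w -> sr_h S v w = xi w) -> sr_g S xi = v.
Proof.
move=> Qv hv; have [Qg hg] := sr_gP xi.
by apply: sr_h_inj => // w Qw; rewrite hg// hv.
Qed.

Lemma sr_g_linear p a (xi eta : cotangent p) :
  sr_g S (a *: xi + eta) = a *: sr_g S xi + sr_g S eta.
Proof.
have [Qx hx] := sr_gP xi; have [Qe he] := sr_gP eta.
apply: sr_g_unique; first exact: sr_Q_linear.
by move=> w Qw; rewrite sr_h_linear// hx// he.
Qed.

Lemma sr_gD p (xi eta : cotangent p) : sr_g S (xi + eta) = sr_g S xi + sr_g S eta.
Proof. by rewrite -[xi]scale1r sr_g_linear !scale1r. Qed.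

Lemma sr_g0 p : sr_g S (0 : cotangent p) = 0.
Proof. by apply: (addrI (sr_g S (0 : cotangent p))); rewrite -sr_gD !addr0. Qed.

Lemma sr_gZ p a (xi : cotangent p) : sr_g S (a *: xi) = a *: sr_g S xi.
Proof. by rewrite -[LHS]/(sr_g S _) -[X in sr_g S X]addr0 sr_g_linear sr_g0 addr0. Qed.

Fact sr_g_smooth (al : oneform M) f : smooth_fun (fun p => sr_g S (al p) f).
Proof.
apply: vfield_local => p; have [X nX] := sr_g_local al p.
by exists X; apply: filterS nX => q [QX hX]; exact: sr_g_unique.
Qed.

Definition gfield (al : oneform M) : vfield M := VField (sr_g_smooth al).

(* A local frame near the points where qchi = 1, cut off so that the
   decomposition holds on all of M. *)
Record qframe := QFrame {
  qE : 'I_k -> vfield M; qth : 'I_k -> oneform M;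
  qF : 'I_n -> vfield M; qze : 'I_n -> oneform M;
  qchi : smoothFun M;
  qE_Q : forall j, section_Q S (qE j);
  qze_Q0 : forall i, section_Q0 S (qze i);
  qframeE : forall q (v : tangent q),
    \sum_j qth j q v *: qE j q + \sum_i qze i q v *: qF i q = qchi q *: v }.

(* The forms th are dual to the fields E on Q, and the forms ze are the
   components of the projection onto a complement of Q in the coordinate
   frame; no frame of that complement is needed. *)
Lemma qframe_exists p : exists F : qframe, \forall q \near p, qchi F q = 1.
Proof.
have [E [QE nE]] := section_Q_frame p.
have [phi [x [d [_ nd]]]] := coordinates_exist' p.
(* Components of the frame of Q in the coordinate frame; independence of the [E j] at [p] is
   freeness of the rows. *)
pose A : 'M[smoothFun M]_(k, n) := \matrix_(j, i) vapply (E j) (x i).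
have Afree : row_free (map_mx (ev p) A).
  rewrite -kermx_eq0; apply/rowV0P => v /sub_kermxP vA.
  have [_ inE'] := nbhs_singleton nE; have [_ _ dp] := nbhs_singleton nd.
  apply/rowP => i; rewrite mxE; apply: (inE' (v 0)).
  rewrite [LHS]dp big1// => l _; rewrite tangent_sumE.
  have /rowP/(_ l) := vA; rewrite !mxE => vAl.
  rewrite (_ : \sum_i0 _ = 0) ?scale0r// -[RHS]vAl.
  by apply: eq_bigr => j _; rewrite !mxE.
(* A constant right inverse of [A] at [p]: [A *m B] is the identity at [p], hence invertible nearby
   with inverse [D], and [B *m D] is a right inverse of [A] near [p]. This is what makes [th] dual
   to [E]. *)
pose B : 'M[smoothFun M]_(n, k) := map_mx (@cstF R n M) (pinvmx (map_mx (ev p) A)).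
have evB q : map_mx (ev q) B = pinvmx (map_mx (ev p) A).
  by apply/matrixP => i j; rewrite !mxE; exact: cstFE.
have [|D nD] := @smooth_matrix_inverse R n M k (A *m B) p.
  by rewrite map_mxM evB mulmxVp// det1 oner_neq0.
pose T := B *m D.
pose th l := \sum_i T i l *: differential (x i).
pose Qsp q := (forall v, Q v <-> exists a : 'I_k -> R, v = \sum_j a j *: E j q) /\
    (forall a : 'I_k -> R, \sum_j a j *: E j q = 0 -> forall j, a j = 0).
pose good q := [/\ Qsp q, forall v : tangent q, v = \sum_i v (x i) *: d i q &
  forall l j, th l q (E j q) = (l == j)%:R].
have ngood : \forall q \near p, good q.
  near=> q; split; first by near: q.
    suff [_ _ //] : [/\ chart_dom phi q, forall i, d i q = coord_vector phi i q &
      forall v : tangent q, v = \sum_i v (x i) *: d i q].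
    by near: q; exact: nd.
  move=> l j; have [CD _] : map_mx (ev q) (A *m B) *m map_mx (ev q) D = 1%:M /\
    map_mx (ev q) D *m map_mx (ev q) (A *m B) = 1%:M by near: q.
  rewrite -map_mxM -mulmxA -/T in CD; have /matrixP/(_ j l) := CD;
    rewrite !mxE eq_sym => <-.
  rewrite -[RHS]/((\sum_i A j i * T i l) q) smoothFun_sumE oneform_sumE
    cotangent_sumE; apply: eq_bigr => i _.
  by rewrite oneform_zE -[LHS]/(T i l q * E j q (x i)) mulrC [A j i]mxE.
have [chi [chi1 chi0]] := bump ngood.
(* The [i]-th coordinate component of [v] minus that of its Q-part, the sum of the [th l v *: E l];
   it vanishes for [v] in Q. *)
pose ze i := chi *: (differential (x i) - \sum_l vapply (E l) (x i) *: th l).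
have zeE i q v : ze i q v = chi q * (v (x i) - \sum_l E l q (x i) * th l q v).
  rewrite oneform_zE cotangentZE; congr (_ * _).
  rewrite oneform_dE -[LHS]/(v (x i) - (\sum_l vapply (E l) (x i) *: th l) q v).
  by rewrite oneform_sumE cotangent_sumE; congr (_ - _); apply: eq_bigr => l _;
    rewrite oneform_zE.
have zeQ0 i : section_Q0 S (ze i).
  move=> q v Qv; rewrite zeE.
  have [->|/chi0 [[Qs _] _ dual]] := eqVneq (chi q) 0; first by rewrite mul0r.
  have [a va] := (Qs v).1 Qv.
  suff -> : \sum_l E l q (x i) * th l q v = v (x i) by rewrite subrr mulr0.
  rewrite va tangent_sumE; apply: eq_bigr => l _.
  rewrite covector_sum (bigD1 l)//= covectorZ dual eqxx mulr1 big1 ?addr0.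
    by rewrite mulrC.
  by move=> j jl; rewrite covectorZ dual eq_sym (negbTE jl) mulr0.
have FE q (v : tangent q) : \sum_j (chi *: th j) q v *: E j q + \sum_i ze i q v *: d
  i q = chi q *: v.
  have [c0|/chi0 [_ dq _]] := eqVneq (chi q) 0.
    rewrite c0 scale0r !big1 ?addr0// => [j|i] _; last first.
      by rewrite oneform_zE c0 scale0r -[X in X *: _]/(0 : R) scale0r.
    by rewrite zeE c0 mul0r scale0r.
  have H : \sum_i (\sum_l E l q (x i) * th l q v) *: d i q = \sum_l th l q v *: E l q.
    under eq_bigr do rewrite scaler_suml.
    rewrite exchange_big; apply: eq_bigr => l _.
    rewrite [in RHS](dq (E l q)) scaler_sumr; apply: eq_bigr => i _.
    by rewrite scalerA mulrC.
  rewrite [in RHS](dq v).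
  transitivity (chi q *: (\sum_l th l q v *: E l q) +
      \sum_i (chi q * (v (x i) - \sum_l E l q (x i) * th l q v)) *: d i q).
    congr (_ + _); last by apply: eq_bigr => i _; rewrite zeE.
    by rewrite scaler_sumr; apply: eq_bigr => j _; rewrite scalerA oneform_zE.
  rewrite -H; under [X in _ + X]eq_bigr do rewrite -scalerA.
  rewrite -[X in _ + X]scaler_sumr -scalerDr; congr (_ *: _).
  by rewrite -big_split /=; apply: eq_bigr => i _; rewrite -scalerDl addrC subrK.
by exists (QFrame QE zeQ0 FE).
Unshelve. all: by end_near. Qed.

Fact zero_qframeE q (v : tangent q) :
  \sum_(j < k) (0 : oneform M) q v *: (vf_comb [::] xpredT (fun=> 0) (fun i : unit =>
    gfield 0) : vfield M) q +
  \sum_(i < n) (0 : oneform M) q v *: (vf_comb [::] xpredT (fun=> 0) (fun i : unit =>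
    gfield 0) : vfield M) q =
  (0 : smoothFun M) q *: v.
Proof. by rewrite !big1 ?addr0 ?scale0r// => i _; exact: scale0r. Qed.

(** Second countability turns frames indexed by points into a sequence: each set of a countable
    basis on which some cut-off is identically 1 selects one such frame. *)
Lemma qframe_sequence : exists F : nat -> qframe,
  forall p, exists i, \forall q \near p, qchi (F i) q = 1.
Proof.
have [Fp Fp1] := choice qframe_exists.
pose Z : vfield M := vf_comb [::] xpredT (fun=> 0) (fun i : unit => gfield 0).
have ZQ : section_Q S Z by move=> q; rewrite /= big_nil; exact: sr_Q_0.
have z0 : section_Q0 S (0 : oneform M) by [].
(* The zero frame, with cut-off 0, fills the indices that come from no suitable basis set. *)
pose F0 := QFrame (fun _ : 'I_k => ZQ) (fun _ : 'I_n => z0) zero_qframeE.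
have [B /countable_injP[c cinj] [Bo Bb]] := @carrier_second_countable _ _ M.
pose good (b : set M) p := forall q, b q -> qchi (Fp p) q = 1.
have ex (i : nat) : exists G : qframe, forall b p, B b -> c b = i -> good b p ->
    exists2 p', good b p' & G = Fp p'.
  have [[b [p [Bb' cb gp]]]|H] := pselect (exists b p, [/\ B b, c b = i & good b p]).
    exists (Fp p) => b' p' Bb1 cb' gp'; exists p => //.
    by suff -> : b' = b by []; apply: cinj; rewrite ?cb ?cb'//; exact: mem_set.
  by exists F0 => b p Bb' cb gp; exfalso; apply: H; exists b, p.
have [Fi FiP] := choice ex.
exists Fi => p.
have [b [Bb1 bp] bsub] := Bb p _ (Fp1 p).
exists (c b); have [p' gp' ->] := FiP _ b p Bb1 erefl bsub.
apply: (@filterS _ (nbhs p) _ b) => //.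
by apply: open_nbhs_nbhs; split => //; exact: Bo.
Qed.

(* A countable locally finite family of local frames adapted to Q; only the
   first gN q members contribute at q. *)
Record gframe := GFrame {
  gE : nat -> 'I_k -> vfield M; gth : nat -> 'I_k -> oneform M;
  gF : nat -> 'I_n -> vfield M; gze : nat -> 'I_n -> oneform M;
  gN : M -> nat;
  gE_Q : forall i j, section_Q S (gE i j);
  gze_Q0 : forall i l, section_Q0 S (gze i l);
  gth_loc : forall p, \forall q \near p,
    forall i j, (gN p <= i)%N -> gth i j q = 0;
  gze_loc : forall p, \forall q \near p,
    forall i l, (gN p <= i)%N -> gze i l q = 0;
  gframeE : forall m q (v : tangent q), (gN q <= m)%N ->
    \sum_(i < m) \sum_j gth i j q v *: gE i j q +
    \sum_(i < m) \sum_l gze i l q v *: gF i l q = v }.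

(* The weights prod_(l < i) (1 - chi_l) * chi_i telescope to
   1 - prod_(l < m) (1 - chi_l), and all but finitely many of them vanish near
   a point where some chi_l is identically 1. *)
Lemma gframe_exists : inhabited gframe.
Proof.
have [F F1] := qframe_sequence.
have [c c1] := choice F1.
pose w i : smoothFun M := \prod_(l < i) (1 - qchi (F l)).
pose N p := (c p).+1.
have w0 p : \forall q \near p, forall i, (N p <= i)%N -> w i q = 0.
  apply: filterS (c1 p) => q chiq i Ni.
  rewrite /w (bigD1 (Ordinal Ni))//= -[LHS]/((1 - qchi (F (c p)) q) * _) chiq.
  by rewrite subrr mul0r.
have tele m q : \sum_(i < m) w i q * qchi (F i) q = 1 - w m q.
  elim: m => [|m IH].
    by rewrite big_ord0 /w big_ord0 -[X in 1 - X]/(1 : R) subrr.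
  have -> : w m.+1 = w m * (1 - qchi (F m)) by rewrite /w big_ord_recr.
  rewrite big_ord_recr /= IH.
  rewrite -[X in _ = 1 - X]/(w m q * (1 - qchi (F m) q)); ring.
apply: inhabits.
refine (@GFrame (fun i => qE (F i)) (fun i j => w i *: qth (F i) j)
  (fun i => qF (F i)) (fun i l => w i *: qze (F i) l) N _ _ _ _ _).
- by move=> i; exact: qE_Q.
- move=> i l q v Qv; rewrite oneform_zE cotangentZE qze_Q0 ?mulr0//.
- by move=> p; apply: filterS (w0 p) => q wq i j Ni; rewrite oneform_zE wq// scale0r.
- by move=> p; apply: filterS (w0 p) => q wq i j Ni; rewrite oneform_zE wq// scale0r.
move=> m q v Nm; rewrite -big_split /=.
have wm : w m q = 0 by exact: (nbhs_singleton (w0 q)).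
transitivity (\sum_(i < m) (w i q * qchi (F i) q) *: v); last first.
  by rewrite -scaler_suml tele wm subr0 scale1r.
apply: eq_bigr => i _; rewrite -scalerA -qframeE scalerDr !scaler_sumr.
by congr (_ + _); apply: eq_bigr => j _; rewrite scalerA.
Qed.

End Frames.

(** * A Q-adapted connection *)

Section LieForm.
Variables (R : realType) (n : nat) (M : smoothManifold R n).
Implicit Types (p q : M) (X Y Z : vfield M) (eta be : oneform M) (f : smoothFun M).

(** Near [p] a field is a combination of coordinate fields, so an expression that is local and
    linear over functions depends on [Y p] alone. This produces covectors from formulas that
    differentiate [Y]. *)
Lemma tensorial_covector p (T : vfield M -> R) :
  (forall Y Y', (\forall q \near p, Y q = Y' q) -> T Y = T Y') ->
  (forall (a : 'I_n -> smoothFun M) (Y : 'I_n -> vfield M),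
    T (vf_comb (index_enum 'I_n) xpredT a Y) = \sum_i a i p * T (Y i)) ->
  exists xi : cotangent p, forall Y, T Y = xi (Y p).
Proof.
move=> Tloc Tlin; have [phi [x [d [_ nd]]]] := coordinates_exist' p.
exists (\sum_i T (d i) *: differential (x i) p) => Y.
rewrite (Tloc Y (vf_comb (index_enum 'I_n) xpredT (fun i => vapply Y (x i)) d)).
  by rewrite Tlin cotangent_sumE; apply: eq_bigr => i _; rewrite cotangentZE mulrC.
by apply: filterS nd => q [_ _ dq]; rewrite {1}[Y q]dq.
Qed.

Lemma lie_combr I (r : seq I) (P : pred I) (a : I -> smoothFun M) (Y : I -> vfield M) X p :
  lie X (vf_comb r P a Y) p =
  \sum_(i <- r | P i) (a i p *: lie X (Y i) p + X p (a i) *: Y i p).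
Proof.
rewrite lieC lie_comb -sumrN; apply: eq_bigr => i _.
by rewrite opprB (lieC _ X) scalerN opprK addrC.
Qed.

Lemma lie_localr X Y Y' p : (\forall q \near p, Y q = Y' q) -> lie X Y p = lie X Y' p.
Proof. by move=> YY'; rewrite lieC (lie_local X YY') -lieC. Qed.

Lemma contract_comb eta I (r : seq I) (P : pred I) (a : I -> smoothFun M) (Y : I ->
  vfield M) :
  contract eta (vf_comb r P a Y) = \sum_(i <- r | P i) a i * contract eta (Y i).
Proof.
apply: smoothFun_ext => q; rewrite smoothFun_sumE.
rewrite -[LHS]/(eta q (\sum_(i <- r | P i) a i q *: Y i q)) covector_sum.
by apply: eq_bigr => i _; rewrite covectorZ.
Qed.

(** The formula is the Lie derivative of [be] along [X]. For a combination of fields, the terms with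
    derivatives [X p (a i)] from the contraction and from the bracket cancel. *)
Fact lie_form_subproof X be p : exists xi : cotangent p, forall Y,
  X p (contract be Y) - be p (lie X Y p) = xi (Y p).
Proof.
apply: (tensorial_covector (T := fun Y => X p (contract be Y) - be p (lie X Y p))).
  move=> Y Y' YY'; rewrite (lie_localr X YY'); congr (_ - _).
  by apply: tangent_local; apply: filterS YY' => q /= ->.
move=> a Y; rewrite contract_comb tangent_sum lie_combr covector_sum -sumrB.
apply: eq_bigr => i _; rewrite tangent_leibniz covectorD !covectorZ.
rewrite -[contract be (Y i) p]/(be p (Y i p)); ring.
Qed.

Definition lie_form_val X be p : cotangent p := sval (cid (lie_form_subproof X be p)).

Lemma lie_form_valE X be p Y :
  lie_form_val X be p (Y p) = X p (contract be Y) - be p (lie X Y p).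
Proof. by rewrite /lie_form_val; case: cid. Qed.

Fact lie_form_smooth X be Y : smooth_fun (fun p => lie_form_val X be p (Y p)).
Proof.
have /smooth_funP := smoothFunP (vapply X (contract be Y) - contract be (lie X Y)).
by congr smooth_fun; apply/funext => p; rewrite lie_form_valE.
Qed.

Definition lie_form X be : oneform M := OneForm (lie_form_smooth X be).

Lemma lie_formE X be p Y :
  lie_form X be p (Y p) = X p (contract be Y) - be p (lie X Y p).
Proof. exact: lie_form_valE. Qed.

Lemma contractD be be' Y : contract (be + be') Y = contract be Y + contract be' Y.
Proof. by apply: smoothFun_ext => q. Qed.

Lemma contractZ f be Y : contract (f *: be) Y = f * contract be Y.
Proof. by apply: smoothFun_ext => q. Qed.

Lemma lie_form_valD X be be' p :
  lie_form_val X (be + be') p = lie_form_val X be p + lie_form_val X be' p.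
Proof.
apply: cotangent_ext => v; have [Y <-] := tangent_extend v.
rewrite cotangentDE !lie_form_valE contractD tangentD oneform_dE cotangentDE; ring.
Qed.

Lemma lie_form_valZ X f be p :
  lie_form_val X (f *: be) p = f p *: lie_form_val X be p + X p f *: be p.
Proof.
apply: cotangent_ext => v; have [Y <-] := tangent_extend v.
rewrite cotangentDE !cotangentZE !lie_form_valE contractZ tangent_leibniz oneform_zE
  cotangentZE.
rewrite -[contract be Y p]/(be p (Y p)); ring.
Qed.

(** The right-hand side is the Lie derivative of [eta] minus [Y] applied to a function, hence
    depends on [Y] only through [Y p]; antisymmetry gives the same for [X], so the extensions chosen
    in [ext_d] do not matter. *)
Lemma ext_dE eta p X Y : ext_d eta (X p) (Y p) =
  X p (contract eta Y) - Y p (contract eta X) - eta p (lie X Y p).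
Proof.
pose V X Y := X p (contract eta Y) - Y p (contract eta X) - eta p (lie X Y p).
have VE X1 Y1 : V X1 Y1 = lie_form X1 eta p (Y1 p) - Y1 p (contract eta X1).
  by rewrite lie_formE /V; ring.
have Vr X1 Y1 Y2 : Y1 p = Y2 p -> V X1 Y1 = V X1 Y2 by move=> Y12; rewrite !VE Y12.
have VC X1 Y1 : V X1 Y1 = - V Y1 X1.
  rewrite /V lieC -[X in eta p X]scaleN1r covectorZ; ring.
rewrite /ext_d; case: xgetP => [_ _ [X' [Y' [XX' YY' ->]]]|].
  rewrite -/(V X' Y') -/(V X Y) (Vr _ _ Y)// VC (Vr _ _ X)//.
by move=> /(_ (V X Y))[]; exists X, Y.
Qed.

End LieForm.

(** The number of active frames [gN] varies from point to point. Sums up to [gN q] and [gN p] are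
    compared through their maximum, both tails being zero at [q] near [p]. *)
Lemma sum_stable (V : zmodType) (F : nat -> V) a m :
  (forall i, (a <= i)%N -> F i = 0) -> (a <= m)%N ->
  \sum_(i < m) F i = \sum_(i < a) F i.
Proof.
move=> F0 /subnKC <-; elim: (m - a)%N => [|d IH]; first by rewrite addn0.
by rewrite addnS big_ord_recr /= IH F0 ?addr0// leq_addr.
Qed.

Section Connection.
Variables (R : realType) (n : nat) (M : smoothManifold R n) (S : subRiemannian M).
Variable G : gframe S.
Local Notation Q := (sr_Q S).
Local Notation k := (sr_rank S).
Local Notation N := (gN G).
Local Notation E := (gE G).
Local Notation th := (gth G).
Implicit Types (p q : M) (X Y Z : vfield M) (eta al be : oneform M) (f : smoothFun M).

Lemma Q_frame p m (v : tangent p) : Q v -> (N p <= m)%N ->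
  \sum_(i < m) \sum_j th i j p v *: E i j p = v.
Proof.
move=> Qv Nm; rewrite -[RHS](gframeE v Nm) [X in _ + X]big1 ?addr0// => i _.
by rewrite big1// => l _; rewrite (gze_Q0 G) ?scale0r.
Qed.

(** The Lie derivative of a general form is not linear over functions in the field. Differentiating
    along fixed frame fields, with the components of [v] as coefficients, is. *)
Definition nabla_at p (v : tangent p) be : cotangent p :=
  \sum_(i < N p) \sum_j th i j p v *: lie_form (E i j) be p.

Lemma nabla_at_stable m p (v : tangent p) be : (N p <= m)%N ->
  nabla_at v be = \sum_(i < m) \sum_j th i j p v *: lie_form (E i j) be p.
Proof.
move=> Nm; rewrite (@sum_stable _ (fun i => \sum_j th i j p v *: lie_form (E i j) be
  p) (N p))//.
move=> i Ni; rewrite big1// => j _.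
by rewrite (nbhs_singleton (gth_loc G p)) ?cotangent0E ?scale0r.
Qed.

Fact nabla_smooth al be X : smooth_fun (fun p => nabla_at (sr_g S (al p)) be (X p)).
Proof.
apply: (oneform_local (w := fun p => nabla_at (sr_g S (al p)) be)) => p.
exists (\sum_(i < N p) \sum_j contract (th i j) (gfield S al) *: lie_form (E i j) be).
near=> q.
have thq : forall i j, (N p <= i)%N -> th i j q = 0.
  by near: q; exact: (gth_loc G p).
rewrite oneform_sumE (nabla_at_stable _ _ (leq_maxl (N q) (N p))).
rewrite (@sum_stable _ (fun i => \sum_j th i j q (sr_g S (al q)) *: lie_form (E i j)
  be q) (N p)) ?leq_maxr//.
  by apply: eq_bigr => i _; rewrite oneform_sumE; apply: eq_bigr => j _; rewrite oneform_zE.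
by move=> i Ni; rewrite big1// => j _; rewrite thq ?cotangent0E ?scale0r.
Unshelve. all: by end_near. Qed.

Definition nabla al be : oneform M := OneForm (nabla_smooth al be).

Lemma nabla_atD p (v : tangent p) be be' :
  nabla_at v (be + be') = nabla_at v be + nabla_at v be'.
Proof.
rewrite -big_split; apply: eq_bigr => i _; rewrite -big_split; apply: eq_bigr => j _ /=.
by rewrite lie_form_valD scalerDr.
Qed.

Lemma nabla_at_leibniz p (v : tangent p) f be : Q v ->
  nabla_at v (f *: be) = f p *: nabla_at v be + v f *: be p.
Proof.
move=> Qv; have vf : v f = \sum_(i < N p) \sum_j th i j p v * E i j p f.
  rewrite -{1}(Q_frame Qv (leqnn _)) tangent_sumE; apply: eq_bigr => i _.
  by rewrite tangent_sumE.
rewrite vf scaler_suml scaler_sumr -big_split; apply: eq_bigr => i _ /=.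
rewrite scaler_suml scaler_sumr -big_split; apply: eq_bigr => j _ /=.
by rewrite lie_form_valZ scalerDr !scalerA mulrC.
Qed.

Lemma nabla_atDl p (v w : tangent p) be :
  nabla_at (v + w) be = nabla_at v be + nabla_at w be.
Proof.
rewrite -big_split; apply: eq_bigr => i _; rewrite -big_split; apply: eq_bigr => j _ /=.
by rewrite covectorD scalerDl.
Qed.

Lemma nabla_atZl p a (v : tangent p) be : nabla_at (a *: v) be = a *: nabla_at v be.
Proof.
rewrite scaler_sumr; apply: eq_bigr => i _; rewrite scaler_sumr; apply: eq_bigr => j _ /=.
by rewrite covectorZ scalerA.
Qed.

Lemma nabla_connection : g_connection S nabla.
Proof.
split.
- move=> al al' be; apply: oneform_ext => p v.
  rewrite (oneform_dE (nabla al be)) cotangentDE -[LHS]/(nabla_at (sr_g S ((al + al')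
    p)) be v).
  by rewrite oneform_dE sr_gD nabla_atDl.
- move=> f al be; apply: oneform_ext => p v.
  rewrite (oneform_zE f (nabla al be)) cotangentZE -[LHS]/(nabla_at (sr_g S ((f *:
    al) p)) be v).
  by rewrite oneform_zE sr_gZ nabla_atZl.
- move=> al be be'; apply: oneform_ext => p v.
  by rewrite (oneform_dE (nabla al be)) cotangentDE /= nabla_atD.
- move=> a al be; apply: oneform_ext => p v.
  rewrite (oneform_zE _ (nabla al be)) /= nabla_at_leibniz; last exact: sr_g_Q.
  by rewrite (tangent_cst (sr_g S (al p))) scale0r addr0.
- by move=> f al be p /=; rewrite nabla_at_leibniz//; exact: sr_g_Q.
Qed.

(** Expanding [X] in the frame creates terms [Y (a) E] with derivatives of the components; they lie
    in Q and [eta] kills them. Only the value of [X] at [p] survives. *)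
Lemma bracket_Q eta X Y p : section_Q0 S eta -> section_Q S X ->
  eta p (lie X Y p) = \sum_(i < N p) \sum_j th i j p (X p) * eta p (lie (E i j) Y p).
Proof.
move=> Qeta QX.
(* A double sum of fields is a [vf_comb] of [vf_comb]s, with outer coefficients 1. *)
pose XE := vf_comb (index_enum 'I_(N p)) xpredT (fun=> 1)
  (fun i => vf_comb (index_enum 'I_k) xpredT (fun j => contract (th i j) X) (fun j =>
    E i j)).
have XXE : \forall q \near p, X q = XE q.
  have := gth_loc G p; apply: filterS => q thq.
  rewrite -[LHS](Q_frame (QX q) (leq_maxl (N q) (N p))).
  rewrite (@sum_stable _ (fun i => \sum_j th i j q (X q) *: E i j q) (N p)) ?leq_maxr//.
    by apply: eq_bigr => i _; rewrite [RHS]scale1r.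
  by move=> i Ni; rewrite big1// => j _; rewrite thq ?cotangent0E ?scale0r.
rewrite (lie_local Y XXE) lie_comb covector_sum; apply: eq_bigr => i _.
rewrite tangent1 scale0r subr0 scale1r lie_comb covector_sum; apply: eq_bigr => j _.
by rewrite covectorB !covectorZ (Qeta p (E i j p)) ?mulr0 ?subr0//; exact: gE_Q.
Qed.

(** Since [eta] vanishes on the field [X = g al], contracting its differential with [X] leaves [X
    (eta Y) - eta [X, Y]]. Both terms split along the frame, the second by [bracket_Q], into the Lie
    derivatives that define [nabla]. *)
Lemma nabla_Q_adapted : Q_adapted S nabla.
Proof.
move=> al eta Qeta p v; have [Y <-] := tangent_extend v.
rewrite -[sr_g S (al p)]/(gfield S al p) ext_dE.
have -> : contract eta (gfield S al) = 0.
  by apply: smoothFun_ext => q; exact/Qeta/sr_g_Q.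
have Qg : section_Q S (gfield S al) by move=> q; exact: sr_g_Q.
rewrite tangent0 subr0 (bracket_Q Y p Qeta Qg).
rewrite -[gfield S al p in X in _ = X - _](Q_frame (Qg p) (leqnn _)).
rewrite /= /nabla_at cotangent_sumE tangent_sumE -sumrB; apply: eq_bigr => i _.
rewrite cotangent_sumE tangent_sumE -sumrB; apply: eq_bigr => j _.
by rewrite cotangentZE lie_formE tangentZE mulrBr.
Qed.

(** A covector in Q^0 ignores the Q-part of the frame, so it is a combination of the [gze i l] with
    its values on the [gF i l] as constant coefficients. *)
Lemma Q0_extend p (xi : cotangent p) : sr_Q0 S xi ->
  exists2 eta : oneform M, section_Q0 S eta & eta p = xi.
Proof.
move=> Qxi; exists (\sum_(i < N p) \sum_l cstF M (xi (gF G i l p)) *: gze G i l).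
  move=> q v Qv; rewrite oneform_sumE cotangent_sumE big1// => i _.
  rewrite oneform_sumE cotangent_sumE big1// => l _.
  by rewrite oneform_zE cotangentZE (gze_Q0 G) ?mulr0.
apply: cotangent_ext => v; rewrite -[in RHS](gframeE v (leqnn (N p))) covectorD.
rewrite [X in _ = X + _](Qxi); last first.
  by apply: sr_Q_sum => i _; apply: sr_Q_sum => j _; apply: sr_QZ; exact: gE_Q.
rewrite add0r oneform_sumE cotangent_sumE covector_sum; apply: eq_bigr => i _.
rewrite oneform_sumE cotangent_sumE covector_sum; apply: eq_bigr => l _.
by rewrite oneform_zE cotangentZE covectorZ cstFE mulrC.
Qed.

Lemma Q_extend p (v : tangent p) : Q v -> exists2 X, section_Q S X & X p = v.
Proof.
move=> Qv; exists (vf_comb (index_enum 'I_(N p)) xpredT (fun=> 1)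
  (fun i => vf_comb (index_enum 'I_k) xpredT (fun j => cstF M (th i j p v)) (fun j =>
    E i j))).
  move=> q; apply: sr_Q_sum => i _; apply: sr_QZ; apply: sr_Q_sum => j _; apply: sr_QZ.
  exact: gE_Q.
rewrite -[RHS](Q_frame Qv (leqnn _)); apply: eq_bigr => i _; rewrite [LHS]scale1r.
by apply: eq_bigr => j _; congr (_ *: _); exact: cstFE.
Qed.

Lemma pair_bracketE (xi : cotBundle M) (w : tanBundle M) Y :
  tag w = tag xi -> sr_Q0 S (tagged xi) -> Q (tagged w) ->
  pair_bracket S xi w Y =
  \sum_(i < N (tag xi)) \sum_j th i j (tag w) (tagged w) * tagged xi (lie (E i j) Y
    (tag xi)).
Proof.
case: xi w => p xi [q w] /= qp; subst q => Qxi Qw.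
rewrite /pair_bracket; case: xgetP => [_ _ [eta [X [Qeta QX /= etap Xp ->]]]|].
  by rewrite bracket_Q// Xp etap.
have [eta Qeta etap] := Q0_extend Qxi; have [X QX Xp] := Q_extend Qw.
by move=> /(_ (eta p (lie X Y p)))[]; exists eta, X.
Qed.

End Connection.

(** * Curves *)

Section DerivIn.
Variable R : realType.
Implicit Types (a b t l e : R) (f g : R -> R).

Lemma deriv_inP a b f t l : deriv_in a b f t l <->
  forall e, 0 < e -> \forall u \near t, a <= u <= b -> u != t ->
    `|l - (u - t)^-1 * (f u - f t)| <= e.
Proof.
have PF : Filter (within `[a, b]%classic t^') by exact: within_filter.
split=> [H e e0|H].
  move/cvgrPdist_le : H => /(_ e e0) H1.
  have H2 : \forall u \near t, u != t -> `[a, b]%classic u ->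
    `|l - (u - t)^-1 * (f u - f t)| <= e by exact: H1.
  near=> u => uab ut.
  have uab' : `[a, b]%classic u by rewrite /= in_itv.
  by move: ut uab'; near: u.
apply/cvgrPdist_le => e e0; have H1 := H e e0.
have H2 : \forall u \near t, u != t -> `[a, b]%classic u ->
    `|l - (u - t)^-1 * (f u - f t)| <= e.
  near=> u => ut; rewrite /= in_itv => uab.
  by move: uab ut; near: u.
exact: H2.
Unshelve. all: by end_near. Qed.

Lemma deriv_in_is_derive a b f t l : is_derive t 1 f l -> deriv_in a b f t l.
Proof.
move=> [df Df]; apply/deriv_inP => e e0.
have cv : h^-1 *: ((f \o shift t) (h *: (1 : R)) - f t) @[h --> 0^'] --> l.
  by rewrite -Df; exact: df.
move/cvgrPdist_le : cv => /(_ e e0) /nbhs_ballP[d /= d0 dH].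
apply/nbhs_ballP; exists d => // u ud uab ut.
have := dH (u - t); rewrite -ball_normE /ball_ /= sub0r normrN.
move: ud; rewrite -ball_normE /ball_ /= distrC => ud /(_ ud).
rewrite subr_eq0 => /(_ ut).
by rewrite [(u - t) *: 1]mulr1 subrK.
Qed.

Lemma deriv_in_sub a b a' b' f t l : a <= a' -> b' <= b ->
  deriv_in a b f t l -> deriv_in a' b' f t l.
Proof.
move=> aa bb /deriv_inP H; apply/deriv_inP => e /H; apply: filterS => u Hu /andP[au ub].
by apply: Hu; rewrite (le_trans aa)// (le_trans ub).
Qed.

Lemma deriv_in_unique a b f t l l' : a < b -> a <= t <= b ->
  deriv_in a b f t l -> deriv_in a b f t l' -> l = l'.
Proof.
move=> ab /andP[at' tb] /deriv_inP H /deriv_inP H'; apply/eqP; rewrite -subr_eq0 -normr_eq0.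
apply/negP => /negP n0.
have e0 : 0 < `|l - l'| / 3 by rewrite divr_gt0// lt_def n0 normr_ge0.
have nH : \forall u \near t, (a <= u <= b -> u != t ->
      `|l - (u - t)^-1 * (f u - f t)| <= `|l - l'| / 3) /\
    (a <= u <= b -> u != t -> `|l' - (u - t)^-1 * (f u - f t)| <= `|l - l'| / 3).
  by near=> u; split; near: u; [exact: H|exact: H'].
have /nbhs_ballP[d /= d0 dH] := nH.
(* A point of the interval close to [t] and distinct from it: to the right of [t] unless [t] is the
   right end. Here [a < b] is essential. *)
have [u [ud uab ut]] : exists u, [/\ ball t d u, a <= u <= b & u != t].
  have d20 : 0 < d / 2 by rewrite divr_gt0.
  have dd : d / 2 < d by rewrite ltr_pdivrMr// ltr_pMr// ltr1n.
  have [tb'|tb'] := ltP t b.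
    exists (t + Num.min (d / 2) (b - t)).
    have m0 : 0 < Num.min (d / 2) (b - t) by rewrite lt_min d20 subr_gt0.
    have md : Num.min (d / 2) (b - t) <= d / 2 by rewrite ge_min lexx.
    have mb : Num.min (d / 2) (b - t) <= b - t by rewrite ge_min lexx orbT.
    split; last by rewrite gt_eqF// ltrDl.
      by rewrite -ball_normE /ball_ /= opprD addrA subrr sub0r normrN gtr0_norm//; lra.
    by apply/andP; split; lra.
  exists (t - Num.min (d / 2) (t - a)).
  have m0 : 0 < Num.min (d / 2) (t - a) by rewrite lt_min d20 subr_gt0; lra.
  have md : Num.min (d / 2) (t - a) <= d / 2 by rewrite ge_min lexx.
  have mb : Num.min (d / 2) (t - a) <= t - a by rewrite ge_min lexx orbT.
  split; last by rewrite lt_eqF// ltrBlDr ltrDl.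
    by rewrite -ball_normE /ball_ /= opprB addrC subrK gtr0_norm//; lra.
  by apply/andP; split; lra.
have [h1 h2] := dH u ud; have {}h1 := h1 uab ut; have {}h2 := h2 uab ut.
have : `|l - l'| <= `|l - l'| / 3 + `|l - l'| / 3.
  set q := _ * (f u - f t) in h1 h2.
  have -> : l - l' = (l - q) - (l' - q) by ring.
  rewrite (le_trans (ler_normB _ _))//.
  have -> : l - q - (l' - q) = l - l' by ring.
  exact: lerD.
have : 0 < `|l - l'| by rewrite lt_def n0 normr_ge0.
by move=> h3 h4; lra.
Unshelve. all: by end_near. Qed.

Lemma deriv_in_eq a b f g t l :
  (\forall u \near t, a <= u <= b -> f u = g u) -> f t = g t ->
  deriv_in a b f t l -> deriv_in a b g t l.
Proof.
move=> fg fgt /deriv_inP H; apply/deriv_inP => e /H He; near=> u => uab ut.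
rewrite -fgt; have <- : f u = g u by move: uab; near: u.
by move: uab ut; near: u.
Unshelve. all: by end_near. Qed.

Lemma deriv_in_ext a b f g t l : (forall u, a <= u <= b -> f u = g u) ->
  a <= t <= b -> deriv_in a b f t l -> deriv_in a b g t l.
Proof.
by move=> fg tab; apply: deriv_in_eq; [near=> u; exact: fg|exact: fg].
Unshelve. all: by end_near. Qed.

Lemma open_oo a b : open `]a, b[%classic.
Proof. exact: interval_open. Qed.

Lemma in_oo a b a' b' t : a' < a -> b < b' -> a <= t <= b -> `]a', b'[%classic t.
Proof.
move=> aa bb /andP[at' tb]; rewrite /= in_itv /=; apply/andP; split.
  exact: lt_le_trans at'.
exact: le_lt_trans bb.
Qed.

Lemma deriv_inD a b f g t l l' :
  deriv_in a b f t l -> deriv_in a b g t l' -> deriv_in a b (f + g) t (l + l').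
Proof.
move=> H H'; have PF : Filter (within `[a, b]%classic t^') by exact: within_filter.
have := @cvgD _ _ _ _ PF _ _ _ _ H H'.
rewrite /deriv_in; set F := (X in X @ _ --> _ -> _); set F' := (X in _ -> X @ _ --> _).
suff -> : F = F' by [].
by apply/funext => u; rewrite /F /F' !fctE; ring.
Qed.

Lemma deriv_in_cst a b (x : R) t : deriv_in a b (cst x) t 0.
Proof. by apply: deriv_in_is_derive; exact: is_derive_cst. Qed.

Lemma deriv_in_continuous a b f t l : deriv_in a b f t l ->
  f @ within `[a, b]%classic t^' --> f t.
Proof.
move=> H; have PF : Filter (within `[a, b]%classic t^') by exact: within_filter.
have cu : (fun u => u - t) @ within `[a, b]%classic t^' --> (0 : R).
  have ct : (fun u : R => u - t) @ nbhs t --> (0 : R).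
    rewrite -(subrr t).
    exact: (@cvgB R R R (nbhs t) _ id (cst t) t t cvg_id (cvg_cst _)).
  move=> A /ct nA; have nA' : \forall u \near t, A (u - t) by [].
  have : \forall u \near t, u != t -> `[a, b]%classic u -> A (u - t).
    by near=> u => _ _; near: u.
  by [].
have cft : (fun=> f t) @ within `[a, b]%classic t^' --> f t by exact: cvg_cst.
have := @cvgD _ _ _ _ PF _ _ _ _ (@cvgM _ _ _ PF _ _ _ _ cu H) cft.
rewrite mul0r add0r.
set F := (X in X @ _ --> _ -> _); suff -> : F = f by [].
apply/funext => u; rewrite -[LHS]/((u - t) * ((u - t)^-1 * (f u - f t)) + f t).
have [->|ut] := eqVneq u t; first by rewrite subrr mul0r add0r.
by rewrite mulrA divff ?subr_eq0// mul1r subrK.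
Unshelve. all: by end_near. Qed.

Lemma deriv_inM a b f g t l l' :
  deriv_in a b f t l -> deriv_in a b g t l' ->
  deriv_in a b (f * g) t (l * g t + f t * l').
Proof.
move=> H H'; have PF : Filter (within `[a, b]%classic t^') by exact: within_filter.
have cft : (fun=> f t) @ within `[a, b]%classic t^' --> f t by exact: cvg_cst.
have := @cvgD _ _ _ _ PF _ _ _ _
  (@cvgM _ _ _ PF _ _ _ _ H (deriv_in_continuous H')) (@cvgM _ _ _ PF _ _ _ _ cft H').
rewrite /deriv_in; set F := (X in X @ _ --> _ -> _); set F' := (X in _ -> X @ _ --> _).
suff -> : F = F' by [].
apply/funext => u.
rewrite -[LHS]/((u - t)^-1 * (f u - f t) * g u + f t * ((u - t)^-1 * (g u - g t))).
by rewrite -[RHS]/((u - t)^-1 * (f u * g u - f t * g t)); ring.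
Qed.

Lemma deriv_in_sum I (r : seq I) (P : pred I) a b (f : I -> R -> R) t (l : I -> R) :
  (forall i, P i -> deriv_in a b (f i) t (l i)) ->
  deriv_in a b (fun u => \sum_(i <- r | P i) f i u) t (\sum_(i <- r | P i) l i).
Proof.
move=> H; have -> : (fun u => \sum_(i <- r | P i) f i u) = \sum_(i <- r | P i) f i.
  by apply/funext => u; rewrite fct_sumE.
elim/big_rec2 : _ => [|i y z Pi IH]; first exact: deriv_in_cst.
by apply: deriv_inD => //; exact: H.
Qed.

Lemma subdivision_mono a b m (s : nat -> R) : subdivision a b m s ->
  forall i j, (i <= j)%N -> (j <= m)%N -> s i <= s j.
Proof.
move=> [_ _ _ ss] i j ij; elim: j ij => [|j IH]; first by rewrite leqn0 => /eqP ->.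
rewrite leq_eqVlt => /orP[/eqP ->//|]; rewrite ltnS => ij jm.
by rewrite (le_trans (IH ij (ltnW jm)))// ltW// ss.
Qed.

Lemma subdivision_in a b m (s : nat -> R) i t : subdivision a b m s -> (i < m)%N ->
  s i <= t <= s i.+1 -> a <= t <= b.
Proof.
move=> sub im /andP[h1 h2]; have mono := subdivision_mono sub.
have [_ s0 sm _] := sub; apply/andP; split.
  by rewrite -s0 (le_trans _ h1)// mono// ltnW.
by rewrite -sm (le_trans h2)// mono.
Qed.

(** The least [i] with [t <= s i.+1]. The piece is open on the left except at [t = a], in accordance
    with the left continuity of piecewise curves. *)
Lemma subdivision_cover a b m (s : nat -> R) t : subdivision a b m s ->
  a <= t <= b -> exists2 i, (i < m)%N & s i <= t <= s i.+1 /\ (s i < t \/ (i = 0%N /\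
    t = a)).
Proof.
move=> [m0 s0 sm ss] /andP[at' tb].
have [->|ta] := eqVneq t a.
  exists 0%N => //; split; last by right.
  by rewrite s0 lexx -s0 ltW// ss.
have {}at' : a < t by rewrite lt_def ta at'.
have ex : exists i, t <= s i.+1 by exists m.-1; rewrite prednK// sm.
have [i ti imin] := ex_minnP ex.
have im : (i < m)%N.
  by rewrite -(prednK m0) ltnS; apply: imin; rewrite prednK// sm.
exists i => //.
have si : s i < t.
  case: i imin im {ti} => [|i] imin im; first by rewrite s0.
  by rewrite ltNge; apply/negP => ti; have := imin _ ti; rewrite ltnn.
by split; [rewrite ltW|left].
Qed.

(** At a subdivision point the derivatives of both adjacent pieces are asked to be [l]; pieces whose
    closed interval misses [t] contain no point near [t]. *)
Lemma deriv_in_glue a b m (s : nat -> R) f t l :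
  subdivision a b m s ->
  (forall i, (i < m)%N -> s i <= t <= s i.+1 -> deriv_in (s i) (s i.+1) f t l) ->
  deriv_in a b f t l.
Proof.
move=> sub H; apply/deriv_inP => e e0.
have nH (i : 'I_m) : \forall u \near t, s i <= u <= s i.+1 -> u != t ->
    `|l - (u - t)^-1 * (f u - f t)| <= e.
  have [sti|] := boolP (s i <= t <= s i.+1).
    by have /deriv_inP := H i (ltn_ord i) sti; apply.
  rewrite negb_and -!ltNge => /orP[ts|ts].
    near=> u => /andP[su _]; exfalso.
    have : u < s i by near: u; exact: lt_nbhsl.
    by rewrite ltNge su.
  near=> u => /andP[_ su]; exfalso.
  have : s i.+1 < u by near: u; exact: lt_nbhsr.
  by rewrite ltNge su.
near=> u => uab ut.
have Hu : forall i : 'I_m, s i <= u <= s i.+1 -> u != t ->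
    `|l - (u - t)^-1 * (f u - f t)| <= e by near: u; exact: filter_forall nH.
by have [i im [ui _]] := subdivision_cover sub uab; exact: (Hu (Ordinal im)).
Unshelve. all: by end_near. Qed.

End DerivIn.

(** * Smooth paths in the manifold and in its cotangent bundle *)

Section Paths.
Variables (R : realType) (n : nat) (M : smoothManifold R n).
Implicit Types (c : R -> M) (J : set R) (Y : vfield M) (eta : oneform M) (f : smoothFun M).

Lemma path_preimage_open J c (U : set M) : open J -> {in J, continuous c} ->
  open U -> open (J `&` c @^-1` U).
Proof.
move=> oJ cc oU; rewrite openE => t [Jt Ut]; apply: filterI.
  exact: open_nbhs_nbhs.
have /= := cc _ (mem_set Jt); apply; exact: open_nbhs_nbhs.
Qed.

Lemma smooth_path_near J c t (P : M -> Prop) : open J -> smooth_path J c -> J t ->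
  (\forall q \near c t, P q) ->
  exists W, [/\ open W, W t & forall u, W u -> J u /\ P (c u)].
Proof.
move=> oJ [cc _] Jt /near_open[U [oU Ut UP]].
exists (J `&` c @^-1` U); split; [exact: path_preimage_open|by []|].
by move=> u [Ju Uu]; split => //; exact: UP.
Qed.

Lemma smooth_path_subset J J' c : open J' -> J' `<=` J -> smooth_path J c ->
  smooth_path J' c.
Proof.
move=> oJ JJ [cc sc]; split; first by move=> t /set_mem /JJ /mem_set; exact: cc.
by move=> phi /sc; apply: smooth_on_subset => t [/JJ].
Qed.

Lemma smooth_path_fun J c f : open J -> smooth_path J c -> smooth_on J (f \o c).
Proof.
move=> oJ sc; apply: smooth_on_near => t Jt.
have [phi aphi dp] := atlas_cover (c t).
have oW : open (J `&` c @^-1` chart_dom phi).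
  by case: sc => cc _; apply: path_preimage_open => //; exact: chart_dom_open.
exists ((f \o chart_inv phi) \o (phi \o c)), (J `&` c @^-1` chart_dom phi); split => //.
- apply: smooth_on_comp (smoothFun_chart f aphi) => //; first exact: chart_cod_open.
    by move=> u [_ du]; exists (c u).
  by case: sc => _; exact.
- by move=> u /set_mem [_ du] /=; rewrite chart_mapK//; exact: mem_set.
Qed.

(** The two-sided velocity, for paths smooth on an open set around [t]; [velocity] is relative to a
    closed interval and one-sided at its ends. *)
Definition vel c t : tangent (c t) :=
  xget 0 [set v : tangent (c t) | forall f, is_derive t 1 (f \o c) (v f)].

Lemma velP J c t f : open J -> smooth_path J c -> J t ->
  is_derive t 1 (f \o c) (vel c t f).
Proof.
move=> oJ sc Jt.
have dc (g : smoothFun M) : derivable (g \o c) t 1.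
  by apply: (@smooth_on_derivable _ _ _ J) => //; exact: smooth_path_fun.
have dv : derivation_at (c t) (fun g => 'D_1 (g \o c) t).
  split=> [x g h|g h].
    have -> : (x *: g + h) \o c = x *: (g \o c : _ -> R) + (h \o c : _ -> R) by [].
    rewrite deriveD; [|apply: derivableZ; exact: dc|exact: dc].
    by rewrite deriveZ; [|exact: dc].
  have -> : (g * h) \o c = (g \o c : _ -> R) * (h \o c : _ -> R) by [].
  rewrite deriveM; [|exact: dc|exact: dc].
  by rewrite -![_ *: _]/(_ * _) /=; ring.
rewrite /vel; case: xgetP => [v _ //|/(_ (mkTangent dv))[] g].
by split; [exact: dc|].
Qed.

(** In coordinates the components of the velocity are the derivatives of the [x i \o c], which are
    smooth. *)
Lemma smooth_form_vel J c eta : open J -> smooth_path J c ->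
  smooth_on J (fun t => eta (c t) (vel c t)).
Proof.
move=> oJ sc; apply: smooth_on_near => t Jt.
have [phi [x [d [_ nd]]]] := coordinates_exist' (c t).
have [W [oW Wt WP]] := smooth_path_near oJ sc Jt nd.
exists (fun u => \sum_i 'D_1 (x i \o c) u * contract eta (d i) (c u)), W; split => //.
  have WJ : W `<=` J by move=> u /WP[].
  apply: smooth_on_sum => // i _.
  apply: (@smooth_onM _ _ W ('D_1 (x i \o c)) (contract eta (d i) \o c)) => //.
    by apply: smooth_on_subset WJ _; apply: smooth_on_derive; exact: smooth_path_fun.
  by apply: smooth_on_subset WJ _; exact: smooth_path_fun.
move=> u /set_mem /WP[Ju [_ _ du]]; rewrite [in RHS](du (vel c u)) covector_sum.
apply: eq_bigr => i _; rewrite covectorZ; congr (_ * _).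
by have [_ ->] := velP (x i) oJ sc Ju.
Qed.

(** Together with [smooth_cot_path_intro] this replaces the fibre coordinates of a chart by the
    pairings with all vector fields, the form in which smoothness in the cotangent bundle is handled
    afterwards. *)
Lemma smooth_cot_pair J (xi : R -> cotBundle M) Y : open J -> smooth_cot_path J xi ->
  smooth_on J (fun t => tagged (xi t) (Y (tag (xi t)))).
Proof.
move=> oJ [sc sxi]; apply: smooth_on_near => t Jt.
have [phi [x [d [aphi nd]]]] := coordinates_exist' (tag (xi t)).
have [W [oW Wt WP]] := smooth_path_near oJ sc Jt nd.
exists (fun u => \sum_i vapply Y (x i) (tag (xi u)) * tagged (xi u) (coord_vector phi
  i (tag (xi u)))), W.
have WJ : W `<=` J by move=> u /WP[].
split => //.
  apply: smooth_on_sum => // i _.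
  apply: (@smooth_onM _ _ W (vapply Y (x i) \o (tag \o xi))
    (fun u => tagged (xi u) (coord_vector phi i (tag (xi u))))) => //.
    by apply: smooth_on_subset WJ _; exact: smooth_path_fun.
  by apply: smooth_on_subset (sxi phi aphi i) => u /WP[Ju []].
move=> u /set_mem /WP[Ju [_ dE du]]; rewrite [in RHS](du (Y _)) covector_sum.
by apply: eq_bigr => i _; rewrite covectorZ dE.
Qed.

Lemma smooth_cot_path_intro J (xi : R -> cotBundle M) : open J ->
  smooth_path J (tag \o xi) ->
  (forall Y, smooth_on J (fun t => tagged (xi t) (Y (tag (xi t))))) ->
  smooth_cot_path J xi.
Proof.
move=> oJ sc sY; split => // phi aphi i; apply: smooth_on_near => t [Jt dt].
have [x [d nd]] := coordinates_exist aphi dt.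
have [W [oW Wt WP]] := smooth_path_near oJ sc Jt nd.
exists (fun u => tagged (xi u) (d i (tag (xi u)))), W; split => //.
  by apply: smooth_on_subset (sY (d i)) => u /WP[].
by move=> u /set_mem /WP[Ju [_ -> _]].
Qed.

End Paths.

Section BundlePoints.
Variables (R : realType) (n : nat) (M : smoothManifold R n).

(** Covectors whose base points are only provably equal have different types; they are compared as
    points of the bundle. *)
Lemma cotBundle_ext (xi eta : cotBundle M) : tag xi = tag eta ->
  (forall Y : vfield M, tagged xi (Y (tag xi)) = tagged eta (Y (tag eta))) -> xi = eta.
Proof.
case: xi eta => p xi [q eta] /= pq; subst q => H; congr existT; apply: cotangent_ext => v.
by have [Y <-] := tangent_extend v; exact: H.
Qed.

Lemma tanBundle_ext (v w : tanBundle M) : tag v = tag w ->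
  (forall f : smoothFun M, tagged v f = tagged w f) -> v = w.
Proof.
by case: v w => p v [q w] /= pq; subst q => H; congr existT; exact: tangent_ext.
Qed.

End BundlePoints.

(** * Covariant derivatives along admissible curves *)

Section Covariant.
Variables (R : realType) (n : nat) (M : smoothManifold R n) (S : subRiemannian M).
Variable G : gframe S.
Local Notation Q := (sr_Q S).
Local Notation k := (sr_rank S).
Local Notation N := (gN G).
Local Notation cot := (@cotangent R n M).
Local Notation tan := (@tangent R n M).
Implicit Types (p q : M) (X Y Z : vfield M) (eta al be : oneform M) (f : smoothFun M).

Definition fom i (z : 'I_k + 'I_n) : oneform M :=
  match z with inl j => gth G i j | inr l => gze G i l end.

Definition fA i (z : 'I_k + 'I_n) : vfield M :=
  match z with inl j => gE G i j | inr l => gF G i l end.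

Lemma fom_loc p : \forall q \near p, forall i z, (N p <= i)%N -> fom i z q = 0.
Proof.
near=> q => i [j|l] Ni /=; move: Ni.
  by move: i j; near: q; exact: gth_loc.
by move: i l; near: q; exact: gze_loc.
Unshelve. all: by end_near. Qed.

Lemma fom_frame p (v : tangent p) :
  \sum_(i < N p) \sum_z fom i z p v *: fA i z p = v.
Proof.
rewrite -[RHS](gframeE v (leqnn (N p))) -big_split; apply: eq_bigr => i _.
by rewrite big_sumType.
Qed.

(* The sum runs over the full frame of TM because a smooth extension of a curve
   beyond [a, b] need not be tangent to Q there; only velocities in Q concern
   nabla. *)
Definition bracket_pair (xi : cotBundle M) (w : tanBundle M) Y : R :=
  \sum_(i < N (tag xi)) \sum_z fom i z (tag w) (tagged w) * tagged xi (lie (fA i z) Y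
    (tag xi)).

Lemma bracket_pairE p (xi : cotangent p) (v : tangent p) Y :
  bracket_pair (Tagged cot xi) (Tagged tan v) Y =
  \sum_(i < N p) \sum_z fom i z p v * xi (lie (fA i z) Y p).
Proof. by []. Qed.

Lemma bracket_pair_Q p (xi : cotangent p) (v : tangent p) Y : Q v ->
  bracket_pair (Tagged cot xi) (Tagged tan v) Y =
  \sum_(i < N p) \sum_j gth G i j p v * xi (lie (gE G i j) Y p).
Proof.
move=> Qv; rewrite bracket_pairE; apply: eq_bigr => i _.
by rewrite big_sumType /= [X in _ + X]big1 ?addr0// => l _; rewrite (gze_Q0 G) ?mul0r.
Qed.

Lemma bracket_pair_stable m p (xi : cotangent p) (v : tangent p) Y : (N p <= m)%N ->
  bracket_pair (Tagged cot xi) (Tagged tan v) Y =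
  \sum_(i < m) \sum_z fom i z p v * xi (lie (fA i z) Y p).
Proof.
move=> Nm; rewrite bracket_pairE.
apply/esym/(@sum_stable _ (fun i => \sum_z fom i z p v * xi (lie (fA i z) Y p))) => // i Ni.
rewrite big1// => z _.
by rewrite (nbhs_singleton (fom_loc p)) ?cotangent0E ?mul0r.
Qed.

Lemma bracket_pair_local p (xi : cotangent p) (v : tangent p) Y Y' :
  (\forall q \near p, Y q = Y' q) ->
  bracket_pair (Tagged cot xi) (Tagged tan v) Y =
  bracket_pair (Tagged cot xi) (Tagged tan v) Y'.
Proof.
move=> YY'; rewrite !bracket_pairE; apply: eq_bigr => i _; apply: eq_bigr => z _.
by rewrite (lie_localr _ YY').
Qed.

(** In [Y] the bracket term obeys the same Leibniz rule as the derivative of the pairing with [Y],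
    so their difference is linear over functions. The full frame is used to recover [v (a l)]. *)
Lemma bracket_pair_comb I (r : seq I) p (xi : cotangent p) (v : tangent p)
    (a : I -> smoothFun M) (Y : I -> vfield M) :
  bracket_pair (Tagged cot xi) (Tagged tan v) (vf_comb r xpredT a Y) =
  \sum_(l <- r) (a l p * bracket_pair (Tagged cot xi) (Tagged tan v) (Y l)
     + v (a l) * xi (Y l p)).
Proof.
rewrite bracket_pairE.
transitivity (\sum_(i < N p) \sum_z \sum_(l <- r)
    (a l p * (fom i z p v * xi (lie (fA i z) (Y l) p)) +
     (fom i z p v * fA i z p (a l)) * xi (Y l p))).
  apply: eq_bigr => i _; apply: eq_bigr => z _.
  rewrite lie_combr covector_sum mulr_sumr; apply: eq_bigr => l _.
  by rewrite covectorD !covectorZ; ring.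
under eq_bigr do rewrite exchange_big.
rewrite exchange_big; apply: eq_bigr => l _.
have va : v (a l) = \sum_(i < N p) \sum_z fom i z p v * fA i z p (a l).
  by rewrite -{1}(fom_frame v) tangent_sumE; apply: eq_bigr => i _; rewrite tangent_sumE.
rewrite va bracket_pairE mulr_sumr mulr_suml -big_split; apply: eq_bigr => i _.
by rewrite mulr_sumr mulr_suml -big_split; apply: eq_bigr => z _.
Qed.

(** The formula that carries over to curves: for a section along [c], the derivative of its pairing
    with [Y] takes the place of [v (contract eta Y)]. *)
Lemma nabla_at_pair p (v : tangent p) eta Y : Q v ->
  nabla_at G v eta (Y p) = v (contract eta Y) -
    bracket_pair (Tagged cot (eta p)) (Tagged tan v) Y.
Proof.
move=> Qv; rewrite bracket_pair_Q// -{2}(Q_frame (G := G) Qv (leqnn _)).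
rewrite cotangent_sumE tangent_sumE -sumrB; apply: eq_bigr => i _.
rewrite cotangent_sumE tangent_sumE -sumrB; apply: eq_bigr => j _.
by rewrite cotangentZE lie_formE tangentZE mulrBr.
Qed.

Section Along.
Variables (a b : R) (c : R -> M) (sigma : forall t, cotangent (c t)).

Definition pairing Y : R -> R := fun t => sigma t (Y (c t)).

(** The covector prescribed by [nabla_at_pair], with a derivative in [t] so that [sigma] need not
    extend to a one-form; [v] may be any velocity, in Q or not. *)
Definition covD t (v : tangent (c t)) : cotangent (c t) :=
  xget 0 [set xi : cotangent (c t) | forall Y l, deriv_in a b (pairing Y) t l ->
    xi (Y (c t)) = l - bracket_pair (Tagged cot (sigma t)) (Tagged tan v) Y].

(** [tensorial_covector] applies since the terms with [v (x i)] in the derivative of the pairing and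
    in [bracket_pair] cancel. The third hypothesis is continuity of [c] relative to the interval,
    for locality in [Y]. *)
Lemma covDE t (v : tangent (c t)) : a < b -> a <= t <= b ->
  (forall P : M -> Prop, (\forall q \near c t, P q) ->
     \forall u \near t, a <= u <= b -> P (c u)) ->
  (forall f, deriv_in a b (f \o c) t (v f)) ->
  (forall Y, exists l, deriv_in a b (pairing Y) t l) ->
  forall Y l, deriv_in a b (pairing Y) t l ->
    covD v (Y (c t)) = l - bracket_pair (Tagged cot (sigma t)) (Tagged tan v) Y.
Proof.
move=> ab tab cc dv /choice[d dd].
have du Y l : deriv_in a b (pairing Y) t l -> l = d Y.
  by move=> dl; exact: deriv_in_unique ab tab dl (dd Y).
have [|x Y|xi xiE] := @tensorial_covector _ _ _ (c t)
    (fun Y => d Y - bracket_pair (Tagged cot (sigma t)) (Tagged tan v) Y).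
- move=> Y Y' YY'; rewrite (bracket_pair_local _ _ YY'); congr (_ - _).
  apply: du; apply: deriv_in_eq (dd Y); last by rewrite /pairing (nbhs_singleton YY').
  by apply: filterS (cc _ YY') => u H uab; rewrite /pairing H.
- rewrite bracket_pair_comb.
  have -> : d (vf_comb (index_enum 'I_n) xpredT x Y) =
      \sum_i (v (x i) * pairing (Y i) t + (x i \o c) t * d (Y i)).
    apply/esym/du.
    have H := @deriv_in_sum R 'I_n (index_enum 'I_n) xpredT a b
      (fun i => (x i \o c) * pairing (Y i)) t _ (fun i _ => deriv_inM (dv (x i)) (dd
        (Y i))).
    apply: deriv_in_ext H => // u _.
    by rewrite /pairing /= covector_sum; apply: eq_bigr => i _; rewrite covectorZ.
  rewrite -sumrB; apply: eq_bigr => i _; rewrite /pairing /=; ring.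
rewrite /covD; case: xgetP => [eta _ //|/(_ xi)[] Y l /du ->].
by rewrite -xiE.
Qed.

End Along.

Lemma curve_cst (a b r : R) : curve (@smooth_on R R R) a b (cst r).
Proof.
exists (a - 1), (b + 1), (cst r); split => //; last exact: smooth_on_cst.
  by rewrite ltrBlDr ltrDl.
by rewrite ltrDl.
Qed.

Lemma bracket_pair_linear p r (xi eta : cotangent p) (w : tanBundle M) Y :
  bracket_pair (Tagged cot (r *: xi + eta)) w Y =
  r * bracket_pair (Tagged cot xi) w Y + bracket_pair (Tagged cot eta) w Y.
Proof.
rewrite mulr_sumr -big_split; apply: eq_bigr => i _.
rewrite mulr_sumr -big_split; apply: eq_bigr => z _.
rewrite -[LHS]/(fom i z (tag w) (tagged w) * (r * xi (lie (fA i z) Y p) + eta (lie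
  (fA i z) Y p))).
rewrite mulrDr mulrCA //.
Qed.

Lemma bracket_pair0 p (w : tanBundle M) Y :
  bracket_pair (Tagged cot (0 : cotangent p)) w Y = 0.
Proof.
rewrite /bracket_pair big1// => i _; rewrite big1// => z _.
exact: mulr0.
Qed.

Section SmoothSections.
Variables (a b : R) (c : R -> M).
Implicit Types (sigma tau : forall t, cotangent (c t)).

Lemma section_extension sigma : smooth_section a b sigma ->
  exists a' b' (psi : R -> cotBundle M), [/\ a' < a, b < b',
    smooth_cot_path `]a', b'[%classic psi &
    forall t, a <= t <= b -> psi t = Tagged cot (sigma t)].
Proof.
by move=> [a' [b' [psi [aa bb sp H]]]]; exists a', b', psi; split => // t tab; rewrite H.
Qed.

Lemma section_continuous sigma t : smooth_section a b sigma -> a <= t <= b ->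
  forall P : M -> Prop, (\forall q \near c t, P q) ->
     \forall u \near t, a <= u <= b -> P (c u).
Proof.
move=> /section_extension[a' [b' [psi [aa bb [sp _] H]]]] tab P nP.
have ct u : a <= u <= b -> c u = tag (psi u) by move=> /H ->.
have Jt := in_oo aa bb tab.
rewrite ct// in nP; have [W [oW Wt WP]] := smooth_path_near (@open_oo _ a' b') sp Jt nP.
near=> u => uab; rewrite ct//.
suff /WP[] : W u by [].
by near: u; exact: open_nbhs_nbhs.
Unshelve. all: by end_near. Qed.

Lemma section_pairing_derivable sigma t Y : smooth_section a b sigma -> a <= t <= b ->
  exists l, deriv_in a b (pairing sigma Y) t l.
Proof.
move=> /section_extension[a' [b' [psi [aa bb sp H]]]] tab.
have Jt := in_oo aa bb tab.
have sY := smooth_cot_pair Y (@open_oo _ a' b') sp.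
exists ('D_1 (fun t => tagged (psi t) (Y (tag (psi t)))) t).
apply: (@deriv_in_ext _ _ _ (fun t => tagged (psi t) (Y (tag (psi t))))) => //.
  by move=> u uab; rewrite H.
apply: deriv_in_is_derive; split => //.
by apply: (@smooth_on_derivable _ _ _ `]a', b'[%classic).
Qed.

Lemma smooth_section_form eta sigma : smooth_section a b sigma ->
  smooth_section a b (fun t => eta (c t)).
Proof.
move=> /section_extension[a' [b' [psi [aa bb sp H]]]].
exists a', b', (fun t => Tagged cot (eta (tag (psi t)))); split => //.
  apply: smooth_cot_path_intro; [exact: open_oo|by case: sp|move=> Y].
  by apply: (smooth_path_fun (contract eta Y)); [exact: open_oo|case: sp].
by move=> t; rewrite in_itv /= => tab; rewrite H.
Qed.

(* Extensions of two sections along c may have different base curves outside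
   [a, b]; the second one is moved to the base curve of the first one through
   its components in the frame. *)
Lemma section_rebase (c' : R -> M) a1 b1 tau : a1 < a -> b < b1 ->
  smooth_path `]a1, b1[%classic c' -> (forall t, a <= t <= b -> c' t = c t) ->
  smooth_section a b tau ->
  exists a2 b2 (tau' : forall t, cot (c' t)), [/\ a2 < a, b < b2,
    smooth_path `]a2, b2[%classic c',
    forall Y, smooth_on `]a2, b2[%classic (fun t => tau' t (Y (c' t))) &
    forall t, a <= t <= b -> Tagged cot (tau' t) = Tagged cot (tau t)].
Proof.
move=> aa1 bb1 sc' cc' /section_extension[a0 [b0 [psi [aa0 bb0 sp H]]]].
pose a2 := Num.max a0 a1; pose b2 := Num.min b0 b1.
have J1 : `]a2, b2[%classic `<=` `]a1, b1[%classic.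
  move=> t; rewrite /= !in_itv /= gt_max lt_min => /andP[/andP[_ ->] /andP[_ ->]] //.
have J0 : `]a2, b2[%classic `<=` `]a0, b0[%classic.
  move=> t; rewrite /= !in_itv /= gt_max lt_min => /andP[/andP[-> _] /andP[-> _]] //.
have oJ := @open_oo _ a2 b2.
have sc : smooth_path `]a2, b2[%classic c' := smooth_path_subset oJ J1 sc'.
pose comp i z t := tagged (psi t) (fA i z (tag (psi t))).
exists a2, b2, (fun t => \sum_(i < N (c' t)) \sum_z comp i z t *: fom i z (c' t)).
split; first by rewrite gt_max aa0 aa1.
- by rewrite lt_min bb0 bb1.
- exact: sc.
- move=> Y; apply: smooth_on_near => t Jt.
  have [W [oW Wt WP]] := smooth_path_near oJ sc Jt (fom_loc (c' t)).
  have WJ : W `<=` `]a2, b2[%classic by move=> u /WP[].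
  exists (fun u => \sum_(i < N (c' t)) \sum_z comp i z u * contract (fom i z) Y (c' u)), W.
  split => //.
    apply: smooth_on_sum => // i _; apply: smooth_on_sum => // z _.
    apply: (@smooth_onM _ _ W (comp i z) (contract (fom i z) Y \o c')) => //.
      apply: smooth_on_subset (smooth_cot_pair (fA i z) (@open_oo _ a0 b0) sp).
      by move=> u /WJ /J0.
    by apply: smooth_on_subset WJ _; exact: smooth_path_fun.
  move=> u /set_mem /WP[Ju fu]; rewrite cotangent_sumE.
  transitivity (\sum_(i < maxn (N (c' u)) (N (c' t))) \sum_z comp i z u * contract
    (fom i z) Y (c' u)).
    apply/esym/(@sum_stable _ (fun i => \sum_z comp i z u * contract (fom i z) Y (c' u))).
      by move=> i Ni; rewrite big1// => z _; rewrite /= fu ?cotangent0E ?mulr0.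
    exact: leq_maxr.
  rewrite (@sum_stable _ (fun i => \sum_z comp i z u * contract (fom i z) Y (c' u))
    (N (c' u))).
  + by apply: eq_bigr => i _; rewrite cotangent_sumE.
  + by move=> i Ni; rewrite big1// => z _;
    rewrite /= (nbhs_singleton (fom_loc (c' u))) ?cotangent0E ?mulr0.
  + exact: leq_maxl.
- move=> t tab; apply: cotBundle_ext => [|Y] /=; first exact: cc'.
  rewrite cc'// -{2}[Y (c t)]fom_frame covector_sum cotangent_sumE; apply: eq_bigr => i _.
  rewrite covector_sum cotangent_sumE; apply: eq_bigr => z _.
  by rewrite cotangentZE covectorZ /comp H// mulrC.
Qed.

Lemma smooth_section_comb (f : R -> R) sigma tau : curve (@smooth_on R R R) a b f ->
  smooth_section a b sigma -> smooth_section a b tau ->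
  smooth_section a b (fun t => f t *: sigma t + tau t).
Proof.
move=> [a0 [b0 [f' [aa0 bb0 sf Hf]]]].
move=> /section_extension[a1 [b1 [psi [aa1 bb1 sp H]]]] st.
have [spath _] := sp.
have [|a2 [b2 [tau' [aa2 bb2 sc st' Ht]]]] := section_rebase aa1 bb1 spath _ st.
  by move=> t tab /=; rewrite H.
pose a3 := Num.max (Num.max a0 a1) a2; pose b3 := Num.min (Num.min b0 b1) b2.
have J t : `]a3, b3[%classic t -> [/\ `]a0, b0[%classic t, `]a1, b1[%classic t &
  `]a2, b2[%classic t].
  rewrite /= !in_itv /= !gt_max !lt_min => /andP[/andP[/andP[-> ->] ->]].
  by move=> /andP[/andP[-> ->] ->].
have oJ := @open_oo _ a3 b3.
exists a3, b3, (fun t => Tagged cot (f' t *: tagged (psi t) + tau' t)); split.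
- by rewrite !gt_max aa0 aa1 aa2.
- by rewrite !lt_min bb0 bb1 bb2.
- apply: smooth_cot_path_intro => //; first by apply: smooth_path_subset sc => // t /J[].
  move=> Y.
  apply: (@smooth_onD _ _ _ _ (f' * (fun t => tagged (psi t) (Y (tag (psi t)))))
    (fun t => tau' t (Y (tag (psi t))))) => //.
    apply: smooth_onM => //; first by apply: smooth_on_subset sf => t /J[].
    by apply: smooth_on_subset (smooth_cot_pair Y (@open_oo _ a1 b1) sp) => t /J[].
  by apply: smooth_on_subset (st' Y) => t /J[].
- move=> t; rewrite in_itv /= => tab; apply: cotBundle_ext; first by rewrite /= H.
  move=> Y; rewrite -[LHS]/(f' t * tagged (psi t) (Y (tag (psi t))) + tau' t (Y (tag
    (psi t)))).
  rewrite -[RHS]/(f t * sigma t (Y (c t)) + tau t (Y (c t))) Hf ?in_itv//;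
    congr (_ * _ + _).
    by rewrite H.
  by have := congr1 (fun x : cotBundle M => tagged x (Y (tag x))) (Ht t tab).
Qed.

Lemma smooth_section_scale (f : R -> R) sigma : curve (@smooth_on R R R) a b f ->
  smooth_section a b sigma -> smooth_section a b (fun t => f t *: sigma t).
Proof.
move=> cf ss; have := smooth_section_comb cf ss (smooth_section_form 0 ss).
congr smooth_section; apply: functional_extensionality_dep => t.
exact: addr0.
Qed.

Lemma smooth_section_sum I (r : seq I) (sigma : I -> forall t, cotangent (c t)) tau :
  smooth_section a b tau -> (forall i, smooth_section a b (sigma i)) ->
  smooth_section a b (fun t => \sum_(i <- r) sigma i t).
Proof.
move=> st ss; elim: r => [|i r IH].
  have := smooth_section_form 0 st.
  congr smooth_section; apply: functional_extensionality_dep => t.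
  by rewrite big_nil.
have := smooth_section_comb (curve_cst a b 1) (ss i) IH.
congr smooth_section; apply: functional_extensionality_dep => t.
by rewrite big_cons scale1r.
Qed.

End SmoothSections.

Section CovariantDerivative.
Variables (a b : R) (al : R -> cotBundle M).
Local Notation c := (tag \o al).
Local Notation v t := (sr_g S (tagged (al t)) : tangent (c t)).
Hypothesis ab : a < b.
Hypothesis valv : forall t, a <= t <= b -> velocity a b c t (v t).
Implicit Types (sigma tau : forall t, cotangent (c t)).

Definition covDal sigma t : cotangent (c t) := covD a b sigma (v t).

Lemma covDalE sigma t Y l : smooth_section a b sigma -> a <= t <= b ->
  deriv_in a b (pairing sigma Y) t l ->
  covDal sigma t (Y (c t)) =
  l - bracket_pair (Tagged cot (sigma t)) (Tagged tan (v t)) Y.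
Proof.
move=> ss tab; apply: covDE => //.
- exact: section_continuous ss tab.
- exact: valv.
- by move=> Z; exact: section_pairing_derivable.
Qed.

Lemma covDal_ext sigma t (xi : cotangent (c t)) : smooth_section a b sigma -> a <= t <= b ->
  (forall Y l, deriv_in a b (pairing sigma Y) t l ->
    l - bracket_pair (Tagged cot (sigma t)) (Tagged tan (v t)) Y = xi (Y (c t))) ->
  covDal sigma t = xi.
Proof.
move=> ss tab H; apply: cotangent_ext => w; have [Y <-] := tangent_extend w.
have [l dl] := section_pairing_derivable Y ss tab.
by rewrite (covDalE ss tab dl) H.
Qed.

(** The same formula, applied to a smooth extension [psi] of [sigma] and the velocity of its own
    base curve, gives a smooth section on an open interval. On the closed interval the two agree,
    because there the pairings, and hence the velocities, are those of the original curve. *)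
Lemma covDal_section sigma : smooth_section a b sigma -> smooth_section a b (covDal sigma).
Proof.
move=> ss; have [a' [b' [psi [aa bb sp H]]]] := section_extension ss.
have oJ := @open_oo _ a' b'.
have ab' : a' < b' by rewrite (lt_trans aa)// (lt_trans ab).
pose c' := tag \o psi.
pose s' t : cotangent (c' t) := tagged (psi t).
pose tau t : cotangent (c' t) := covD a' b' s' (vel c' t).
have eta (x : cotBundle M) : Tagged cot (tagged x) = x by case: x.
have psiE t : Tagged cot (s' t) = psi t := eta (psi t).
have [spath _] := sp.
have cts t : `]a', b'[%classic t -> forall P : M -> Prop, (\forall q \near c' t, P q) ->
    \forall u \near t, a' <= u <= b' -> P (c' u).
  move=> Jt P nP; have [W [oW Wt WP]] := smooth_path_near oJ spath Jt nP.
  near=> u => _; suff /WP[] : W u by [].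
  by near: u; exact: open_nbhs_nbhs.
have sY Y : smooth_on `]a', b'[%classic (pairing s' Y) by exact: smooth_cot_pair.
have dY Y t : `]a', b'[%classic t -> deriv_in a' b' (pairing s' Y) t ('D_1 (pairing
  s' Y) t).
  move=> Jt; apply: deriv_in_is_derive; split => //.
  by apply: (@smooth_on_derivable _ _ _ `]a', b'[%classic) => //; exact: sY.
have tauE t Y : `]a', b'[%classic t -> tau t (Y (c' t)) = 'D_1 (pairing s' Y) t -
    bracket_pair (psi t) (Tagged tan (vel c' t)) Y.
  move=> Jt; rewrite -[psi t]psiE; apply: covDE.
  - exact: ab'.
  - by move: Jt; rewrite /= in_itv /= => /andP[? ?]; rewrite !ltW.
  - exact: cts.
  - by move=> f; apply: deriv_in_is_derive; exact: velP oJ spath Jt.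
  - by move=> Z; exists ('D_1 (pairing s' Z) t); exact: dY.
  - exact: dY.
exists a', b', (fun t => Tagged cot (tau t)); split => //.
  apply: smooth_cot_path_intro => // Y.
  apply: smooth_on_near => t Jt.
  have [W [oW Wt WP]] := smooth_path_near oJ spath Jt (fom_loc (c' t)).
  have WJ : W `<=` `]a', b'[%classic by move=> u /WP[].
  exists ('D_1 (pairing s' Y) - (fun u => \sum_(i < N (c' t)) \sum_z
    fom i z (c' u) (vel c' u) * tagged (psi u) (lie (fA i z) Y (tag (psi u))))), W;
      split => //.
    apply: smooth_onB => //.
      by apply: smooth_on_subset WJ _; exact: smooth_on_derive.
    apply: smooth_on_sum => // i _; apply: smooth_on_sum => // z _.
    apply: (@smooth_onM _ _ W (fun u => fom i z (c' u) (vel c' u))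
      (fun u => tagged (psi u) (lie (fA i z) Y (tag (psi u))))) => //.
      by apply: smooth_on_subset WJ _; exact: smooth_form_vel.
    by apply: smooth_on_subset WJ _; exact: smooth_cot_pair.
  move=> u /set_mem /WP[Ju fu]; rewrite [RHS]tauE// -[LHS]/(_ - _); congr (_ - _).
  rewrite -[psi u]psiE (bracket_pair_stable _ _ _ (leq_maxl (N (c' u)) (N (c' t)))).
  apply/esym/(@sum_stable _ (fun i => \sum_z fom i z (c' u) (vel c' u) *
    s' u (lie (fA i z) Y (c' u)))); rewrite ?leq_maxr// => i Ni.
  by rewrite big1// => z _; rewrite fu ?cotangent0E ?mul0r.
move=> t; rewrite in_itv /= => tab.
have Jt := in_oo aa bb tab.
have tagE u : a <= u <= b -> c' u = c u by move=> uab; rewrite /c' /= H.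
apply: cotBundle_ext; first exact: tagE.
move=> Y; rewrite [LHS]tauE//.
have dl : deriv_in a b (pairing sigma Y) t ('D_1 (pairing s' Y) t).
  apply: (@deriv_in_ext _ _ _ (pairing s' Y)) => //.
    by move=> u uab; rewrite /pairing /s' /c' /= H.
  by apply: (deriv_in_sub _ _ (dY Y t Jt)); rewrite ltW.
rewrite [RHS](covDalE ss tab dl) H//; congr (_ - bracket_pair _ _ _).
apply: tanBundle_ext; first exact: tagE.
move=> f /=; apply: (deriv_in_unique ab tab (f := f \o c)); last exact: valv.
apply: (@deriv_in_ext _ _ _ (f \o c')) => //.
  by move=> u uab; rewrite /= -/(c' u) tagE.
by apply: deriv_in_is_derive; exact: velP oJ spath Jt.
Unshelve. all: by end_near. Qed.

Lemma covDal_covariant : covariant_derivative (nabla G) a b covDal.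
Proof.
split.
- exact: covDal_section.
- move=> r sigma tau ss st t; rewrite in_itv /= => tab.
  apply: cotangent_ext => w; have [Y <-] := tangent_extend w.
  have [l dl] := section_pairing_derivable Y ss tab.
  have [l' dl'] := section_pairing_derivable Y st tab.
  have dd := deriv_inD (deriv_inM (deriv_in_cst a b r t) dl) dl'.
  have sst : smooth_section a b (fun u => r *: sigma u + tau u).
    by apply: smooth_section_comb => //; exact: curve_cst.
  rewrite (covDalE sst tab dd) cotangentDE cotangentZE (covDalE ss tab dl) (covDalE
    st tab dl').
  by rewrite bracket_pair_linear; rewrite /cst /=; ring.
- move=> f sigma sf ss t; rewrite in_itv /= => tab d df.
  apply: cotangent_ext => w; have [Y <-] := tangent_extend w.
  have [l dl] := section_pairing_derivable Y ss tab.
  have sfs : smooth_section a b (fun u => f u *: sigma u).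
    exact: smooth_section_scale.
  rewrite (covDalE sfs tab (deriv_inM df dl)) cotangentDE !cotangentZE (covDalE ss tab dl).
  rewrite -[f t *: sigma t]addr0 bracket_pair_linear bracket_pair0 /pairing; ring.
- move=> sigma eta ss seta t; rewrite in_itv /= => tab be bet.
  apply: covDal_ext => // Y l dl.
  have -> : l = v t (contract eta Y).
    apply: (deriv_in_unique ab tab dl).
    apply: (@deriv_in_ext _ _ _ (contract eta Y \o c)) => //; last exact: valv.
    by move=> u uab; rewrite /pairing -seta ?in_itv.
  rewrite -seta ?in_itv// /= bet nabla_at_pair//; exact: sr_g_Q.
Qed.

End CovariantDerivative.

End Covariant.

(** * Parallel sections and abnormal extremals *)

Section ParallelTransport.
Variables (R : realType) (n : nat) (M : smoothManifold R n) (S : subRiemannian M).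
Local Notation Q := (sr_Q S).
Local Notation k := (sr_rank S).
Local Notation cot := (@cotangent R n M).
Local Notation tan := (@tangent R n M).
Implicit Types (p q : M) (X Y Z : vfield M) (eta be : oneform M) (f : smoothFun M).

Lemma pair_bracket_extend p (xi : cotangent p) X Y : sr_Q0 S xi -> section_Q S X ->
  pair_bracket S (Tagged cot xi) (Tagged tan (X p)) Y = xi (lie X Y p).
Proof.
move=> Qxi QX; have [G] := gframe_exists S.
rewrite (@pair_bracketE _ _ _ _ G (Tagged cot xi) (Tagged tan (X p)) Y erefl Qxi (QX p)).
by have [eta Qeta <-] := Q0_extend G Qxi; rewrite (bracket_Q G).
Qed.

Section Pieces.
Variables (a b : R) (c : R -> M).
Implicit Types (sigma tau : forall t, cotangent (c t)).

Lemma curve_pairing sigma Y : smooth_section a b sigma ->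
  curve (@smooth_on R R R) a b (pairing sigma Y).
Proof.
move=> /section_extension[a' [b' [psi [aa bb sp H]]]].
exists a', b', (fun t => tagged (psi t) (Y (tag (psi t)))); split => //.
  exact: smooth_cot_pair (@open_oo _ a' b') sp.
by move=> t; rewrite in_itv /= => tab; rewrite H.
Qed.

Lemma curve_fun sigma f : smooth_section a b sigma ->
  curve (@smooth_on R R R) a b (f \o c).
Proof.
move=> /section_extension[a' [b' [psi [aa bb [sp _] H]]]].
exists a', b', (f \o (tag \o psi)); split => //.
  exact: smooth_path_fun (@open_oo _ a' b') sp.
by move=> t; rewrite in_itv /= => tab; rewrite H.
Qed.

End Pieces.

Section CovariantSum.
Variables (G : gframe S) (nabla : oneform M -> oneform M -> oneform M) (a b : R) (al
  : R -> cotBundle M).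
Local Notation c := (tag \o al).
Variable D : (forall t, cotangent (c t)) -> (forall t, cotangent (c t)).
Hypothesis cvD : covariant_derivative nabla a b D.

(** The axioms do not mention 0: the zero section is written as [-1 *: sigma + sigma]. *)
Lemma cov_zero (sigma : forall t, cotangent (c t)) t : smooth_section a b sigma -> a
  <= t <= b ->
  D (fun u => 0) t = 0.
Proof.
move=> ss tab.
have tin : t \in `[a, b] by rewrite in_itv.
have := cov_linear cvD (-1) ss ss tin.
rewrite [X in _ = X -> _](_ : _ = 0) ?scaleN1r ?addNr// => <-.
congr (D _ t); apply: functional_extensionality_dep => u.
by rewrite scaleN1r addNr.
Qed.

Lemma cov_sum I (r : seq I) (s : I -> forall t, cotangent (c t)) (sigma : forall t,
  cotangent (c t)) t :
  smooth_section a b sigma -> (forall i, smooth_section a b (s i)) -> a <= t <= b ->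
  D (fun u => \sum_(i <- r) s i u) t = \sum_(i <- r) D (s i) t.
Proof.
move=> ss sss tab; elim: r => [|i r IH].
  rewrite big_nil -(cov_zero ss tab).
  by congr (D _ t); apply: functional_extensionality_dep => u; rewrite big_nil.
rewrite big_cons -IH -[X in X + _]scale1r.
have tin : t \in `[a, b] by rewrite in_itv.
rewrite -(cov_linear cvD 1 (sss i) (smooth_section_sum G r ss sss) tin); congr (D _ t).
by apply: functional_extensionality_dep => u; rewrite big_cons scale1r.
Qed.

End CovariantSum.

(* Near t the cut-off of a local frame is 1, so qchi sigma = sum_l f_l ze_l with
   f_l = sigma(F_l); the terms sigma(E_j) th_j vanish as sigma is in Q^0. *)
Lemma parallel_pairing_derivative nabla (a b : R) (al : R -> cotBundle M) D
    (sigma : forall t, cotangent (tag (al t))) t X :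
  a < b -> a <= t <= b -> Q_adapted S nabla ->
  covariant_derivative nabla a b D -> smooth_section a b sigma ->
  (forall u, a <= u <= b -> sr_Q0 S (sigma u)) ->
  velocity a b (tag \o al) t (sr_g S (tagged (al t))) -> D sigma t = 0 ->
  deriv_in a b (fun u => sigma u (X (tag (al u)))) t
    (pair_bracket S (Tagged cot (sigma t)) (Tagged tan (sr_g S (tagged (al t)))) X).
Proof.
move=> ab tab adapt cvD ss Qs valt Ds0.
have [G] := gframe_exists S.
pose c := tag \o al; pose v := sr_g S (tagged (al t)).
(* A section of Q through the velocity at [t], so that the bracket with [X] is one of actual
   fields. *)
have [V QV Vv] := Q_extend G (sr_g_Q S (tagged (al t))).
have [be betal] := cotangent_extend (tagged (al t)).
rewrite -Vv pair_bracket_extend//; last exact: Qs.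
have [F chi1] := qframe_exists S (c t).
have nchi : \forall u \near t, a <= u <= b -> qchi F (c u) = 1.
  exact: section_continuous ss tab _ chi1.
have chit : qchi F (c t) = 1 by exact: nbhs_singleton chi1.
have tin : t \in `[a, b] by rewrite in_itv.
pose f l := pairing sigma (qF F l); pose g j := pairing sigma (qE F j).
have /choice[f' df] l : exists d, deriv_in a b (f l) t d.
  exact: section_pairing_derivable.
have g0 j u : a <= u <= b -> g j u = 0.
  by move=> uab; apply: Qs => //; exact: qE_Q.
have dg j : deriv_in a b (g j) t 0.
  by apply: (@deriv_in_ext _ _ _ (cst 0)) => //; [move=> u /g0 ->|exact: deriv_in_cst].
pose sth j u := g j u *: qth F j (c u); pose sze l u := f l u *: qze F l (c u).
have formS eta : smooth_section a b (fun u => eta (c u)) := smooth_section_form eta ss.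
have ssth j : smooth_section a b (sth j).
  exact: (smooth_section_scale G (curve_pairing (qE F j) ss) (formS (qth F j))).
have ssze l : smooth_section a b (sze l).
  exact: (smooth_section_scale G (curve_pairing (qF F l) ss) (formS (qze F l))).
(* Thanks to the cut-off factor the splitting holds for every [u], also outside the interval, so the
   argument of [D] can be rewritten by extensionality. *)
have split u : qchi F (c u) *: sigma u =
    1 *: (\sum_j sth j u) + \sum_l sze l u.
  rewrite scale1r; apply: cotangent_ext => w.
  rewrite cotangentZE -covectorZ -qframeE covectorD !covector_sum cotangentDE
    !cotangent_sumE.
  by congr (_ + _); apply: eq_bigr => j _; rewrite covectorZ cotangentZE mulrC.
(* Both the coefficient [g j] and its derivative vanish at [t], whatever the derivative of [qth F j]
   is. *)
have Dsth j : D (sth j) t = 0.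
  have := cov_leibniz cvD (curve_pairing (qE F j) ss) (formS (qth F j)) tin (dg j).
  by rewrite -/(g j) g0// !scale0r addr0.
have Dsze l : D (sze l) t = f' l *: qze F l (c t) + f l t *: nabla be (qze F l) (c t).
  have := cov_leibniz cvD (curve_pairing (qF F l) ss) (formS (qze F l)) tin (df l).
  move=> ->; congr (_ + _ *: _).
  exact: (cov_restrict cvD (formS (qze F l)) _ tin betal).
(* At [t] the cut-off has value 1 and derivative 0, so multiplying [sigma] by it leaves the
   covariant derivative zero. *)
have D0 : \sum_l D (sze l) t = 0.
  have dchi : deriv_in a b (qchi F \o c) t 0.
    apply: (@deriv_in_eq _ _ _ (cst 1)); [|by rewrite /= chit|exact: deriv_in_cst].
    by apply: filterS nchi => u H /H /= ->.
  have := cov_leibniz cvD (curve_fun (qchi F) ss) ss tin dchi.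
  rewrite Ds0 scale0r scaler0 addr0.
  rewrite (_ : (fun u => _ *: sigma u) = fun u => 1 *: (\sum_j sth j u) + \sum_l sze
    l u); last first.
    by apply: functional_extensionality_dep => u; exact: split.
  rewrite (cov_linear cvD 1 (smooth_section_sum G _ ss ssth) (smooth_section_sum G _
    ss ssze) tin).
  rewrite (cov_sum G cvD _ ss ssth tab) (cov_sum G cvD _ ss ssze tab) big1 ?scaler0
    ?add0r//.
have dX : deriv_in a b (fun u => \sum_l (contract (qze F l) X \o c) u * f l u) t
   (\sum_l (v (contract (qze F l) X) * f l t + contract (qze F l) X (c t) * f' l)).
  by apply: deriv_in_sum => l _; exact: deriv_inM (valt _) (df l).
have pairX (Y : vfield M) u : a <= u <= b -> qchi F (c u) = 1 ->
    sigma u (Y (c u)) = \sum_l contract (qze F l) Y (c u) * f l u.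
  move=> uab chiu; rewrite -[LHS]mul1r -chiu -covectorZ -qframeE covectorD !covector_sum.
  rewrite big1 ?add0r; last by move=> j _; rewrite covectorZ [sigma u _]g0 ?mulr0.
  by apply: eq_bigr => l _; rewrite covectorZ.
(* Pair [D0] with [X]: adaptedness turns the derivative of [qze F l] into [v (contract (qze F l) X)]
   minus its value on the bracket, and the brackets recombine to [sigma]. *)
have -> : sigma t (lie V X (tag (al t))) =
    \sum_l (v (contract (qze F l) X) * f l t + contract (qze F l) X (c t) * f' l).
  rewrite [LHS](pairX _ t tab chit).
  have := congr1 (fun x : cotangent (c t) => x (X (c t))) D0.
  rewrite cotangent_sumE cotangent0E => H.
  apply/eqP; rewrite eq_sym -subr_eq0 -sumrB; apply/eqP.
  rewrite -[RHS]H; apply: eq_bigr => l _.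
  rewrite Dsze cotangentDE !cotangentZE adapt; last exact: qze_Q0.
  rewrite betal -Vv ext_dE.
  have -> : contract (qze F l) V = 0.
    by apply: smoothFun_ext => q; exact: (@qze_Q0 _ _ _ _ F l q (V q) (QV q)).
  rewrite tangent0 subr0 Vv -/v -[contract _ X (c t)]/(qze F l (c t) (X (c t))).
  rewrite -[contract _ (lie V X) (c t)]/(qze F l (c t) (lie V X (c t))); ring.
apply: deriv_in_eq dX.
  by apply: filterS nchi => u H uab; rewrite [RHS](pairX X u uab (H uab)).
by rewrite [RHS](pairX X t tab chit).
Qed.

Lemma velocity_restrict (a b a0 b0 : R) (c c0 : R -> M) t
    (v : tangent (c t)) (w : tangent (c0 t)) :
  a <= a0 -> b0 <= b -> a0 < b0 -> a0 <= t <= b0 ->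
  (\forall u \near t, a0 <= u <= b0 -> c0 u = c u) ->
  velocity a b c t v -> velocity a0 b0 c0 t w -> Tagged tan w = Tagged tan v.
Proof.
move=> aa bb ab tab cc vv vw; have cct : c0 t = c t by exact: nbhs_singleton cc tab.
apply: tanBundle_ext => //= f; apply: (deriv_in_unique ab tab (f := f \o c0));
  first exact: vw.
apply: (@deriv_in_eq _ _ _ (f \o c)).
- by apply: filterS cc => u H /H /= ->.
- by rewrite /= cct.
- exact: deriv_in_sub aa bb (vv f).
Qed.

(* alp i need not agree with al at the left end point s i, so t is taken in the
   piece on which al is left continuous. *)
Lemma admissible_velocity (a b : R) (c : R -> M) k s al alp t (v : tangent (c t)) :
  admissible_pieces S a b c k s al alp -> a <= t <= b -> velocity a b c t v ->
  Tagged tan (sr_g S (tagged (al t))) = Tagged tan v.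
Proof.
move=> [[sub pa Hp] _ tagal valp] tab vv; have [k0 s0 sk ss] := sub.
have [i ik [sti tcase]] := subdivision_cover sub tab.
have sab u : s i <= u <= s i.+1 -> a <= u <= b by exact: (subdivision_in sub ik).
have ev : \forall u \near t, s i <= u <= s i.+1 -> alp i u = al u.
  have [_ pE] := Hp i ik.
  case: tcase => [st|[i0 ta]].
    near=> u => /andP[_ us]; apply: pE; rewrite in_itv /= us andbT.
    by near: u; exact: lt_nbhsr.
  near=> u => /andP[]; rewrite le_eqVlt => /orP[/eqP <- _|su us].
    by rewrite i0 s0.
  by apply: pE; rewrite in_itv /= su us.
have <- : alp i t = al t by exact: nbhs_singleton ev sti.
have ti : t \in `[s i, s i.+1] by rewrite in_itv.
have /andP[asi _] : a <= s i <= b by apply: sab; rewrite lexx ltW// ss.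
have /andP[_ bsi] : a <= s i.+1 <= b by apply: sab; rewrite lexx ltW// ss.
apply: (velocity_restrict asi bsi (ss i ik) sti _ vv (valp i ik t ti)).
near=> u => su; have -> : (tag \o alp i) u = tag (al u).
  by congr tag; move: su; near: u.
by apply: tagal; rewrite in_itv; exact: sab.
Unshelve. all: by end_near. Qed.

(** The admissible curve in the abnormal equation is unrelated to the one along which [psi] is
    parallel. Where [c] has a velocity, [sr_g] maps both to it, so the brackets agree; at a
    subdivision point this also gives both pieces the same derivative. *)
Lemma parallel_abnormal_extremal (a b : R) (c : R -> M) psi nabla al :
  nonvanishing_Q0_section S a b c psi -> Q_adapted S nabla ->
  parallel S nabla a b c al psi -> abnormal_extremal S a b c.
Proof.
move=> psiQ adapt [k [s [alp [[[sub _ _] _ _ valp] par]]]].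
exists psi; split => // al' [k' [s' [alp' adm']]] X t; rewrite in_itv /= => tab [v vv].
have [_ psiP] := psiQ; have [_ _ _ ss] := sub.
apply: (deriv_in_glue sub) => i ik sti.
have [D [sigma [cvD sS sE sp]]] := par i ik.
have sab u : s i <= u <= s i.+1 -> a <= u <= b by exact: (subdivision_in sub ik).
have siE u : s i <= u <= s i.+1 -> Tagged cot (sigma u) = psi u.
  by move=> su; apply: sE; rewrite in_itv.
have tagE u : s i <= u <= s i.+1 -> tag (alp i u) = c u.
  move=> su; have [|<- _ _] := psiP u; first by rewrite in_itv; exact: sab.
  by rewrite -siE.
have ti : t \in `[s i, s i.+1] by rewrite in_itv.
have /andP[asi _] : a <= s i <= b by apply: sab; rewrite lexx ltW// ss.
have /andP[_ bsi] : a <= s i.+1 <= b by apply: sab; rewrite lexx ltW// ss.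
rewrite (admissible_velocity adm' tab vv) -siE//.
have <- : Tagged tan (sr_g S (tagged (alp i t))) = Tagged tan v.
  apply: (velocity_restrict asi bsi (ss i ik) sti _ vv (valp i ik t ti)).
  by near=> u => su; exact: tagE.
apply: (@deriv_in_ext _ _ _ (fun u => sigma u (X (tag (alp i u))))) => //.
  by move=> u su; rewrite -siE.
apply: (@parallel_pairing_derivative nabla _ _ (alp i) D sigma t X (ss i ik) sti
  adapt cvD sS).
- move=> u su; have [|_ _] := psiP u; first by rewrite in_itv; exact: sab.
  by rewrite -siE.
- exact: valp.
- exact: sp.
Unshelve. all: by end_near. Qed.

End ParallelTransport.

(** * From abnormal extremals to parallel sections *)

Lemma eq0_closure (R : realType) (a b t : R) (f : R -> R) : a < b -> a <= t <= b ->
  {for t, continuous f} -> (forall u, a < u < b -> f u = 0) -> f t = 0.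
Proof.
move=> ab /andP[at' tb] cf f0; apply/eqP; apply/negP => /negP ft0.
have nz : \forall u \near t, f u != 0.
  exact: (cf [set x | x != 0] (open_nbhs_nbhs (conj (@open_neq _ _) ft0))).
have /nbhs_ballP[d /= d0 dH] := nz.
suff [u [ud uab]] : exists u, ball t d u /\ a < u < b.
  by have := dH u ud; rewrite f0 ?eqxx.
(* Move from [t] towards the midpoint by a fraction [e], small enough to stay within [d] of [t]; the
   new point is interior. *)
pose m := (a + b) / 2; pose e := Num.min 1 (d / (2 * (b - a))).
have e0 : 0 < e by rewrite lt_min ltr01 divr_gt0// mulr_gt0// subr_gt0.
have e1 : e <= 1 by rewrite ge_min lexx.
have ed : e * (b - a) <= d / 2.
  rewrite -ler_pdivlMr ?subr_gt0//; rewrite ge_min; apply/orP; right.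
  by rewrite invfM mulrA.
have am : a < m by rewrite /m; lra.
have mb : m < b by rewrite /m; lra.
exists (t + e * (m - t)); split.
  rewrite -ball_normE /ball_ /= opprD addrA subrr sub0r normrN normrM gtr0_norm//.
  apply: (@le_lt_trans _ _ (e * (b - a))); last by lra.
  rewrite ler_pM2l// ler_norml; apply/andP; split; lra.
apply/andP; split; nra.
Qed.

Lemma deriv_in_interior (R : realType) (a b a0 b0 t l : R) (f : R -> R) :
  a0 < t < b0 -> deriv_in a0 b0 f t l -> deriv_in a b f t l.
Proof.
move=> /andP[at' tb] /deriv_inP H; apply/deriv_inP => e /H He; near=> u => _.
suff: a0 <= u <= b0 by near: u.
by apply/andP; split; apply/ltW; near: u; [exact: lt_nbhsr|exact: lt_nbhsl].
Unshelve. all: by end_near. Qed.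

Section AbnormalParallel.
Variables (R : realType) (n : nat) (M : smoothManifold R n) (S : subRiemannian M).
Variable G : gframe S.
Local Notation Q := (sr_Q S).
Local Notation k := (sr_rank S).
Local Notation N := (gN G).
Local Notation E := (gE G).
Local Notation th := (gth G).
Local Notation cot := (@cotangent R n M).
Local Notation tan := (@tangent R n M).
Implicit Types (p q : M) (X Y Z : vfield M) (eta be : oneform M) (f : smoothFun M).

(** [w] is h paired with [X], evaluated on the part of a vector seen by the [th i j]; on Q the frame
    reproduces vectors, so it is the form dual to [X]. *)
Lemma section_Q_dual X : section_Q S X -> exists eta, forall p, sr_g S (eta p) = X p.
Proof.
move=> QX; pose w p : cotangent p :=
  \sum_(i < N p) \sum_j sr_h S (X p) (E i j p) *: th i j p.
have sw : forall Y, smooth_fun (fun p => w p (Y p)).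
  move=> Y; apply: (oneform_local (w := w)) => p.
  exists (\sum_(i < N p) \sum_j
    mkSmooth (sr_h_smooth QX (gE_Q G i j)) *: th i j).
  near=> q.
  have thq : forall i j, (N p <= i)%N -> th i j q = 0.
    by near: q; exact: (gth_loc G p).
  rewrite oneform_sumE.
  transitivity (\sum_(i < maxn (N q) (N p)) \sum_j sr_h S (X q) (E i j q) *: th i j q).
    apply/esym/(@sum_stable _ (fun i => \sum_j sr_h S (X q) (E i j q) *: th i j q));
      rewrite ?leq_maxl//.
    by move=> i Ni; rewrite big1// => j _; rewrite (nbhs_singleton (gth_loc G q)) ?scaler0.
  rewrite (@sum_stable _ (fun i => \sum_j sr_h S (X q) (E i j q) *: th i j q) (N p))
    ?leq_maxr//.
    by apply: eq_bigr => i _; rewrite oneform_sumE; apply: eq_bigr => j _;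
      rewrite oneform_zE.
  by move=> i Ni; rewrite big1// => j _; rewrite thq ?scaler0.
exists (OneForm sw) => p; apply: sr_g_unique => // u Qu.
rewrite -[RHS]/(w p u) -{1}(Q_frame (G := G) Qu (leqnn _)) cotangent_sumE.
rewrite -(big_mkord xpredT (fun i => \sum_j th i j p u *: E i j p)).
have QE i j : Q (E i j p) by exact: gE_Q.
transitivity (sr_h S (X p) (\sum_(i < N p) 1 *: (\sum_j th i j p u *: E i j p))).
  by rewrite big_mkord; congr (sr_h S _ _); apply: eq_bigr => i _; rewrite scale1r.
rewrite sr_h_sumr//; last by move=> i; apply: sr_Q_sum => j _; exact: sr_QZ.
apply: eq_bigr => i _; rewrite mul1r sr_h_sumr// cotangent_sumE; apply: eq_bigr => j _.
by rewrite cotangentZE mulrC.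
Unshelve. all: by end_near. Qed.

(** The components [th i j] of the velocity multiply fixed forms [eta] with [sr_g eta = E i j]. The
    result is smooth along the whole path, and [sr_g] returns the velocity wherever it lies in Q. *)
Lemma admissible_lift (J : set R) (c : R -> M) : open J -> smooth_path J c ->
  exists lam : forall t, cotangent (c t),
    smooth_cot_path J (fun t => Tagged cot (lam t)) /\
    forall t, Q (vel c t) -> sr_g S (lam t) = vel c t.
Proof.
move=> oJ sc.
have /choice[eta etaE] : forall ij : nat * 'I_k, exists eta : oneform M,
    forall p, sr_g S (eta p) = E ij.1 ij.2 p.
  by move=> [i j]; apply: section_Q_dual; exact: gE_Q.
exists (fun t => \sum_(i < N (c t)) \sum_j th i j (c t) (vel c t) *: eta (val i, j) (c t)).
split; last first.
  move=> t Qv; rewrite -[RHS](Q_frame (G := G) Qv (leqnn _)).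
  have gsum I (r : seq I) (F : I -> cotangent (c t)) :
      sr_g S (\sum_(i <- r) F i) = \sum_(i <- r) sr_g S (F i).
    elim: r => [|i r IH]; first by rewrite !big_nil sr_g0.
    by rewrite !big_cons sr_gD IH.
  rewrite gsum; apply: eq_bigr => i _; rewrite gsum; apply: eq_bigr => j _.
  by rewrite sr_gZ etaE.
apply: smooth_cot_path_intro => // Y; apply: smooth_on_near => t Jt.
have [W [oW Wt WP]] := smooth_path_near oJ sc Jt (gth_loc G (c t)).
have WJ : W `<=` J by move=> u /WP[].
exists (fun u => \sum_(i < N (c t)) \sum_j th i j (c u) (vel c u) * contract (eta
  (val i, j)) Y (c u)), W.
split => //.
  apply: smooth_on_sum => // i _; apply: smooth_on_sum => // j _.
  apply: (@smooth_onM _ _ W (fun u => th i j (c u) (vel c u)) (contract (eta (val i,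
    j)) Y \o c)) => //.
    by apply: smooth_on_subset WJ _; exact: smooth_form_vel.
  by apply: smooth_on_subset WJ _; exact: smooth_path_fun.
move=> u /set_mem /WP[Ju thu];
  rewrite -[RHS]/((\sum_(i < N (c u)) \sum_j th i j (c u) (vel c u) *: eta (val i, j)
    (c u)) (Y (c u))).
pose F i := \sum_j th i j (c u) (vel c u) * contract (eta (i, j)) Y (c u).
transitivity (\sum_(i < N (c u)) F i); last first.
  rewrite cotangent_sumE; apply: eq_bigr => i _; rewrite cotangent_sumE.
  by apply: eq_bigr => j _; rewrite cotangentZE.
transitivity (\sum_(i < maxn (N (c u)) (N (c t))) F i).
  apply/esym/(@sum_stable _ F); last exact: leq_maxr.
  by move=> i Ni; rewrite /F big1// => j _; rewrite thu ?cotangent0E ?mul0r.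
apply: (@sum_stable _ F); last exact: leq_maxl.
by move=> i Ni; rewrite /F big1// => j _;
  rewrite (nbhs_singleton (gth_loc G (c u))) ?cotangent0E ?mul0r.
Qed.

(** At the ends of a piece [c] itself may have no velocity, so tangency gives nothing there
    directly. The forms [gze] vanish on interior velocities, hence by continuity on the end
    velocities, which therefore lie in Q. *)
Lemma vel_Q_closure (J : set R) (c : R -> M) a b : open J -> smooth_path J c ->
  a < b -> (forall t, a <= t <= b -> J t) -> (forall t, a < t < b -> Q (vel c t)) ->
  forall t, a <= t <= b -> Q (vel c t).
Proof.
move=> oJ sc ab abJ Qv t tab.
rewrite -(gframeE (vel c t) (leqnn (N (c t)))) [X in _ + X]big1 ?addr0.
  by apply: sr_Q_sum => i _; apply: sr_Q_sum => j _; apply: sr_QZ; exact: gE_Q.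
move=> i _; rewrite big1// => l _.
have -> : gze G i l (c t) (vel c t) = 0; last by rewrite scale0r.
apply: (eq0_closure (f := fun t => gze G i l (c t) (vel c t)) ab tab).
  apply: (@smooth_on_continuous _ _ _ J); last exact: abJ.
  exact: smooth_form_vel.
by move=> u /Qv Qu; apply: gze_Q0.
Qed.

Lemma tan_cast (x : tanBundle M) q : tag x = q -> exists v : tangent q, Tagged tan v = x.
Proof. by case: x => p v /= <-; exists v. Qed.

Lemma cot_cast (x : cotBundle M) q : tag x = q -> exists v : cotangent q, Tagged cot v = x.
Proof. by case: x => p v /= <-; exists v. Qed.

Lemma velocity_interior (a b a0 b0 : R) (c c0 : R -> M) t (w : tangent (c0 t)) :
  a0 < t < b0 -> (forall u, a0 <= u <= b0 -> c0 u = c u) -> velocity a0 b0 c0 t w ->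
  exists2 v : tangent (c t), velocity a b c t v & Tagged tan v = Tagged tan w.
Proof.
move=> tab cc vw; have tab' : a0 <= t <= b0 by case/andP: tab => ? ?; rewrite !ltW.
have [v vE] := @tan_cast (Tagged tan w) _ (cc t tab').
exists v => // f; apply: (deriv_in_interior _ _ tab).
have -> : v f = w f by exact: (congr1 (fun x : tanBundle M => tagged x f) vE).
by apply: deriv_in_ext (vw f) => // u uab; rewrite /= cc.
Qed.

(** The base curve of a smooth extension of [psi] extends [c] on this piece, so the admissible curve
    can be built over the subdivision of [psi]. *)
Lemma lift_piece (a b a0 b0 : R) (c : R -> M) (psi : R -> cotBundle M) :
  tangent_to_Q S a b c -> a <= a0 -> b0 <= b -> a0 < b0 ->
  curve (@smooth_cot_path R n M) a0 b0 psi -> (forall t, a0 <= t <= b0 -> tag (psi t)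
    = c t) ->
  exists al : R -> cotBundle M, [/\ curve (@smooth_cot_path R n M) a0 b0 al,
    forall t, a0 <= t <= b0 -> tag (al t) = c t &
    forall t, a0 <= t <= b0 -> velocity a0 b0 (tag \o al) t (sr_g S (tagged (al t)))].
Proof.
move=> hQ aa bb ab [a' [b' [psi' [aa' bb' [sc _] H]]]] psic.
have oJ := @open_oo _ a' b'; pose c' := tag \o psi'.
have abJ t : a0 <= t <= b0 -> `]a', b'[%classic t by exact: in_oo.
have cc t : a0 <= t <= b0 -> c' t = c t by move=> tab; rewrite /c' /= H ?in_itv// psic.
have vv t : a0 <= t <= b0 -> velocity a0 b0 c' t (vel c' t).
  by move=> /abJ Jt f; apply: deriv_in_is_derive; exact: velP oJ sc Jt.
have Qv : forall t, a0 <= t <= b0 -> Q (vel c' t).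
  apply: (vel_Q_closure oJ sc ab abJ) => t tab.
  have tab' : a0 <= t <= b0 by case/andP: tab => ? ?; rewrite !ltW.
  have [v vel_v vE] := velocity_interior a b tab cc (vv t tab').
  have Qeq (x y : tanBundle M) : x = y -> Q (tagged x) -> Q (tagged y) by move=> ->.
  apply: (Qeq _ _ vE); apply: hQ vel_v.
  by case/andP: tab' => h1 h2; rewrite in_itv /= (le_trans aa)// (le_trans h2).
have [lam [slam lamE]] := admissible_lift oJ sc.
exists (fun t => Tagged cot (lam t)); split.
- by exists a', b', (fun t => Tagged cot (lam t)).
- exact: cc.
- by move=> t tab; rewrite [X in velocity _ _ _ _ X](lamE t (Qv t tab)); exact: vv.
Qed.

(** Inside the piece the abnormal equation says that the two terms of [covDal] cancel. The pairing
    of the result with a field extends to a smooth function, so it vanishes at the ends as well. *)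
Lemma parallel_piece (a b : R) (al psi : R -> cotBundle M) : a < b ->
  curve (@smooth_cot_path R n M) a b psi ->
  (forall t, a <= t <= b -> tag (psi t) = tag (al t)) ->
  (forall t, a <= t <= b -> velocity a b (tag \o al) t (sr_g S (tagged (al t)))) ->
  (forall t, a <= t <= b -> sr_Q0 S (tagged (psi t))) ->
  (forall X t, a < t < b -> deriv_in a b (fun u => tagged (psi u) (X (tag (psi u)))) t
    (pair_bracket S (psi t) (Tagged tan (sr_g S (tagged (al t)))) X)) ->
  exists D (sigma : forall t, cotangent (tag (al t))),
    [/\ covariant_derivative (nabla G) a b D, smooth_section a b sigma,
     {in `[a, b], forall t, Tagged cot (sigma t) = psi t} &
     {in `[a, b], forall t, D sigma t = 0}].
Proof.
move=> ab cpsi tagE valv Qpsi ode.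
(* Outside the interval the base points of [psi] and [al] may differ; there [sigma] takes the value
   0. *)
have ex t : exists xi : cotangent (tag (al t)), a <= t <= b -> Tagged cot xi = psi t.
  have [tab|_] := boolP (a <= t <= b); last by exists 0.
  by have [xi xiE] := cot_cast (tagE t tab); exists xi.
pose sigma t := sval (cid (ex t)).
have sE t : a <= t <= b -> Tagged cot (sigma t) = psi t by exact: (svalP (cid (ex t))).
have ss : smooth_section a b sigma.
  case: cpsi => a' [b' [psi' [aa bb sp H]]]; exists a', b', psi'; split => //.
  by move=> t tab; rewrite H// sE//; move: tab; rewrite in_itv.
exists (covDal G a b (al := al)), sigma; split => //.
- exact: covDal_covariant.
move=> t; rewrite in_itv /= => tab.
have sD := covDal_section G ab valv ss.
apply: cotangent_ext => w; have [Y <-] := tangent_extend w; rewrite cotangent0E.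
have [a' [b' [f [aa bb sf Hf]]]] := curve_pairing Y sD.
have fE u : a <= u <= b -> f u = covDal G a b sigma u (Y (tag (al u))).
  by move=> uab; rewrite Hf// in_itv.
rewrite -fE//; apply: (eq0_closure ab tab).
  by apply: (@smooth_on_continuous _ _ _ `]a', b'[%classic) => //; exact: in_oo aa bb tab.
move=> u uab; have uab' : a <= u <= b by case/andP: uab => ? ?; rewrite !ltW.
rewrite fE//.
have du : deriv_in a b (pairing sigma Y) u
    (pair_bracket S (psi u) (Tagged tan (sr_g S (tagged (al u)))) Y).
  apply: (@deriv_in_ext _ _ _ (fun u => tagged (psi u) (Y (tag (psi u))))) => //.
    by move=> x xab; rewrite -sE.
  exact: ode.
have Qs : sr_Q0 S (sigma u).
  by have := Qpsi u uab'; rewrite -sE.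
rewrite (covDalE G ab valv ss uab' du) bracket_pair_Q; last exact: sr_g_Q.
rewrite -sE// (pair_bracketE G)//=; first by rewrite subrr.
exact: sr_g_Q.
Qed.

(** The abnormal equation is stated relative to admissible curves, so one is constructed beforehand,
    piece by piece over the subdivision of [psi]. Its pieces need not match at the break points. *)
Lemma abnormal_extremal_parallel (a b : R) (c : R -> M) psi :
  continuous_piecewise (@smooth_path R n M) a b c -> tangent_to_Q S a b c ->
  nonvanishing_Q0_section S a b c psi ->
  (forall al, admissible S a b c al -> forall X,
    {in `[a, b], forall t, (exists v, velocity a b c t v) ->
      deriv_in a b (fun u => tagged (psi u) (X (tag (psi u)))) t
        (pair_bracket S (psi t) (Tagged tan (sr_g S (tagged (al t)))) X)}) ->
  exists al, admissible S a b c al /\ parallel S (nabla G) a b c al psi.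
Proof.
move=> hc hQ [[m [s [piece [[sub _ Hp] ps]]]] psiP] ode.
have [m0 s0 sm ss] := sub.
have mono := subdivision_mono sub.
have psiE i u : (i < m)%N -> s i <= u <= s i.+1 -> piece i u = psi u.
  move=> im /andP[]; rewrite le_eqVlt => /orP[/eqP <- _|su us]; first exact: ps.
  by have [_ ->] := Hp i im; rewrite // in_itv /= su us.
have sab i u : (i < m)%N -> s i <= u <= s i.+1 -> a <= u <= b.
  by move=> im; exact: subdivision_in sub im.
have asi i : (i < m)%N -> a <= s i.
  by move=> im; rewrite -s0 mono// ltnW.
have bsi i : (i < m)%N -> s i.+1 <= b by move=> im; rewrite -sm mono.
have psic i u : (i < m)%N -> s i <= u <= s i.+1 ->
    tag (psi u) = c u /\ sr_Q0 S (tagged (psi u)).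
  by move=> im /(sab i u im) uab; have [|? _ ?] := psiP u; rewrite ?in_itv.
have cpsi i : (i < m)%N -> curve (@smooth_cot_path R n M) (s i) (s i.+1) psi.
  move=> im; have [[a' [b' [psi' [aa bb sp H]]]] _] := Hp i im.
  by exists a', b', psi'; split => // t tab; rewrite H// psiE.
have /choice[alp alpP] : forall i, exists al : R -> cotBundle M, (i < m)%N ->
  [/\ curve (@smooth_cot_path R n M) (s i) (s i.+1) al,
    forall t, s i <= t <= s i.+1 -> tag (al t) = c t &
    forall t, s i <= t <= s i.+1 ->
      velocity (s i) (s i.+1) (tag \o al) t (sr_g S (tagged (al t)))].
  move=> i; have [im|_] := boolP (i < m)%N; last by exists psi.
  have [|al alP] := lift_piece hQ (asi i im) (bsi i im) (ss i im) (cpsi i im).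
    by move=> t tsi; have [] := psic i t im tsi.
  by exists al.
(* At a break point the piece ending there is chosen, as left continuity requires, and at [a] the
   initial one; outside the interval [psi t] is a filler. *)
have /choice[al alE] : forall t, exists x, a <= t <= b ->
    exists i, [/\ (i < m)%N, s i <= t <= s i.+1, s i < t \/ (i = 0%N /\ t = a) & x =
      alp i t].
  move=> t; have [tab|_] := boolP (a <= t <= b); last by exists (psi t).
  by have [i im [ti H]] := subdivision_cover sub tab; exists (alp i t) => _; exists i.
have alpE i t : (i < m)%N -> s i < t -> t <= s i.+1 -> alp i t = al t.
  move=> im st ts; have [|j [jm /andP[_ tj] H ->]] := alE t.
    by apply: (sab i) => //; rewrite (ltW st).
  case: H => [sjt|[_ ta]]; last by move: st; rewrite ta ltNge asi.
  suff -> : i = j by [].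
  apply/eqP; rewrite eqn_leq; apply/andP; split; rewrite leqNgt; apply/negP => ij.
    by move: st; rewrite ltNge (le_trans tj)// mono// ltnW.
  by move: sjt; rewrite ltNge (le_trans ts)// mono// ltnW.
have alp0 : alp 0%N a = al a.
  have [|j [jm _ H ->]] := alE a; first by apply: (sab 0%N) => //;
    rewrite -s0 lexx ltW// ss.
  by case: H => [|[-> //]]; rewrite ltNge asi.
have adm : admissible_pieces S a b c m s al alp.
  split => //.
  - split => // i im; have [? _ _] := alpP i im; split => // t.
    by rewrite in_itv /= => /andP[st ts]; exact: alpE.
  - move=> t; rewrite in_itv /= => /alE[i [im sit _ ->]].
    by have [_ H _] := alpP i im; exact: H.
  - by move=> i im t; rewrite in_itv /=; have [_ _] := alpP i im; exact.
exists al; split; first by exists m, s, alp.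
exists m, s, alp; split => // i im.
have [_ tagal valp] := alpP i im.
apply: (parallel_piece (ss i im) (cpsi i im)) => //.
- by move=> t ti; rewrite tagal//; have [] := psic i t im ti.
- by move=> t ti; have [] := psic i t im ti.
move=> X t tsi; have ti : s i <= t <= s i.+1 by case/andP: tsi => ? ?; rewrite !ltW.
have [v vv _] := velocity_interior a b tsi tagal (valp t ti).
rewrite alpE//; [|by case/andP: tsi|by case/andP: ti].
apply: (deriv_in_sub (asi i im) (bsi i im)).
apply: ode; [by exists m, s, alp|by rewrite in_itv; exact: sab ti|by exists v].
Qed.

End AbnormalParallel.

Theorem theorem19 (R : realType) (n : nat) (M : smoothManifold R n)
    (S : subRiemannian M) (a b : R) (c : R -> M)
    (hc : continuous_piecewise (@smooth_path R n M) a b c)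
    (hQ : tangent_to_Q S a b c) :
  abnormal_extremal S a b c <->
  exists psi : R -> cotBundle M,
    nonvanishing_Q0_section S a b c psi /\
    exists nabla : oneform M -> oneform M -> oneform M,
      [/\ g_connection S nabla, Q_adapted S nabla &
          exists al : R -> cotBundle M,
            admissible S a b c al /\ parallel S nabla a b c al psi].
Proof.
split=> [[psi [psiQ ode]]|[psi [psiQ [nab [_ adapt [al [_ par]]]]]]].
  have [G] := gframe_exists S.
  exists psi; split => //; exists (nabla G); split.
  - exact: nabla_connection.
  - exact: nabla_Q_adapted.
  - exact: abnormal_extremal_parallel.
exact: parallel_abnormal_extremal psiQ adapt par.
Qed.
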